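(* Let $\mathscr{M}=\{m_j\}_{j\in\mathbb{N}_0}$ be a weight sequence. Let $\alpha\in\mathbb{C}\setminus\{0\}$, $\delta\in\mathbb{R}$, $\lambda=(\lambda_1,\dots,\lambda_n)\in\mathbb{R}^n$, $p_0=(p_{01},\dots,p_{0n})\in\mathbb{R}^n$, and let $q,s\in\mathcal{E}_{\mathscr{M}}(\mathbb{T}^1;\mathbb{R})$ with $q\ge0$ and $q_0:=\int_0^{2\pi}q(\tau)\,d\tau>0$. Consider the operator $P:\mathcal{E}_{\mathscr{M}}(\mathbb{T}^{n+1})\to\mathcal{E}_{\mathscr{M}}(\mathbb{T}^{n+1})$, in the variables $(t,x)\in\mathbb{T}^1\times\mathbb{T}^n$, given by $$Pu=Lu-(s(t)+i\delta q(t))u-\alpha q(t)\bar u,\qquad L=\frac{\partial}{\partial t}-\sum_{j=1}^n\left(p_{0j}+i\lambda_jq(t)\right)\frac{\partial}{\partial x_j}.$$ Put $s_0=\int_0^{2\pi}s(\tau)\,d\tau$, $A_0=s_0+i\delta q_0$, $B_0=\alpha q_0$ and $C_0=2\pi p_0+i\lambda q_0\in\mathbb{C}^n$. Assume that the following conditions hold: (I) $|\alpha|\ne|\delta|$; (II) there is no $(\xi,\tau)\in\mathbb{Z}^n\times\mathbb{Z}$ solution to $$\begin{cases}\mathrm{Re}\left(A_0(2\pi\tau+\xi\cdot\overline{C_0})\right)=0,\\ |2\pi\tau+\xi\cdot C_0|^2=|A_0|^2-|B_0|^2;\end{cases}$$ (III) for all $\varepsilon>0$ there exist $C_\varepsilon,\gamma_\varepsilon>0$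 such that if $\xi\in\mathbb{Z}^n$ and $\|\xi\|\ge\gamma_\varepsilon$, then $$\min\left\{\left|e^{-\rho_\xi q_0}-e^{s_0+i2\pi\xi\cdot p_0}\right|,\ \left|1-e^{-\rho_\xi q_0+s_0+i2\pi\xi\cdot p_0}\right|\right\}\ge C_\varepsilon\inf_{j\in\mathbb{N}_0}\frac{m_j\,j!}{\varepsilon^j(1+\|\xi\|)^j},$$ where $\rho_\xi\in\left\{\pm\sqrt{(\lambda\cdot\xi-i\delta)^2+|\alpha|^2}\right\}$ is chosen to satisfy $\mathrm{Re}(\rho_\xi)\ge0$. Then for all $f\in\mathcal{E}_{\mathscr{M}}(\mathbb{T}^{n+1})$ there exists $u\in\mathcal{E}_{\mathscr{M}}(\mathbb{T}^{n+1})$ such that $Pu=f$.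
   Context: $\mathbb{T}^N\simeq\mathbb{R}^N/2\pi\mathbb{Z}^N$; $\|\cdot\|$ is the Euclidean norm; $\mathbb{N}_0=\{0,1,2,\dots\}$; $a\cdot b=\sum_j a_jb_j$ (bilinear, no conjugation), and $\overline{C_0}$ is the componentwise conjugate. A weight sequence is a sequence $\mathscr{M}=\{m_j\}_{j\in\mathbb{N}_0}$ of positive reals such that (i) $m_0=m_1=1$; (ii) $m_j^2\le m_{j-1}m_{j+1}$ for all $j\ge 1$; (iii) there is $H\ge1$ with $m_{j+k}\le H^{j+k}m_jm_k$ for all $j,k\in\mathbb{N}_0$. $\mathcal{E}_{\mathscr{M}}(\mathbb{T}^N)$ is the space of smooth functions $f:\mathbb{T}^N\to\mathbb{C}$ for which there exist $C,h>0$ with $\sup_{x\in\mathbb{T}^N}|\partial^\beta f(x)|\le Ch^{|\beta|}m_{|\beta|}|\beta|!$ for all $\beta\in\mathbb{N}_0^N$; $\mathcal{E}_{\mathscr{M}}(\mathbb{T}^1;\mathbb{R})$ denotes the real-valued elements of $\mathcal{E}_{\mathscr{M}}(\mathbb{T}^1)$. *)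

(* Defs.v *)
(* Stdlib reals with Coquelicot; from MathComp only the index types 'I_N,
   sequences and big operators are used. *)
From Stdlib Require Import Reals.
From Coquelicot Require Import Coquelicot.
From mathcomp Require Import all_boot.
Set Implicit Arguments.
Unset Strict Implicit.
Unset Printing Implicit Defensive.

Local Open Scope R_scope.

Record weight_sequence (m : nat -> R) : Prop := WeightSequence {
  weight_pos : forall j, 0 < m j;
  weight_0 : m 0%nat = 1;
  weight_1 : m 1%nat = 1;
  (* m_j^2 <= m_(j-1) m_(j+1) for j >= 1, shifted by one to avoid truncated
     predecessors *)
  weight_logconvex : forall j, m j.+1 ^ 2 <= m j * m j.+2;
  weight_moderate : exists H, 1 <= H /\
    forall j k : nat, m (j + k)%N <= H ^ (j + k)%N * m j * m k
}.

(* A function on T^N is a 2*pi-periodic function on R^N = ('I_N -> R). *)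
Definition torus_periodic (N : nat) (f : ('I_N -> R) -> C) : Prop :=
  forall (x : 'I_N -> R) (k : 'I_N -> Z),
    f (fun j => x j + 2 * PI * IZR (k j)) = f x.

Definition upd (N : nat) (x : 'I_N -> R) (j : 'I_N) (r : R) : 'I_N -> R :=
  fun k => if k == j then r else x k.

Definition ex_pderiv (N : nat) (j : 'I_N) (f : ('I_N -> R) -> C)
    (x : 'I_N -> R) : Prop :=
  ex_derive (fun r => Re (f (upd x j r))) (x j) /\
  ex_derive (fun r => Im (f (upd x j r))) (x j).

(* [Derive] is total: the value is meaningful only under [ex_pderiv]. *)
Definition pderiv (N : nat) (j : 'I_N) (f : ('I_N -> R) -> C)
    (x : 'I_N -> R) : C :=
  (Derive (fun r => Re (f (upd x j r))) (x j),
   Derive (fun r => Im (f (upd x j r))) (x j)).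

(* C^oo: all iterated partial derivatives, in any order, exist and are
   continuous.  The topology on ('I_N -> R) is Coquelicot's uniform one, that
   is, the one of the sup norm on R^N. *)
Definition smooth (N : nat) (f : ('I_N -> R) -> C) : Prop :=
  forall (l : seq 'I_N) (x : 'I_N -> R),
    continuous (foldr (@pderiv N) f l) x /\
    forall j : 'I_N, ex_pderiv j (foldr (@pderiv N) f l) x.

Definition mderiv (N : nat) (beta : 'I_N -> nat) (f : ('I_N -> R) -> C) :
    ('I_N -> R) -> C :=
  foldr (fun j g => iter (beta j) (@pderiv N j) g) f (enum 'I_N).

Definition mlength (N : nat) (beta : 'I_N -> nat) : nat :=
  (\sum_(j < N) beta j)%N.

Definition class_EM (m : nat -> R) (N : nat) (f : ('I_N -> R) -> C) : Prop :=
  torus_periodic f /\ smooth f /\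
  exists K h : R, 0 < K /\ 0 < h /\
    forall (beta : 'I_N -> nat) (x : 'I_N -> R),
      Cmod (mderiv beta f x) <=
        K * h ^ mlength beta * m (mlength beta) * INR (mlength beta)`!.

(* E_M(T^1; R), with elements written as functions of a real variable *)
Definition class_EM1_real (m : nat -> R) (g : R -> R) : Prop :=
  class_EM m (fun x : 'I_1 -> R => RtoC (g (x ord0))).

Definition dotR (n : nat) (a b : 'I_n -> R) : R :=
  \big[Rplus/0]_(j < n) (a j * b j).

Definition dotC (n : nat) (a b : 'I_n -> C) : C :=
  \big[Cplus/RtoC 0]_(j < n) (a j * b j)%C.

Definition ZtoR (n : nat) (xi : 'I_n -> Z) : 'I_n -> R := fun j => IZR (xi j).

Definition ZtoC (n : nat) (xi : 'I_n -> Z) : 'I_n -> C :=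
  fun j => RtoC (IZR (xi j)).

Definition enorm (n : nat) (a : 'I_n -> R) : R := sqrt (dotR a a).

Definition cexp (z : C) : C := (exp (Re z) * cos (Im z), exp (Re z) * sin (Im z)).

(* Coordinate ord0 of R^(n+1) is t, coordinate lift ord0 j is x_j. *)
Definition opL (n : nat) (lam p0 : 'I_n -> R) (q : R -> R)
    (u : ('I_n.+1 -> R) -> C) (y : 'I_n.+1 -> R) : C :=
  (pderiv ord0 u y -
   \big[Cplus/RtoC 0]_(j < n)
     ((RtoC (p0 j) + Ci * RtoC (lam j) * RtoC (q (y ord0))) *
      pderiv (lift ord0 j) u y))%C.

Definition opP (n : nat) (alpha : C) (delta : R) (lam p0 : 'I_n -> R)
    (q s : R -> R) (u : ('I_n.+1 -> R) -> C) (y : 'I_n.+1 -> R) : C :=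
  (opL lam p0 q u y
   - (RtoC (s (y ord0)) + Ci * RtoC delta * RtoC (q (y ord0))) * u y
   - alpha * RtoC (q (y ord0)) * Cconj (u y))%C.

(* Main.v *)
(* Write u and f as Fourier series in x.  As P is only R-linear, it couples
   the frequencies xi and -xi: with v_xi = conj u_(-xi), the equation Pu = f
   becomes the periodic 2x2 system
     w' = (s + i xi.p0) w + q M w + F,
     M = [[-xi.lam + i delta, alpha], [conj alpha, xi.lam - i delta]],
   for w = (u_xi, v_xi), F = (f_xi, conj f_(-xi)), where M^2 = rho_xi^2.  By
   (I), |rho_xi| is bounded below, so the system splits into scalar equations
   with coefficients s + i xi.p0 +- rho_xi q.  Condition (II) says exactly that
   none of their monodromies exp (s0 + 2 i pi xi.p0 +- rho_xi q0) is 1, so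
   each has a periodic solution.  Integrating over one period in the direction
   in which exp (+-rho_xi q) decays bounds it by sup |f_xi| divided by one of
   the quantities of (III).  Moderate growth of m shows that this division
   preserves the decay in xi, and the equation itself then controls the
   t-derivatives.  Averaging the solution with its image under the symmetry
   (u, v) |-> (conj v_(-xi), conj u_(-xi)) enforces v_xi = conj u_(-xi).
   Fourier inversion in x is obtained from iterated Fejer means. *)

Require Import Defs.
From HB Require Import structures.
From Stdlib Require Import Reals ZArith Lra Lia FunctionalExtensionality ClassicalEpsilon.
From Coquelicot Require Import Coquelicot.
From mathcomp Require Import all_boot.
Set Implicit Arguments.
Unset Strict Implicit.
Unset Printing Implicit Defensive.
Local Open Scope R_scope.
(* mathcomp rebinds the delimiter R to its own ring_scope. *)
Delimit Scope R_scope with RR.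

(** * Complex-valued functions of a real variable *)

(** Every loss in the argument is one power of [freq xi]: the entries of M, its eigenvalues and
    [kap] grow linearly in it, hence so does the cost of each t-derivative, and diagonalising M
    costs a further factor of the size of [m11 / rho]. [EMfam] therefore counts t-derivatives and
    powers of the frequency by one common index k + b; a loss shifts this index by one, which
    moderate growth absorbs. (III) speaks only of large frequencies. The finitely many others have a
    positive minimal denominator, because (II) excludes monodromy 1 at each of them. Inversion needs
    no uniqueness theorem: the same Fejer weights truncate the series of u and that of f, the
    equation is checked coefficientwise on each truncation, and both sides pass to the limit.
    Evenness of the weights makes truncation commute with conjugation; nonnegativity of the kernel
    keeps iterated means bounded. Complex bounds come from real and imaginary parts separately,
    whence the harmless factors 2 throughout. *)

Lemma C_eq (z w : C) : Re z = Re w -> Im z = Im w -> z = w.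
Proof. by case: z => a b; case: w => c d /= -> ->. Qed.

Lemma Cmod_le_abs (z : C) : Cmod z <= Rabs (Re z) + Rabs (Im z).
Proof.
have {1}-> : z = (RtoC (Re z) + Ci * RtoC (Im z))%C.
  by case: z => a b; apply: C_eq => /=; ring.
apply: Rle_trans (Cmod_triangle _ _) _.
by rewrite Cmod_mult Cmod_Ci !Cmod_R; lra.
Qed.

Lemma Rabs_Re_le (z : C) : Rabs (Re z) <= Cmod z.
Proof. exact: re_le_Cmod. Qed.

Lemma Rabs_Im_le (z : C) : Rabs (Im z) <= Cmod z.
Proof. by apply: Rle_trans (Rmax_Cmod z); apply: Rmax_r. Qed.

Lemma Cmod_sub_le (x y : C) : Cmod (x - y) <= Cmod x + Cmod y.
Proof. by rewrite -(Cmod_opp y); apply: Cmod_triangle. Qed.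

Lemma cexp_add (z w : C) : cexp (z + w) = (cexp z * cexp w)%C.
Proof.
rewrite /cexp (_ : Re (z + w)%C = Re z + Re w) // (_ : Im (z + w)%C = Im z + Im w) //.
by rewrite exp_plus cos_plus sin_plus /Cmult /=; congr pair; ring.
Qed.

Lemma cexp0 : cexp (RtoC 0) = RtoC 1.
Proof. by apply: C_eq; rewrite /cexp /= exp_0 ?cos_0 ?sin_0; ring. Qed.

Lemma cexp_neq0 (z : C) : cexp z <> RtoC 0.
Proof.
move=> e; have : (cexp z * cexp (- z))%C = RtoC 1.
  by rewrite -cexp_add -cexp0; congr cexp; ring.
by rewrite e Cmult_0_l => /RtoC_inj; lra.
Qed.

Lemma cexp_opp (z : C) : cexp (- z) = (/ cexp z)%C.
Proof.
have h : (cexp z * cexp (- z))%C = RtoC 1.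
  by rewrite -cexp_add -cexp0; congr cexp; ring.
rewrite -(Cmult_1_r (/ cexp z)) -h; field; exact: cexp_neq0.
Qed.

Lemma Cmod_cexp (z : C) : Cmod (cexp z) = exp (Re z).
Proof.
rewrite /Cmod /cexp /=.
have -> : exp (Re z) * cos (Im z) * (exp (Re z) * cos (Im z) * 1) +
  exp (Re z) * sin (Im z) * (exp (Re z) * sin (Im z) * 1)
  = exp (Re z) ^ 2 * ((sin (Im z))² + (cos (Im z))²).
  by rewrite /Rsqr; ring.
rewrite sin2_cos2 Rmult_1_r sqrt_pow2 //; exact: Rlt_le (exp_pos _).
Qed.

Definition cderiv (f : R -> C) (x : R) (l : C) :=
  is_derive (fun r => Re (f r)) x (Re l) /\
  is_derive (fun r => Im (f r)) x (Im l).

Definition CD (f : R -> C) (x : R) : C :=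
  (Derive (fun r => Re (f r)) x, Derive (fun r => Im (f r)) x).

Lemma cderiv_unique f x l : cderiv f x l -> CD f x = l.
Proof. by case=> h1 h2; apply: C_eq => /=; apply: is_derive_unique. Qed.

Lemma cderiv_CD f x :
  ex_derive (fun r => Re (f r)) x -> ex_derive (fun r => Im (f r)) x ->
  cderiv f x (CD f x).
Proof. by move=> h1 h2; split; apply: Derive_correct. Qed.

Lemma cderiv_eq f x l l' : cderiv f x l -> l = l' -> cderiv f x l'.
Proof. by move=> h <-. Qed.

Lemma cderiv_ext f g x l : (forall t, f t = g t) -> cderiv f x l -> cderiv g x l.
Proof.
move=> e [h1 h2]; split; [move: h1|move: h2];
by apply: is_derive_ext => t; rewrite e.
Qed.

Lemma cderiv_const c x : cderiv (fun _ => c) x (RtoC 0).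
Proof. by split; apply: is_derive_const. Qed.

Lemma cderiv_plus f g x l k :
  cderiv f x l -> cderiv g x k -> cderiv (fun t => (f t + g t)%C) x (l + k)%C.
Proof. by case=> ? ? [? ?]; split; apply: is_derive_plus. Qed.

Lemma cderiv_opp f x l : cderiv f x l -> cderiv (fun t => (- f t)%C) x (- l)%C.
Proof. by case=> ? ?; split; apply: is_derive_opp. Qed.

Lemma cderiv_minus f g x l k :
  cderiv f x l -> cderiv g x k -> cderiv (fun t => (f t - g t)%C) x (l - k)%C.
Proof. by move=> h1 h2; apply: cderiv_plus => //; apply: cderiv_opp. Qed.

Lemma cderiv_mult f g x l k :
  cderiv f x l -> cderiv g x k ->
  cderiv (fun t => (f t * g t)%C) x (l * g x + f x * k)%C.
Proof.
have mul (u v : R -> R) y a b : is_derive u y a -> is_derive v y b ->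
  is_derive (fun t => u t * v t) y (a * v y + u y * b).
  by move=> hu hv; apply: (@is_derive_mult R_AbsRing) => // n m; exact: Rmult_comm.
case=> h1 h2 [h3 h4]; split.
- have := @is_derive_minus _ _ _ _ _ _ _ (mul _ _ _ _ _ h1 h3) (mul _ _ _ _ _ h2 h4).
  move=> /= H; apply: (eq_rect _ (is_derive _ x) H).
  by rewrite /minus /plus /opp /= /Re /Im; ring.
- have := @is_derive_plus _ _ _ _ _ _ _ (mul _ _ _ _ _ h1 h4) (mul _ _ _ _ _ h2 h3).
  move=> /= H; apply: (eq_rect _ (is_derive _ x) H).
  by rewrite /plus /= /Re /Im; ring.
Qed.

Lemma cderiv_scal c f x l : cderiv f x l -> cderiv (fun t => (c * f t)%C) x (c * l)%C.
Proof.
move=> h; apply: cderiv_eq (cderiv_mult (cderiv_const c x) h) _.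
ring.
Qed.

Lemma cderiv_conj f x l : cderiv f x l -> cderiv (fun t => Cconj (f t)) x (Cconj l).
Proof. by case=> h1 h2; split => //; apply: (@is_derive_opp R_AbsRing). Qed.

Lemma cderiv_RtoC (f : R -> R) x l : is_derive f x l -> cderiv (fun t => RtoC (f t)) x (RtoC l).
Proof. by move=> h; split => //; apply: (@is_derive_const R_AbsRing). Qed.

Lemma cderiv_cexp f x l : cderiv f x l ->
  cderiv (fun t => cexp (f t)) x (l * cexp (f x))%C.
Proof.
case=> h1 h2.
have e1 : is_derive (fun t => exp (Re (f t))) x (Re l * exp (Re (f x))).
  by apply: is_derive_comp => //; apply: is_derive_exp.
have e2 : is_derive (fun t => cos (Im (f t))) x (Im l * - sin (Im (f x))).
  by apply: is_derive_comp => //; apply: is_derive_cos.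
have e3 : is_derive (fun t => sin (Im (f t))) x (Im l * cos (Im (f x))).
  by apply: is_derive_comp => //; apply: is_derive_sin.
have H := cderiv_mult (cderiv_RtoC e1)
  (conj e2 e3 : cderiv (fun t => (cos (Im (f t)), sin (Im (f t)))) x (_, _)).
move: H => /cderiv_ext; move/(_ (fun t => cexp (f t))) => H.
apply: cderiv_eq (H _) _.
  by move=> t; apply: C_eq; rewrite /cexp /= /Re /Im; ring.
by apply: C_eq; rewrite /cexp /= /Re /Im; ring.
Qed.

Lemma cderiv_shift f x c l : cderiv f (x + c) l -> cderiv (fun t => f (t + c)) x l.
Proof.
have sh : is_derive (fun t : R => t + c) x 1.
  by auto_derive => //.
case=> h1 h2; split.
- by rewrite -[Re l]Rmult_1_l; apply: (@is_derive_comp R_AbsRing _ (fun r => Re (f r))).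
- by rewrite -[Im l]Rmult_1_l; apply: (@is_derive_comp R_AbsRing _ (fun r => Im (f r))).
Qed.

(** The mean value theorem fails for complex values; it is applied to each of the two components,
    which costs the factor 2. *)
Lemma cderiv_bound (f df : R -> C) (D a b : R) : a <= b ->
  (forall t, a <= t <= b -> cderiv f t (df t) /\ Cmod (df t) <= D) ->
  Cmod (f b - f a) <= 2 * D * (b - a).
Proof.
move=> ab h.
have bnd (g dg : R -> R) : (forall t, a <= t <= b -> is_derive g t (dg t) /\ Rabs (dg t) <= D) ->
   Rabs (g b - g a) <= D * (b - a).
  move=> H.
  have [|x|xi [hc ->]] := MVT_gen g a b dg.
  - by move=> x; rewrite Rmin_left // Rmax_right // => hx; apply H; lra.
  - rewrite Rmin_left // Rmax_right // => hx.
    apply/continuity_pt_filterlim/(@ex_derive_continuous R_AbsRing R_NormedModule).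
    by eexists; apply H.
  move: hc; rewrite Rmin_left // Rmax_right // => hc.
  rewrite Rabs_mult (Rabs_pos_eq (b - a)); last lra.
  by apply: Rmult_le_compat_r; [lra|apply H].
apply: Rle_trans (Cmod_le_abs _) _.
have h1 := bnd (fun r => Re (f r)) (fun r => Re (df r)) _.
have h2 := bnd (fun r => Im (f r)) (fun r => Im (df r)) _.
have /= H1 : Rabs (Re (f b) - Re (f a)) <= D * (b - a).
  apply: h1 => t /h [[? ?] ?]; split=> //; exact: Rle_trans (Rabs_Re_le _) _.
have /= H2 : Rabs (Im (f b) - Im (f a)) <= D * (b - a).
  apply: h2 => t /h [[? ?] ?]; split=> //; exact: Rle_trans (Rabs_Im_le _) _.
by apply: Rle_trans (Rplus_le_compat _ _ _ _ H1 H2) _; lra.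
Qed.

Lemma cderiv0_const (f : R -> C) (a b : R) :
  (forall t, cderiv f t (RtoC 0)) -> f a = f b.
Proof.
have aux (g : R -> R) : (forall t, is_derive g t 0) -> forall x y, x < y -> g x = g y.
  by move=> h x y xy; apply: (@eq_is_derive R_NormedModule g) => // t _.
move=> h; have [ab|[->//|ab]] := Rtotal_order a b; apply: C_eq.
- by apply: (aux (fun r => Re (f r))) => // t; case: (h t).
- by apply: (aux (fun r => Im (f r))) => // t; case: (h t).
- by apply/esym/(aux (fun r => Re (f r))) => // t; case: (h t).
- by apply/esym/(aux (fun r => Im (f r))) => // t; case: (h t).
Qed.

Definition ccont (T : UniformSpace) (f : T -> C) (x : T) :=
  continuous (fun r => Re (f r)) x /\ continuous (fun r => Im (f r)) x.

Lemma ccontP (T : UniformSpace) (f : T -> C) (x : T) : ccont f x <-> continuous f x.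
Proof.
split.
- case=> h1 h2.
  apply/filterlim_locally => eps.
  move/filterlim_locally/(_ eps): h1 => h1; move/filterlim_locally/(_ eps): h2 => h2.
  exact: filter_and h1 h2.
- move=> h; split.
  + by apply: (continuous_comp f (fun z : C => z.1)) => //; exact: continuous_fst.
  + by apply: (continuous_comp f (fun z : C => z.2)) => //; exact: continuous_snd.
Qed.

Lemma cderiv_ccont f (x : R) l : cderiv f x l -> ccont (T := R_UniformSpace) f x.
Proof.
by case=> h1 h2; split; apply: (@ex_derive_continuous R_AbsRing R_NormedModule); eexists; eauto.
Qed.

Lemma ccont_mult (T : UniformSpace) (f g : T -> C) (x : T) :
  ccont f x -> ccont g x -> ccont (fun t => (f t * g t)%C) x.
Proof.
case=> a b [c d]; split => /=.
- apply: (@continuous_minus T R_AbsRing R_NormedModule (fun t => Re (f t) * Re (g t)) (fun t => Im (f t) * Im (g t))).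
  + exact: (@continuous_mult T R_AbsRing).
  + exact: (@continuous_mult T R_AbsRing).
- apply: (@continuous_plus T R_AbsRing R_NormedModule (fun t => Re (f t) * Im (g t)) (fun t => Im (f t) * Re (g t))).
  + exact: (@continuous_mult T R_AbsRing).
  + exact: (@continuous_mult T R_AbsRing).
Qed.

Lemma ccont_plus (T : UniformSpace) (f g : T -> C) (x : T) :
  ccont f x -> ccont g x -> ccont (fun t => (f t + g t)%C) x.
Proof.
case=> a b [c d]; split => /=.
- exact: (@continuous_plus T R_AbsRing R_NormedModule (fun t => Re (f t)) (fun t => Re (g t))).
- exact: (@continuous_plus T R_AbsRing R_NormedModule (fun t => Im (f t)) (fun t => Im (g t))).
Qed.

Lemma ccont_const (T : UniformSpace) (c : C) (x : T) : ccont (fun _ => c) x.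
Proof. by split; apply: continuous_const. Qed.

Lemma ccont_scal (T : UniformSpace) (c : C) (f : T -> C) (x : T) :
  ccont f x -> ccont (fun t => (c * f t)%C) x.
Proof. by move=> h; apply: ccont_mult => //; apply: ccont_const. Qed.

Lemma ccont_ext (T : UniformSpace) (f g : T -> C) (x : T) :
  (forall t, f t = g t) -> ccont f x -> ccont g x.
Proof.
by move=> e [h1 h2]; split; [move: h1|move: h2]; apply: continuous_ext => t; rewrite e.
Qed.

(** * Integrals of complex-valued functions *)

Definition CInt (f : R -> C) (a b : R) : C :=
  (RInt (fun r => Re (f r)) a b, RInt (fun r => Im (f r)) a b).

Notation Rcont f := (forall t : R, ccont (T := R_UniformSpace) f t).

Lemma CInt_ext f g a b : (forall t, f t = g t) -> CInt f a b = CInt g a b.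
Proof. by move=> e; rewrite /CInt; congr pair; apply: RInt_ext => t _; rewrite e. Qed.

Lemma ex_RInt_cont (f : R -> R) a b : (forall t : R, continuous f t) -> ex_RInt f a b.
Proof. by move=> h; apply: (@ex_RInt_continuous R_CompleteNormedModule) => t _. Qed.

Lemma is_derive_RInt_cont (f : R -> R) a t : (forall t : R, continuous f t) ->
  is_derive (RInt f a) t (f t).
Proof.
move=> h; apply: (@is_derive_RInt R_NormedModule f (RInt f a) a) => //.
apply: filter_forall => x.
by apply: (@RInt_correct R_CompleteNormedModule); apply: ex_RInt_cont.
Qed.

Lemma cderiv_CInt f a t : Rcont f -> cderiv (CInt f a) t (f t).
Proof.
by move=> h; split; apply: is_derive_RInt_cont => r; case: (h r).
Qed.

Lemma CInt_point f a : CInt f a a = RtoC 0.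
Proof. by rewrite /CInt !RInt_point. Qed.

Lemma CInt_FTC F f a b : Rcont f -> (forall t, cderiv F t (f t)) ->
  CInt f a b = (F b - F a)%C.
Proof.
move=> hc hd.
have : (CInt f a b - F b = CInt f a a - F a)%C.
  apply: (@cderiv0_const (fun b => CInt f a b - F b)%C) => t.
  apply: cderiv_eq (cderiv_minus (cderiv_CInt a t hc) (hd t)) _; ring.
rewrite CInt_point => h.
have -> : CInt f a b = (CInt f a b - F b + F b)%C by ring.
by rewrite h; ring.
Qed.

(** Both sides are primitives in the upper limit, so the fundamental theorem gives linearity without
    going back to components. *)
Lemma CInt_plus f g a b : Rcont f -> Rcont g ->
  CInt (fun t => f t + g t)%C a b = (CInt f a b + CInt g a b)%C.
Proof.
move=> hf hg.
rewrite (@CInt_FTC (fun t => CInt f a t + CInt g a t)%C).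
- by rewrite !CInt_point; ring.
- by move=> t; apply: ccont_plus.
- by move=> t; apply: cderiv_plus; apply: cderiv_CInt.
Qed.

Lemma CInt_scal c f a b : Rcont f ->
  CInt (fun t => c * f t)%C a b = (c * CInt f a b)%C.
Proof.
move=> hf.
rewrite (@CInt_FTC (fun t => c * CInt f a t)%C).
- by rewrite !CInt_point; ring.
- by move=> t; apply: ccont_scal.
- by move=> t; apply: cderiv_scal; apply: cderiv_CInt.
Qed.

Lemma CInt_le f a b M : a <= b -> Rcont f -> (forall t, a <= t <= b -> Cmod (f t) <= M) ->
  Cmod (CInt f a b) <= 2 * M * (b - a).
Proof.
move=> ab hf hM.
have -> : CInt f a b = (CInt f a b - CInt f a a)%C by rewrite CInt_point; ring.
apply: (@cderiv_bound (CInt f a) f) => // t tab; split; [exact: cderiv_CInt|exact: hM].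
Qed.

(** * Weight sequences *)

Lemma INR_leq (a b : nat) : (a <= b)%N -> INR a <= INR b.
Proof. by move/leP/le_INR. Qed.

Lemma INR_mul (a b : nat) : INR (a * b)%N = INR a * INR b.
Proof. exact: mult_INR. Qed.

Lemma INR_exp (a k : nat) : INR (a ^ k)%N = INR a ^ k.
Proof. by elim: k => [|k IH] //; rewrite expnS INR_mul IH. Qed.

Lemma bin_le_exp2 (k i : nat) : ('C(k, i) <= 2 ^ k)%N.
Proof.
elim: k i => [|k IH] [|i] //; first by rewrite bin0 expn_gt0.
by rewrite binS expnS mul2n -addnn leq_add.
Qed.

(** The binomial coefficient increases with its upper argument, and C(k+b, i) times the two
    factorials is exactly (k+b)!. *)
Lemma bin_mul_fact_le (k i b : nat) : (i <= k)%N ->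
  ('C(k, i) * (i`! * (k - i + b)`!) <= (k + b)`!)%N.
Proof.
move=> ik; rewrite -(@bin_fact (k + b) i) ?(leq_trans ik) ?leq_addr //.
rewrite addnBAC // leq_mul2r; apply/orP; right.
elim: b => [|b IH]; first by rewrite addn0.
by apply: leq_trans IH _; rewrite addnS; case: (i) => [|i']; rewrite ?bin0 ?binS ?leq_addr.
Qed.

(** Weight and factorial always occur together; all later bounds are written on the scale of their
    product. *)
Definition wfact (m : nat -> R) (j : nat) : R := m j * INR j`!.

Section Weights.
Variables (m : nat -> R) (hm : weight_sequence m).
Let W := wfact m.

Lemma weight_gt0 j : 0 < m j. Proof. exact: weight_pos. Qed.

(** Log-convexity makes the ratios m_(j+1) / m_j nondecreasing; this is the cross-multiplied
    form. *)
Lemma weight_ratio i j : m j.+1 * m (i + j)%N <= m (i + j).+1 * m j.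
Proof.
elim: i => [|i IH]; first by rewrite add0n; lra.
have h := weight_logconvex hm (i + j).
have p1 := weight_gt0 (i + j); have p2 := weight_gt0 (i + j).+1; have p3 := weight_gt0 j.
have p4 := weight_gt0 (i+j).+2; have p5 := weight_gt0 j.+1.
rewrite addSn; apply: (Rmult_le_reg_r (m (i + j)%N)) => //.
apply: (Rle_trans _ (m (i + j).+1 * m j * m (i + j).+1)).
  have := Rmult_le_compat_r _ _ _ (Rlt_le _ _ p2) IH; lra.
have := Rmult_le_compat_r _ _ _ (Rlt_le _ _ p3) h; lra.
Qed.

(** Starting from m_0 = 1, the ratio inequality multiplies up: the product of j ratios beginning at
    i dominates the one beginning at 0. *)
Lemma weight_supermul i j : m i * m j <= m (i + j)%N.
Proof.
elim: j => [|j IH]; first by rewrite addn0 (weight_0 hm); lra.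
have h := weight_ratio i j.
have p1 := weight_gt0 j; have p2 := weight_gt0 j.+1; have p3 := weight_gt0 i.
rewrite addnS; apply: (Rmult_le_reg_r (m j)) => //.
have := Rmult_le_compat_r _ _ _ (Rlt_le _ _ p2) IH; lra.
Qed.

Lemma weight_mono j : m j <= m j.+1.
Proof. by have := weight_supermul j 1; rewrite (weight_1 hm) addn1; lra. Qed.

Lemma wfact_gt0 j : 0 < W j.
Proof.
apply: Rmult_lt_0_compat; first exact: weight_gt0.
by apply/lt_0_INR/ltP; rewrite fact_gt0.
Qed.

Lemma wfact_ge0 j : 0 <= W j. Proof. exact: Rlt_le (wfact_gt0 j). Qed.

Lemma wfact0 : W 0 = 1.
Proof. by rewrite /W /wfact (weight_0 hm) /=; ring. Qed.

Lemma wfact1 : W 1 = 1.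
Proof. by rewrite /W /wfact (weight_1 hm) /=; ring. Qed.

Lemma wfactS j : W j <= W j.+1.
Proof.
apply: Rmult_le_compat; [exact: Rlt_le (weight_gt0 _)|exact: pos_INR|exact: weight_mono|].
by apply: INR_leq; rewrite factS leq_pmull.
Qed.

Lemma wfact_mono i j : (i <= j)%N -> W i <= W j.
Proof.
move/subnK <-; elim: (j - i)%N => [|d IH]; first by rewrite add0n; lra.
exact: Rle_trans IH (wfactS _).
Qed.

(** This closes the Leibniz rule: a term with i derivatives on the coefficient and k - i on the
    solution fits into one weight of the total order. The extra b leaves room for powers of the
    frequency. *)
Lemma wfact_binom k i b : (i <= k)%N ->
  INR 'C(k, i) * (W i * W (k - i + b)) <= W (k + b)%N.
Proof.
move=> ik; rewrite /W /wfact.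
apply: (Rle_trans _ ((m i * m (k - i + b)%N) * INR ('C(k, i) * (i`! * (k - i + b)`!))%N)).
  by rewrite !INR_mul; apply: Req_le; ring.
apply: Rmult_le_compat.
- by apply: Rmult_le_pos; apply: Rlt_le; exact: weight_gt0.
- exact: pos_INR.
- by apply: Rle_trans (weight_supermul _ _) _; rewrite addnA subnKC //; lra.
- by apply: INR_leq; exact: bin_mul_fact_le.
Qed.

Lemma wfact_moderate : exists H, 1 <= H /\
  forall j k : nat, W (j + k)%N <= H ^ (j + k)%N * W j * W k.
Proof.
have [H [H1 hH]] := weight_moderate hm.
(* The 2 pays for the binomial coefficient (j+k)! / (j! k!), at most 2^(j+k). *)
exists (2 * H); split; first lra.
move=> j k; rewrite /W /wfact -(@bin_fact (j + k) j) ?leq_addr // addKn.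
rewrite !INR_mul Rpow_mult_distr.
have p : 0 <= H ^ (j + k)%N by apply: pow_le; lra.
apply: (Rle_trans _ ((H ^ (j + k)%N * m j * m k) * (2 ^ (j + k)%N * (INR j`! * INR k`!)))).
  apply: Rmult_le_compat => //.
  - exact: Rlt_le (weight_gt0 _).
  - by repeat apply: Rmult_le_pos; exact: pos_INR.
  - apply: Rmult_le_compat_r; first by apply: Rmult_le_pos; exact: pos_INR.
    have -> : 2 ^ (j + k)%N = INR (2 ^ (j + k))%N by rewrite INR_exp.
    by apply: INR_leq; exact: bin_le_exp2.
by apply: Req_le; ring.
Qed.

End Weights.

(** * Periodic scalar ODEs *)

Notation periodic f := (forall t, f (t + 2 * PI)%RR = f t).

(** Periodicity of the integrand makes the increment over a period independent of the starting
    point. *)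
Lemma primitive_quasi_periodic (A a : R -> C) : periodic a ->
  (forall t, cderiv A t (a t)) -> A 0 = RtoC 0 ->
  forall t, A (t + 2 * PI)%RR = (A t + A (2 * PI)%RR)%C.
Proof.
move=> pa hA A0 t.
have : (A (t + 2 * PI)%RR - A t = A (0 + 2 * PI)%RR - A 0)%C.
  apply: (@cderiv0_const (fun t => A (t + 2 * PI)%RR - A t)%C) => x.
  apply: cderiv_eq (cderiv_minus (cderiv_shift (hA _)) (hA _)) _.
  by rewrite pa; ring.
rewrite A0 Rplus_0_l => h.
have -> : A (t + 2 * PI)%RR = (A (t + 2 * PI)%RR - A t + A t)%C by ring.
by rewrite h; ring.
Qed.

Definition ode_coef (s q : R -> R) (kap : R) (r : C) (t : R) : C :=
  (RtoC (s t) + Ci * RtoC kap + r * RtoC (q t))%C.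

(** The factor gained over one period by solutions of the homogeneous equation with coefficient
    [ode_coef s q kap r]. *)
Definition monodromy (s q : R -> R) (kap : R) (r : C) : C :=
  cexp (RtoC (RInt s 0 (2 * PI)%RR) + Ci * RtoC (2 * PI * kap)%RR
        + r * RtoC (RInt q 0 (2 * PI)%RR)).

Section PeriodicODE.
Variables (s q : R -> R) (kap : R) (r : C) (g : R -> C) (Sb : R).
Hypotheses (cs : forall t : R, continuous s t) (cq : forall t : R, continuous q t).
Hypotheses (ps : periodic s) (pq : periodic q) (pg : periodic g) (cg : Rcont g).
Hypotheses (q_ge0 : forall t, 0 <= q t) (s_le : forall t, Rabs (s t) <= Sb).
Let a := ode_coef s q kap r.
Let E := monodromy s q kap r.
Hypothesis E1 : E <> RtoC 1.

Let Phi t : C := (RtoC (RInt s 0 t) + Ci * RtoC (kap * t)%RR + r * RtoC (RInt q 0 t))%C.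

Let Phi_deriv t : cderiv Phi t (a t).
Proof.
apply: cderiv_plus; first apply: cderiv_plus.
- exact/cderiv_RtoC/is_derive_RInt_cont.
- apply/cderiv_scal/cderiv_RtoC.
  by auto_derive => //; ring.
- exact/cderiv_scal/cderiv_RtoC/is_derive_RInt_cont.
Qed.

Let Phi0 : Phi 0 = RtoC 0.
Proof. by rewrite /Phi !RInt_point Rmult_0_r; apply: C_eq => /=; rewrite /zero /=; ring. Qed.

Let PhiE : cexp (Phi (2 * PI)%RR) = E.
Proof. by rewrite /Phi /E /monodromy (Rmult_comm kap). Qed.

Let Phi_shift t : Phi (t + 2 * PI)%RR = (Phi t + Phi (2 * PI)%RR)%C.
Proof.
apply: (@primitive_quasi_periodic _ a) => // x.
by rewrite /a /ode_coef ps pq.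
Qed.

Let twisted t : C := (cexp (- Phi t) * g t)%C.

Let Phi_deriv_opp t : cderiv (fun t => - Phi t)%C t (- a t)%C.
Proof. exact/cderiv_opp. Qed.

Let twisted_cont : Rcont twisted.
Proof.
by move=> t; apply: ccont_mult => //; apply/cderiv_ccont/cderiv_cexp/Phi_deriv_opp.
Qed.

(** The initial value is forced by periodicity: with I the integral of [twisted] over a period, u(2
    pi) = E (c0 + I) must equal u(0) = c0. *)
Let c0 : C := (E / (RtoC 1 - E) * CInt twisted 0 (2 * PI)%RR)%C.

Let u t : C := (cexp (Phi t) * (c0 + CInt twisted 0 t))%C.

Let E_sub : (RtoC 1 - E)%C <> RtoC 0.
Proof.
move=> h; apply: E1; have -> : E = (RtoC 1 - (RtoC 1 - E))%C by ring.
by rewrite h; ring.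
Qed.

Let E_neq0 : E <> RtoC 0.
Proof. exact: cexp_neq0. Qed.

Let u_periodic : periodic u.
Proof.
move=> t; rewrite /u Phi_shift cexp_add PhiE.
have -> : CInt twisted 0 (t + 2 * PI)%RR = (CInt twisted 0 (2 * PI)%RR + / E * CInt twisted 0 t)%C.
  have H : (CInt twisted 0 (t + 2 * PI)%RR - / E * CInt twisted 0 t =
     CInt twisted 0 (0 + 2 * PI)%RR - / E * CInt twisted 0 0)%C.
    apply: (@cderiv0_const (fun t => CInt twisted 0 (t + 2 * PI)%RR - / E * CInt twisted 0 t)%C) => x.
    apply: cderiv_eq (cderiv_minus (cderiv_shift (cderiv_CInt _ _ twisted_cont)) (cderiv_scal _ (cderiv_CInt _ _ twisted_cont))) _.
    rewrite /twisted pg Phi_shift (_ : (- (Phi x + Phi (2 * PI)%RR))%C = (- Phi x + - Phi (2 * PI)%RR)%C); last by ring.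
    by rewrite cexp_add (cexp_opp (Phi (2 * PI)%RR)) PhiE; ring.
  rewrite Rplus_0_l CInt_point in H.
  have -> : CInt twisted 0 (t + 2 * PI)%RR = (CInt twisted 0 (t + 2 * PI)%RR - / E * CInt twisted 0 t + / E * CInt twisted 0 t)%C by ring.
  by rewrite H; ring.
by rewrite /c0; field; split.
Qed.

Let u_ode t : cderiv u t (a t * u t + g t)%C.
Proof.
have h := cderiv_mult (cderiv_cexp (Phi_deriv t))
  (cderiv_plus (cderiv_const c0 t) (cderiv_CInt 0 t twisted_cont)).
apply: cderiv_eq h _; rewrite /u /twisted cexp_opp.
by field; apply: cexp_neq0.
Qed.

(* Comparing h t over one full period with endpoint t cancels everything but
   u t times the resonance factor. *)
Let h t x : C := (cexp (Phi t - Phi x) * u x)%C.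

Let h_deriv t x : cderiv (h t) x (cexp (Phi t - Phi x) * g x)%C.
Proof.
have H := cderiv_mult (cderiv_cexp (cderiv_minus (cderiv_const (Phi t) x) (Phi_deriv x))) (u_ode x).
by apply: cderiv_eq H _; ring.
Qed.

Let RePhi t x : Re (Phi t - Phi x)%C = RInt s x t + Re r * RInt q x t.
Proof.
have ch (f : R -> R) : (forall t : R, continuous f t) -> RInt f 0 t - RInt f 0 x = RInt f x t.
  move=> cf; rewrite -(@RInt_Chasles R_CompleteNormedModule f 0 x t) ?/plus /=; [lra| |]; exact: ex_RInt_cont.
rewrite -(ch s) // -(ch q) // /Phi /Re /=; ring.
Qed.

Let RInt_s_le t x : x <= t -> t <= x + 2 * PI -> Rabs (RInt s x t) <= 2 * PI * Sb.
Proof.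
move=> xt tx; have Sb0 : 0 <= Sb by apply: Rle_trans (s_le 0); apply: Rabs_pos.
apply: (Rle_trans _ ((t - x) * Sb)).
  apply: (@norm_RInt_le_const R_NormedModule s x t) => //.
  by apply: RInt_correct; apply: ex_RInt_cont.
apply: Rmult_le_compat_r => //; lra.
Qed.

Let RInt_q_ge0 t x : x <= t -> 0 <= RInt q x t.
Proof. by move=> xt; apply: RInt_ge_0 => //; apply: ex_RInt_cont. Qed.

(** The hypothesis on [Phi] bounds the propagator by exp (2 pi Sb) on a whole period, on whichever
    side of t it lies; 4 pi is 2 pi times the factor 2 of [cderiv_bound]. *)
Let h_bound t x1 x2 G : x2 = x1 + 2 * PI -> (forall t, Cmod (g t) <= G) ->
  (forall x, x1 <= x <= x2 -> Re (Phi t - Phi x)%C <= 2 * PI * Sb) ->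
  Cmod (h t x2 - h t x1) <= 4 * PI * exp (2 * PI * Sb) * G.
Proof.
move=> e hG hx; have pi0 := PI_RGT_0.
have -> : 4 * PI * exp (2 * PI * Sb) * G = 2 * (exp (2 * PI * Sb) * G) * (x2 - x1).
  by rewrite e; ring.
apply: (@cderiv_bound (h t) (fun x => cexp (Phi t - Phi x) * g x)%C); first lra.
move=> x xx; split; first exact: h_deriv.
rewrite Cmod_mult Cmod_cexp; apply: Rmult_le_compat => //; first exact: Rlt_le (exp_pos _).
  exact: Cmod_ge_0.
by case: (hx x xx) => [/exp_increasing|->]; lra.
Qed.

(** The bounds involve neither [kap] nor the size of [r], hence are uniform in the frequency. The
    sign of Re r decides whether the period before or after t is used, so that q >= 0 makes the
    propagator decay. *)
Lemma periodic_ode : exists u : R -> C,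
  periodic u /\ (forall t, cderiv u t (ode_coef s q kap r t * u t + g t)%C) /\
  forall G, (forall t, Cmod (g t) <= G) ->
    (Re r <= 0 -> forall t, Cmod (u t) * Cmod (RtoC 1 - monodromy s q kap r) <= 4 * PI * exp (2 * PI * Sb) * G) /\
    (0 <= Re r -> forall t, Cmod (u t) * Cmod (RtoC 1 - / monodromy s q kap r) <= 4 * PI * exp (2 * PI * Sb) * G).
Proof.
have pi0 := PI_RGT_0.
exists u; split=> //; split=> // G hG; rewrite -/E; split=> hr t.
(* Here h t t = u t and h t (t - 2 pi) = E u t, so the difference is (1 - E) u t. *)
- have hb : Cmod (h t t - h t (t - 2 * PI)%RR) <= 4 * PI * exp (2 * PI * Sb) * G.
    apply: h_bound => //; first lra.
    move=> x hx; rewrite RePhi.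
    have h1 := RInt_s_le (proj2 hx) _; have h2 := RInt_q_ge0 (proj2 hx).
    have h3 := Rle_abs (RInt s x t); have h4 : Re r * RInt q x t <= 0 by nra.
    have := h1 ltac:(lra); lra.
  apply: Rle_trans hb; rewrite -Cmod_mult; apply: Req_le; congr Cmod.
  have e1 := u_periodic (t - 2 * PI)%RR; have e2 := Phi_shift (t - 2 * PI)%RR.
  rewrite (_ : t - 2 * PI + 2 * PI = t) in e1 e2; last ring.
  rewrite /h -e1 e2 (_ : (Phi (t - 2 * PI)%RR + Phi (2 * PI)%RR - (Phi (t - 2 * PI)%RR + Phi (2 * PI)%RR))%C = RtoC 0); last by ring.
  rewrite (_ : (Phi (t - 2 * PI)%RR + Phi (2 * PI)%RR - Phi (t - 2 * PI)%RR)%C = Phi (2 * PI)%RR); last by ring.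
  by rewrite PhiE cexp0; ring.
(* Here h t (t + 2 pi) = u t / E, so the difference is (1 / E - 1) u t. *)
- have hb : Cmod (h t (t + 2 * PI)%RR - h t t) <= 4 * PI * exp (2 * PI * Sb) * G.
    apply: h_bound => //.
    move=> x hx; rewrite RePhi.
    have h1 := RInt_s_le (proj1 hx) _; have h2 := RInt_q_ge0 (proj1 hx).
    have h3 := Rle_abs (- RInt s t x); rewrite Rabs_Ropp in h3.
    have sw (f : R -> R) : (forall t : R, continuous f t) -> RInt f x t = - RInt f t x.
      by move=> cf; rewrite -(@opp_RInt_swap R_CompleteNormedModule) //; exact: ex_RInt_cont.
    rewrite (sw s) // (sw q) //.
    have h4 : Re r * - RInt q t x <= 0 by nra.
    have := h1 ltac:(lra); lra.
  apply: Rle_trans hb; rewrite -Cmod_mult -Cmod_opp; apply: Req_le; congr Cmod.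
  rewrite /h u_periodic Phi_shift (_ : (Phi t - Phi t)%C = RtoC 0); last by ring.
  rewrite (_ : (Phi t - (Phi t + Phi (2 * PI)%RR))%C = (- Phi (2 * PI)%RR)%C); last by ring.
  by rewrite cexp_opp PhiE cexp0; ring.
Qed.

End PeriodicODE.

(** * Finite sums and derivatives of ODE solutions *)

HB.instance Definition _ := Monoid.isComLaw.Build C (RtoC 0) Cplus Cplus_assoc Cplus_comm Cplus_0_l.
HB.instance Definition _ := Monoid.isComLaw.Build R 0 Rplus
  (fun x y z => esym (Rplus_assoc x y z)) Rplus_comm Rplus_0_l.

Section Sums.
Variables (I : Type) (l : seq I).

Lemma csum_scal c (F : I -> C) :
  (c * \big[Cplus/RtoC 0]_(i <- l) F i)%C = \big[Cplus/RtoC 0]_(i <- l) (c * F i)%C.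
Proof. by apply: big_morph => [x y|]; ring. Qed.

Lemma csum_conj (F : I -> C) :
  Cconj (\big[Cplus/RtoC 0]_(i <- l) F i) = \big[Cplus/RtoC 0]_(i <- l) Cconj (F i).
Proof.
apply: big_morph => [x y|]; first exact: Cplus_conj.
by apply: C_eq => /=; ring.
Qed.

Lemma rsum_scal c (F : I -> R) :
  c * \big[Rplus/0]_(i <- l) F i = \big[Rplus/0]_(i <- l) (c * F i).
Proof. by apply: big_morph => [x y|]; ring. Qed.

Lemma rsum_le (F G : I -> R) : (forall i, F i <= G i) ->
  \big[Rplus/0]_(i <- l) F i <= \big[Rplus/0]_(i <- l) G i.
Proof.
move=> h; elim: l => [|i l' IH]; first by rewrite !big_nil; lra.
by rewrite !big_cons; have := h i; lra.
Qed.

Lemma Cmod_csum_le (F : I -> C) :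
  Cmod (\big[Cplus/RtoC 0]_(i <- l) F i) <= \big[Rplus/0]_(i <- l) Cmod (F i).
Proof.
elim: l => [|i l' IH]; first by rewrite !big_nil Cmod_0; lra.
by rewrite !big_cons; apply: Rle_trans (Cmod_triangle _ _) _; lra.
Qed.

Lemma cderiv_csum (F : I -> R -> C) (dF : I -> C) t :
  (forall i, cderiv (F i) t (dF i)) ->
  cderiv (fun x => \big[Cplus/RtoC 0]_(i <- l) F i x) t (\big[Cplus/RtoC 0]_(i <- l) dF i).
Proof.
move=> h; elim: l => [|i l' IH].
  rewrite big_nil; apply: cderiv_ext (cderiv_const (RtoC 0) t) => x; by rewrite big_nil.
rewrite big_cons; apply: cderiv_ext (cderiv_plus (h i) IH) => x; by rewrite big_cons.
Qed.

End Sums.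

(** * Iterated derivatives and the Leibniz formula *)

Definition csmooth (f : R -> C) :=
  forall k t, cderiv (iter k CD f) t (iter k.+1 CD f t).

(** Iterated derivatives are computed by exhibiting a candidate for each order; this is how all
    closed forms of [iter k CD] below are obtained. *)
Lemma csmooth_seq (F : nat -> R -> C) : (forall k t, cderiv (F k) t (F k.+1 t)) ->
  (forall k, iter k CD (F 0%N) = F k) /\ csmooth (F 0%N).
Proof.
move=> h.
have e k : iter k CD (F 0%N) = F k.
  elim: k => //= k ->; apply: functional_extensionality => t; exact: cderiv_unique.
by split=> // k t; rewrite !e.
Qed.

Lemma csmooth_cont f : csmooth f -> Rcont f.
Proof. by move=> h t; exact: cderiv_ccont (h 0%N t). Qed.

Definition leibniz (a u : nat -> C) (k : nat) : C :=
  \big[Cplus/RtoC 0]_(i < k.+1) (RtoC (INR 'C(k, i)) * (a i * u (k - i)%N))%C.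

(** Pascal's rule, with the summation index shifted in the half of the sum that differentiates
    [a]. *)
Lemma leibnizS (a u : nat -> C) k :
  \big[Cplus/RtoC 0]_(i < k.+1) (RtoC (INR 'C(k, i)) *
    (a i.+1 * u (k - i)%N + a i * u (k - i).+1%N))%C = leibniz a u k.+1.
Proof.
rewrite /leibniz [RHS]big_ord_recl.
under [X in _ = (_ + X)%C]eq_bigr => i _ do
  rewrite /= /bump /= add1n binS plus_INR RtoC_plus subSS Cmult_plus_distr_r.
rewrite big_split /=.
under eq_bigr => i _ do rewrite Cmult_plus_distr_l.
rewrite big_split /= [X in (X + _)%C = _](_ : _ = \big[Cplus/RtoC 0]_(i < k.+1) (RtoC (INR 'C(k, i)) * (a i.+1 * u (k - i)%N))%C) //.
rewrite [X in (_ + X)%C = _]big_ord_recl /= !bin0 !subn0.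
rewrite [X in _ = (_ + (X + _))%C]big_ord_recr /= [in 'C(k, k.+1)]bin_small // Cmult_0_l Cplus_0_r.
have -> : \big[Cplus/RtoC 0]_(i < k) (RtoC (INR 'C(k, bump 0 i)) * (a (bump 0 i) * u (k - bump 0 i).+1))%C
  = \big[Cplus/RtoC 0]_(i < k) (RtoC (INR 'C(k, i.+1)) * (a i.+1 * u (k - i)%N))%C.
  by apply: eq_bigr => i _; rewrite /bump /= add1n subnSK.
by rewrite Cplus_comm -Cplus_assoc; congr (_ + (_ + _))%C.
Qed.

Section OdeDerivatives.
Variables (a : nat -> R -> C) (g u : R -> C).
Hypotheses (ha : forall i t, cderiv (a i) t (a i.+1 t)) (hg : csmooth g).
Hypothesis hu : forall t, cderiv u t (a 0%N t * u t + g t)%C.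

Let rhs k t := (leibniz (fun i => a i t) (fun i => iter i CD u t) k + iter k CD g t)%C.

(** A bootstrap: the right-hand side of order k contains derivatives of u up to order k only, so
    each order of differentiability yields the next. *)
Lemma ode_derivatives : csmooth u /\ forall k t, iter k.+1 CD u t = rhs k t.
Proof.
have H k t : cderiv (iter k CD u) t (rhs k t).
  elim/ltn_ind: k t => k IH t.
  case: k IH => [|k] IH.
    apply: cderiv_eq (hu t) _.
    by rewrite /rhs /leibniz big_ord1 bin0 /= Cmult_1_l.
  have e : iter k.+1 CD u = rhs k.
    by apply: functional_extensionality => x; apply: cderiv_unique; apply: IH.
  have d j x : (j <= k)%N -> cderiv (iter j CD u) x (iter j.+1 CD u x).
    move=> jk; have h := IH j jk x; by rewrite [iter j.+1 _ _ _]/= (cderiv_unique h).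
  rewrite e /rhs -leibnizS; apply: cderiv_plus; last exact: hg.
  apply: cderiv_csum => i; apply: cderiv_scal; apply: cderiv_eq (cderiv_mult (ha i t) (d (k - i)%N t (leq_subr _ _))) _.
  by [].
split=> k t; last exact: (cderiv_unique (H k t)).
by apply: cderiv_eq (H k t) _; rewrite -(cderiv_unique (H k t)).
Qed.

End OdeDerivatives.

Ltac Rmult_pos := repeat first [done | lra | apply: Rmult_le_pos].

Lemma geometric_half k : \big[Rplus/0]_(i < k.+1) (/ 2) ^ i <= 2.
Proof.
suff -> : \big[Rplus/0]_(i < k.+1) (/ 2) ^ i = 2 - (/ 2) ^ k.
  have : 0 <= (/ 2) ^ k by apply: pow_le; lra.
  lra.
elim: k => [|k IH]; first by rewrite big_ord1 /=; lra.
by rewrite big_ord_recr IH /=; lra.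
Qed.

(** * Derivative bounds for an equation whose coefficient grows with a parameter N *)

Section DerivativeBound.
Variables (m : nat -> R) (hm : weight_sequence m).
Let W := wfact m.
Variables (U al ga : nat -> R) (N C0 h K A B : R).
Hypotheses (U0 : forall k, 0 <= U k) (ga0 : forall k, 0 <= ga k).
Hypotheses (N1 : 1 <= N) (C00 : 0 <= C0) (h0 : 0 <= h) (K0 : 0 <= K) (A0 : 0 <= A).
Hypothesis hU : forall k, U k.+1 <=
  \big[Rplus/0]_(i < k.+1) (INR 'C(k, i) * (al i * U (k - i)%N)) + ga k.
Hypothesis hal : forall i, al i <= C0 * N * h ^ i * W i.
Hypothesis hga : forall k b, ga k * N ^ b <= K * A ^ (k + b) * W (k + b)%N.
Hypothesis hU0 : forall b, U 0%N * N ^ b <= K * A ^ b * W b.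
(** B >= 2h makes the Leibniz sum geometric of ratio 1/2, with total at most 2; B >= 4 C0 A then
    lets this sum use at most half of the new factor B, and B >= 2 leaves the other half to the
    forcing term, whose A^k is below B^k by the last condition. *)
Hypotheses (B1 : 2 * h <= B) (B2 : 4 * (C0 * A) <= B) (B3 : 2 <= B) (B4 : A <= B).

(* Each t-derivative costs a factor N, which is traded for one more power of N
   on the left: hence an induction on k that is uniform in b. *)
Lemma derivative_bound k b : U k * N ^ b <= K * B ^ k * A ^ b * W (k + b)%N.
Proof.
elim/ltn_ind: k b => k IH b.
case: k IH => [|k] IH; first by rewrite add0n /=; have := hU0 b; lra.
have Nb0 b' : 0 <= N ^ b' by apply: pow_le; lra.
have Bk : 0 <= B ^ k by apply: pow_le; lra.
have Ab b' : 0 <= A ^ b' by apply: pow_le.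
have Wp := wfact_ge0 hm (k.+1 + b).
have main : \big[Rplus/0]_(i < k.+1) (INR 'C(k, i) * (al i * U (k - i)%N)) * N ^ b
  <= C0 * K * A ^ b.+1 * B ^ k * W (k.+1 + b)%N * 2.
  apply: (Rle_trans _ (C0 * K * A ^ b.+1 * B ^ k * W (k.+1 + b)%N * \big[Rplus/0]_(i < k.+1) (/ 2) ^ i)); last first.
    apply: Rmult_le_compat_l; last exact: geometric_half.
    by Rmult_pos.
  rewrite Rmult_comm !rsum_scal; apply: rsum_le => i.
  have ik : (i <= k)%N by rewrite -ltnS.
  have IHi := IH (k - i)%N (leq_subr _ _) b.+1.
  have bin0 : 0 <= INR 'C(k, i) by apply: pos_INR.
  have hi : h ^ i <= B ^ i * (/ 2) ^ i.
    rewrite -Rpow_mult_distr; apply: pow_incr; lra.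
  have Bki : B ^ k = B ^ (k - i)%N * B ^ i by rewrite -pow_add plusE subnK.
  have e : W (k - i + b.+1)%N = W (k - i + b.+1)%N by [].
  have Wi := wfact_ge0 hm i; rewrite -/W in Wi.
  have hpos : 0 <= h ^ i by apply: pow_le.
  have Bk' : 0 <= B ^ (k - i)%N by apply: pow_le; lra.
  have WW := wfact_binom hm b.+1 ik.
  have Wki := wfact_ge0 hm (k - i + b.+1).
  apply: (Rle_trans _ (INR 'C(k, i) * ((C0 * h ^ i * W i) * (U (k - i)%N * N ^ b.+1)))).
    have -> : N ^ b * (INR 'C(k, i) * (al i * U (k - i)%N)) = (INR 'C(k, i) * (N ^ b * U (k - i)%N)) * al i by ring.
    apply: (Rle_trans _ (INR 'C(k, i) * (N ^ b * U (k - i)%N) * (C0 * N * h ^ i * W i))).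
      by apply: Rmult_le_compat_l => //; Rmult_pos.
    by apply: Req_le => /=; ring.
  apply: (Rle_trans _ (INR 'C(k, i) * (C0 * h ^ i * W i * (K * B ^ (k - i)%N * A ^ b.+1 * W (k - i + b.+1)%N)))).
    by apply: Rmult_le_compat_l => //; apply: Rmult_le_compat_l => //; Rmult_pos.
  have -> : INR 'C(k, i) * (C0 * h ^ i * W i * (K * B ^ (k - i)%N * A ^ b.+1 * W (k - i + b.+1)%N))
     = (C0 * K * A ^ b.+1 * B ^ (k - i)%N * h ^ i) * (INR 'C(k, i) * (W i * W (k - i + b.+1)%N)) by ring.
  have -> : C0 * K * A ^ b.+1 * B ^ k * W (k.+1 + b)%N * (/ 2) ^ i =
     (C0 * K * A ^ b.+1 * B ^ (k - i)%N * (B ^ i * (/ 2) ^ i)) * W (k + b.+1)%N.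
    by rewrite Bki addSnnS; ring.
  apply: Rmult_le_compat => //.
  - by Rmult_pos.
  - by Rmult_pos.
  - by apply: Rmult_le_compat_l => //; Rmult_pos.
have h1 : ga k * N ^ b <= K * B ^ k * A ^ b * W (k.+1 + b)%N.
  apply: Rle_trans (hga k b) _; rewrite pow_add.
  have W1 : W (k + b)%N <= W (k.+1 + b)%N by apply: wfactS.
  have AB : A ^ k <= B ^ k by apply: pow_incr.
  have Wp2 := wfact_ge0 hm (k + b).
  apply: (Rle_trans _ ((K * A ^ k * A ^ b) * W (k + b)%N)); first by apply: Req_le; ring.
  apply: (Rmult_le_compat _ (K * B ^ k * A ^ b) (W _)) => //; first by Rmult_pos.
  apply: Rmult_le_compat_r => //; exact: Rmult_le_compat_l.
apply: (Rle_trans _ ((\big[Rplus/0]_(i < k.+1) (INR 'C(k, i) * (al i * U (k - i)%N)) + ga k) * N ^ b)).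
  by apply: Rmult_le_compat_r.
rewrite Rmult_plus_distr_r.
have Z : 0 <= K * B ^ k * A ^ b * W (k.+1 + b)%N by Rmult_pos.
have := Rmult_le_compat_l _ _ _ Z B2; have := Rmult_le_compat_l _ _ _ Z B3.
move: main h1 => /= main h1; nra.
Qed.

End DerivativeBound.

(** * Families of Fourier coefficients *)

Section Frequencies.
Variable n : nat.
Implicit Types xi : 'I_n -> Z.

Definition freq xi : R := 1 + enorm (ZtoR xi).

Definition zopp xi : 'I_n -> Z := fun j => (- xi j)%Z.

Lemma zoppK xi : zopp (zopp xi) = xi.
Proof. by apply: functional_extensionality => j; rewrite /zopp Z.opp_involutive. Qed.

Lemma dotR_zopp a xi : dotR a (ZtoR (zopp xi)) = - dotR a (ZtoR xi).
Proof.
rewrite /dotR -[RHS]Rmult_1_l -Ropp_mult_distr_r Ropp_mult_distr_l rsum_scal.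
by apply: eq_bigr => j _; rewrite /ZtoR /zopp opp_IZR; ring.
Qed.

Lemma freq_zopp xi : freq (zopp xi) = freq xi.
Proof.
rewrite /freq /enorm; congr (_ + sqrt _); apply: eq_bigr => j _.
by rewrite /ZtoR /zopp opp_IZR; ring.
Qed.

Lemma freq_ge1 xi : 1 <= freq xi.
Proof. by rewrite /freq /enorm; have := sqrt_pos (dotR (ZtoR xi) (ZtoR xi)); lra. Qed.

Lemma freq_gt0 xi : 0 < freq xi.
Proof. by have := freq_ge1 xi; lra. Qed.

Lemma Rabs_le_enorm (a : 'I_n -> R) j : Rabs (a j) <= enorm a.
Proof.
rewrite -sqrt_Rsqr_abs; apply: sqrt_le_1_alt.
rewrite /dotR (bigD1 j) //= /Rsqr.
rewrite -{1}[a j * a j]Rplus_0_r; apply: Rplus_le_compat_l.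
by apply: big_ind => [|x y ? ?|i _]; [lra|lra|nra].
Qed.

Lemma Rabs_freq xi j : Rabs (IZR (xi j)) <= freq xi.
Proof. by have := Rabs_le_enorm (ZtoR xi) j; rewrite /freq /ZtoR; lra. Qed.

Lemma dotR_le_freq (a : 'I_n -> R) : exists2 K, 0 <= K &
  forall xi, Rabs (dotR a (ZtoR xi)) <= K * freq xi.
Proof.
exists (\big[Rplus/0]_(j < n) Rabs (a j)).
  by apply: big_ind => [|x y ? ?|i _]; [lra|lra|exact: Rabs_pos].
move=> xi; rewrite Rmult_comm rsum_scal /dotR.
have : forall l : seq 'I_n, Rabs (\big[Rplus/0]_(j <- l) (a j * ZtoR xi j)) <= \big[Rplus/0]_(j <- l) (freq xi * Rabs (a j)).
  elim=> [|j l IH]; first by rewrite !big_nil Rabs_R0; lra.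
  rewrite !big_cons; apply: Rle_trans (Rabs_triang _ _) _.
  have : Rabs (a j * ZtoR xi j) <= freq xi * Rabs (a j).
    rewrite Rabs_mult Rmult_comm; apply: Rmult_le_compat_r (Rabs_freq xi j); exact: Rabs_pos.
  lra.
exact.
Qed.

(** Only finitely many frequencies lie in a ball, so a positive function is bounded below there.
    This covers the range on which (III) is silent. *)
Lemma low_freq_min (d : ('I_n -> Z) -> R) (gam : R) : (forall xi, 0 < d xi) ->
  exists2 c, 0 < c & forall xi, enorm (ZtoR xi) < gam -> c <= d xi.
Proof.
move=> d0; pose B := Z.to_nat (up gam).
(* Integer vectors with entries in [-B, B] are coded by a finite type of functions, shifted by B. *)
pose dec (f : {ffun 'I_n -> 'I_(B + B).+1}) : 'I_n -> Z :=
  fun j => (Z.of_nat (f j) - Z.of_nat B)%Z.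
have [c c0 hc] : exists2 c, 0 < c & forall f, f \in enum [set: {ffun 'I_n -> 'I_(B + B).+1}] -> c <= d (dec f).
  elim: (enum _) => [|f l [c c0 IH]]; first by exists 1; [lra|].
  exists (Rmin c (d (dec f))); first by apply: Rmin_glb_lt.
  move=> g; rewrite in_cons => /orP [/eqP ->|/IH]; first exact: Rmin_r.
  by apply: Rle_trans; apply: Rmin_l.
exists c => // xi hxi.
pose f : {ffun 'I_n -> 'I_(B + B).+1} := [ffun j => inord (Z.to_nat (xi j + Z.of_nat B))].
have -> : xi = dec f.
  apply: functional_extensionality => j; rewrite /dec ffunE.
  have := Rle_lt_trans _ _ _ (Rabs_le_enorm (ZtoR xi) j) hxi; rewrite /ZtoR => h.
  have [u1 _] := archimed gam.
  have [h1 h2] := Rabs_def2 _ _ h.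
  have k1 : (xi j < up gam)%Z by apply: lt_IZR; lra.
  have k2 : (- up gam < xi j)%Z by apply: lt_IZR; rewrite opp_IZR; lra.
  rewrite inordK; first by rewrite /B; lia.
  by apply/ltP; rewrite /B -plusE; lia.
by apply: hc; rewrite mem_enum inE.
Qed.

End Frequencies.

(** * Coefficient families of the class E_M *)

Section Families.
Variables (m : nat -> R) (hm : weight_sequence m) (n : nat).
Let W := wfact m.
Implicit Types (xi : 'I_n -> Z) (c : ('I_n -> Z) -> R -> C).

(** The coefficient side of [class_EM]: a power of the frequency plays the part of an x-derivative,
    so k and b enter the bound only through their sum. *)
Definition EMfam c :=
  [/\ forall xi, csmooth (c xi), forall xi, periodic (c xi) &
   exists K A, [/\ 0 <= K, 1 <= A & forall xi t k b,
     Cmod (iter k CD (c xi) t) * freq xi ^ b <= K * A ^ (k + b) * W (k + b)%N]].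

Lemma EM_bound_weaken K A K' A' j : 0 <= K <= K' -> 1 <= A <= A' ->
  K * A ^ j * W j <= K' * A' ^ j * W j.
Proof.
move=> [K0 KK] [A0 AA]; apply: Rmult_le_compat_r; first exact: wfact_ge0.
by apply: Rmult_le_compat => //; [apply: pow_le; lra|apply: pow_incr; lra].
Qed.

Lemma EMfam_plus c1 c2 : EMfam c1 -> EMfam c2 -> EMfam (fun xi t => c1 xi t + c2 xi t)%C.
Proof.
move=> [s1 p1 [K1 [A1 [K10 A10 h1]]]] [s2 p2 [K2 [A2 [K20 A20 h2]]]].
have S xi := @csmooth_seq (fun k t => iter k CD (c1 xi) t + iter k CD (c2 xi) t)%C
  (fun k t => cderiv_plus (s1 xi k t) (s2 xi k t)).
split=> [xi|xi t|]; first by case: (S xi).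
  by rewrite p1 p2.
exists (K1 + K2), (Rmax A1 A2); split; [lra|exact: Rle_trans (Rmax_l _ _)|].
move=> xi t k b; rewrite (proj1 (S xi)).
have h := pow_le _ b (Rlt_le _ _ (freq_gt0 xi)).
apply: (Rle_trans _ (Cmod (iter k CD (c1 xi) t) * freq xi ^ b + Cmod (iter k CD (c2 xi) t) * freq xi ^ b)).
  by rewrite -Rmult_plus_distr_r; apply: Rmult_le_compat_r => //; exact: Cmod_triangle.
have := h1 xi t k b; have := h2 xi t k b.
have := @EM_bound_weaken K1 A1 K1 (Rmax A1 A2) (k + b) _ _.
have := @EM_bound_weaken K2 A2 K2 (Rmax A1 A2) (k + b) _ _.
have := Rmax_l A1 A2; have := Rmax_r A1 A2; move=> m2 m1 w2 w1.
have := w1 ltac:(lra) ltac:(lra); have := w2 ltac:(lra) ltac:(lra); lra.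
Qed.

(** A multiplier of linear growth uses one more power of the frequency; moderate growth with index 1
    brings W_(j+1) back to W_j at the price of enlarging A to A H. *)
Lemma EMfam_scale z C0 c : (forall xi, Cmod (z xi) <= C0 * freq xi) -> EMfam c ->
  EMfam (fun xi t => z xi * c xi t)%C.
Proof.
move=> hz [s1 p1 [K [A [K0 A0 h]]]].
have S xi := @csmooth_seq (fun k t => z xi * iter k CD (c xi) t)%C
  (fun k t => cderiv_scal (z xi) (s1 xi k t)).
split=> [xi|xi t|]; first by case: (S xi).
  by rewrite p1.
have C0p : 0 <= C0.
  have := Rle_trans _ _ _ (Cmod_ge_0 _) (hz (fun _ => 0%Z)); have := freq_gt0 (fun _ : 'I_n => 0%Z); nra.
have [H [H1 hH]] := wfact_moderate hm.
exists (C0 * K * A * H), (A * H).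
have AH1 : 1 <= A * H by nra.
split=> //; first by repeat apply: Rmult_le_pos => //; lra.
move=> xi t k b; rewrite (proj1 (S xi)) Cmod_mult.
have fp := pow_le _ b (Rlt_le _ _ (freq_gt0 xi)).
apply: (Rle_trans _ (C0 * (Cmod (iter k CD (c xi) t) * freq xi ^ b.+1))).
  rewrite [freq xi ^ b.+1]/=.
  have := Rmult_le_compat_r _ _ _ (Rmult_le_pos _ _ (Cmod_ge_0 (iter k CD (c xi) t)) fp) (hz xi).
  lra.
apply: (Rle_trans _ (C0 * (K * A ^ (k + b).+1 * W (k + b).+1))).
  by apply: Rmult_le_compat_l => //; rewrite -addnS; exact: h.
have hW := hH (k + b)%N 1%N; rewrite wfact1 // addn1 Rmult_1_r in hW.
have Ap : 0 <= A ^ (k + b).+1 by apply: pow_le; lra.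
apply: (Rle_trans _ (C0 * (K * A ^ (k + b).+1 * (H ^ (k + b).+1 * W (k + b)%N)))).
  apply: Rmult_le_compat_l => //; apply: Rmult_le_compat_l => //; exact: Rmult_le_pos.
by rewrite Rpow_mult_distr /=; apply: Req_le; ring.
Qed.

Lemma EMfam_conj c : EMfam c -> EMfam (fun xi t => Cconj (c (zopp xi) t)).
Proof.
move=> [s1 p1 [K [A [K0 A0 h]]]].
have S xi := @csmooth_seq (fun k t => Cconj (iter k CD (c (zopp xi)) t))
  (fun k t => cderiv_conj (s1 (zopp xi) k t)).
split=> [xi|xi t|]; first by case: (S xi).
  by rewrite p1.
exists K, A; split=> // xi t k b; rewrite (proj1 (S xi)) Cmod_conj -freq_zopp; exact: h.
Qed.

Definition EMfun (q : R -> R) :=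
  [/\ forall k t, is_derive (Derive_n q k) t (Derive_n q k.+1 t), periodic q &
   exists K h, [/\ 0 <= K, 1 <= h & forall k t, Rabs (Derive_n q k t) <= K * h ^ k * W k]].

Lemma EMfun_cont q : EMfun q -> forall t : R, continuous q t.
Proof.
move=> [h _ _] t; apply: (@ex_derive_continuous R_AbsRing R_NormedModule).
by eexists; exact: (h 0%N t).
Qed.

(** Decay of u itself is enough: the equation supplies its t-derivatives, and [derivative_bound]
    with N = [freq xi] controls them uniformly in the frequency. *)
Lemma EMfam_ode (s q : R -> R) (kap : ('I_n -> Z) -> R) (r : ('I_n -> Z) -> C) (C0 : R) g u :
  EMfun s -> EMfun q -> (forall xi, Rabs (kap xi) <= C0 * freq xi) ->
  (forall xi, Cmod (r xi) <= C0 * freq xi) ->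
  EMfam g -> (forall xi, periodic (u xi)) ->
  (forall xi t, cderiv (u xi) t (ode_coef s q (kap xi) (r xi) t * u xi t + g xi t)%C) ->
  (exists K A, [/\ 0 <= K, 1 <= A & forall xi t b, Cmod (u xi t) * freq xi ^ b <= K * A ^ b * W b]) ->
  EMfam u.
Proof.
move=> [ds ps [Ks [hs [Ks0 hs1 bs]]]] [dq pq [Kq [hq [Kq0 hq1 bq]]]] hkap hr [sg pg [Kg [Ag [Kg0 Ag1 bg]]]] pu hu [Ku [Au [Ku0 Au1 bu]]].
(* The i-th t-derivative of the coefficient; its constant part i [kap] survives only for i = 0. *)
pose a xi i t : C := (RtoC (Derive_n s i t) + (if i == 0%N then (Ci * RtoC (kap xi))%C else RtoC 0) + r xi * RtoC (Derive_n q i t))%C.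
have ha xi i t : cderiv (a xi i) t (a xi i.+1 t).
  apply: cderiv_plus; last exact/cderiv_scal/cderiv_RtoC.
  apply: cderiv_plus; [exact/cderiv_RtoC|exact: cderiv_const].
have D xi := ode_derivatives (ha xi) (sg xi) (hu xi).
have C00 : 0 <= C0.
  have := Rle_trans _ _ _ (Cmod_ge_0 _) (hr (fun _ => 0%Z)); have := freq_gt0 (fun _ : 'I_n => 0%Z); nra.
pose h := Rmax hs hq; have h1 : hs <= h by apply: Rmax_l. have h2 : hq <= h by apply: Rmax_r.
pose C1 := Ks + C0 + C0 * Kq.
have bound_a xi i t : Cmod (a xi i t) <= C1 * freq xi * h ^ i * W i.
  have Wi : 1 <= W i by rewrite -(wfact0 hm); apply: wfact_mono.
  have hi : 1 <= h ^ i by apply: pow_R1_Rle; lra.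
  have N1 := freq_ge1 xi.
  have e1 : Cmod (RtoC (Derive_n s i t)) <= Ks * freq xi * h ^ i * W i.
    rewrite Cmod_R; apply: Rle_trans (bs i t) _.
    apply: Rle_trans (EM_bound_weaken (K' := Ks) (A' := h) i _ _) _; [lra|lra|].
    have Z : 0 <= Ks * h ^ i * W i by apply: Rmult_le_pos; [apply: Rmult_le_pos|]; lra.
    have := Rmult_le_compat_l _ _ _ Z N1; lra.
  have e2 : Cmod (if i == 0%N then (Ci * RtoC (kap xi))%C else RtoC 0) <= C0 * freq xi * h ^ i * W i.
    case: (i == 0%N); last by rewrite Cmod_0; Rmult_pos.
    rewrite Cmod_mult Cmod_Ci Cmod_R Rmult_1_l; apply: Rle_trans (hkap xi) _.
    have Z : 0 <= C0 * freq xi by apply: Rmult_le_pos => //; lra.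
    have Y : 1 <= h ^ i * W i by nra.
    have := Rmult_le_compat_l _ _ _ Z Y; lra.
  have e3 : Cmod (r xi * RtoC (Derive_n q i t)) <= C0 * Kq * freq xi * h ^ i * W i.
    rewrite Cmod_mult Cmod_R.
    have Z : Rabs (Derive_n q i t) <= Kq * h ^ i * W i.
      apply: Rle_trans (bq i t) (EM_bound_weaken (K' := Kq) (A' := h) i _ _); lra.
    have := Rmult_le_compat _ _ _ _ (Cmod_ge_0 _) (Rabs_pos _) (hr xi) Z; lra.
  have t1 := Cmod_triangle (RtoC (Derive_n s i t) + (if i == 0%N then (Ci * RtoC (kap xi))%C else RtoC 0)) (r xi * RtoC (Derive_n q i t)).
  have t2 := Cmod_triangle (RtoC (Derive_n s i t)) (if i == 0%N then (Ci * RtoC (kap xi))%C else RtoC 0).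
  rewrite /a /C1; lra.
pose K := Kg + Ku; pose A := Rmax Ag Au.
have A1 : Ag <= A by apply: Rmax_l. have A2 : Au <= A by apply: Rmax_r.
have C10 : 0 <= C1 by rewrite /C1; have := Rmult_le_pos _ _ C00 Kq0; lra.
(* The sum of the four lower bounds that [derivative_bound] asks of B. *)
pose B := 2 * h + 4 * (C1 * A) + 2 + A.
have C1A : 0 <= C1 * A by apply: Rmult_le_pos => //; lra.
split=> [xi|//|]; first by case: (D xi).
exists K, B; split; [rewrite /K; lra|rewrite /B; lra|].
move=> xi t k b.
have AB : A ^ b <= B ^ b by apply: pow_incr; rewrite /B; lra.
have Wp := wfact_ge0 hm (k + b); rewrite -/W in Wp.
have Kp : 0 <= K by rewrite /K; lra.
have Bk : 0 <= B ^ k by apply: pow_le; rewrite /B; lra.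
apply: (Rle_trans _ (K * B ^ k * A ^ b * W (k + b)%N)); last first.
  rewrite pow_add; apply: Rmult_le_compat_r => //.
  by rewrite -Rmult_assoc; apply: Rmult_le_compat_l => //; apply: Rmult_le_pos.
apply: (@derivative_bound m hm (fun k => Cmod (iter k CD (u xi) t)) (fun i => Cmod (a xi i t))
  (fun k => Cmod (iter k CD (g xi) t)) (freq xi) C1 h) => //; try (rewrite /B; lra).
- by move=> k'; exact: Cmod_ge_0.
- exact: freq_ge1.
- move=> k'; rewrite (proj2 (D xi)).
  apply: Rle_trans (Cmod_triangle _ _) _; apply: Rplus_le_compat_r.
  apply: Rle_trans (Cmod_csum_le _ _) _; apply: Req_le; apply: eq_bigr => i _.
  by rewrite !Cmod_mult Cmod_R Rabs_pos_eq //; exact: pos_INR.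
- move=> k' b'; apply: Rle_trans (bg xi t k' b') _.
  by apply: EM_bound_weaken; rewrite /K; lra.
- move=> b'; apply: Rle_trans (bu xi t b') _.
  by apply: EM_bound_weaken; rewrite /K; lra.
Qed.

(** * The infimum in (III) and division by small denominators *)

Definition gevrey_inf (eps N : R) : R :=
  real (Inf_seq (fun j => Rbar.Finite (m j * INR j`! / (eps ^ j * N ^ j)))).

Lemma le_gevrey_inf eps N x : (forall j, x <= W j / (eps ^ j * N ^ j)) -> x <= gevrey_inf eps N.
Proof.
move=> h; rewrite /gevrey_inf.
set v := fun j => _; have := Inf_seq_correct v; case: (Inf_seq v) => [l||] /= H.
- apply: Rnot_lt_le => lx.
  have [_ [j hj]] := H (mkposreal (x - l) ltac:(lra)).
  by have := h j; rewrite /v /= /W /wfact in hj *; lra.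
- have := H (m 0%N * INR (0)`! / (eps ^ 0 * N ^ 0)) 0%N; rewrite /v; lra.
- by have [j hj] := H x; have := h j; rewrite /v /W /wfact in hj *; lra.
Qed.

Lemma gevrey_inf_le1 eps N : 0 < eps -> 0 < N -> gevrey_inf eps N <= 1.
Proof.
move=> e0 N0; rewrite /gevrey_inf.
set v := fun j => _.
have v0 j : 0 <= m j * INR j`! / (eps ^ j * N ^ j).
  apply: Rmult_le_pos; first exact: (wfact_ge0 hm).
  by apply/Rlt_le/Rinv_0_lt_compat; apply: Rmult_lt_0_compat; apply: pow_lt.
have := Inf_seq_correct v; case: (Inf_seq v) => [l||] /= H.
- apply: Rnot_lt_le => lx.
  have [h _] := H (mkposreal (l - 1) ltac:(lra)).
  by have := h 0%N; rewrite /v /= (weight_0 hm); lra.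
- lra.
- lra.
Qed.

(* Moderate growth turns the decay of c with W_(j+b), read for all j at once,
   into the decay with W_b times gevrey_inf, and the latter absorbs 1 / den. *)
Lemma gevrey_division (den : ('I_n -> Z) -> R) c (u : ('I_n -> Z) -> R -> C) (Cu : R) :
  (forall xi, 0 < den xi) ->
  (forall eps, 0 < eps -> exists2 Ce, 0 < Ce & forall xi, Ce * gevrey_inf eps (freq xi) <= den xi) ->
  EMfam c -> 0 <= Cu ->
  (forall xi G, (forall t, Cmod (c xi t) <= G) -> forall t, Cmod (u xi t) * den xi <= Cu * G) ->
  exists K A, [/\ 0 <= K, 1 <= A & forall xi t b, Cmod (u xi t) * freq xi ^ b <= K * A ^ b * W b].
Proof.
move=> d0 hd [_ _ [K [A [K0 A1 hc]]]] Cu0 hu.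
have [H [H1 hH]] := wfact_moderate hm.
(* With this choice eps^(-j) equals the factor (A H)^j that moderate growth produces when j powers
   of the frequency are split off. *)
pose eps := / (A * H).
have AH : 1 <= A * H by nra.
have e0 : 0 < eps by apply: Rinv_0_lt_compat; lra.
have [Ce Ce0 hCe] := hd eps e0.
exists (Cu * K / Ce), (A * H); split=> //.
  by apply: Rmult_le_pos; [exact: Rmult_le_pos|exact/Rlt_le/Rinv_0_lt_compat].
move=> xi t b; have N0 := freq_gt0 xi; set N := freq xi.
have Nb : 0 < N ^ b by apply: pow_lt.
pose G := K * (A * H) ^ b * W b * gevrey_inf eps N / N ^ b.
have hG x : Cmod (c xi x) <= G.
  have Wb := wfact_gt0 hm b; rewrite -/W in Wb.
  have pb : 0 < (A * H) ^ b by apply: pow_lt; lra.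
  (* The general argument divides by K; for K = 0 the family vanishes. *)
  have [K00|Kpos] : K = 0 \/ 0 < K by lra.
    have := hc xi x 0%N 0%N; rewrite K00 /G K00 /= /Rdiv !Rmult_0_l Rmult_1_r; lra.
  have P : 0 < K * (A * H) ^ b * W b by repeat first [done | apply: Rmult_lt_0_compat].
  have : Cmod (c xi x) * N ^ b / (K * (A * H) ^ b * W b) <= gevrey_inf eps N.
    apply: le_gevrey_inf => j.
    have Nj : 0 < N ^ j by apply: pow_lt.
    have ej : 0 < eps ^ j by apply: pow_lt.
    have pj : 0 < (A * H) ^ j by apply: pow_lt; lra.
    apply/Rle_div_l => //.
    apply: (Rmult_le_reg_r (N ^ j)) => //.
    have -> : W j / (eps ^ j * N ^ j) * (K * (A * H) ^ b * W b) * N ^ j = K * (A * H) ^ (j + b) * W j * W b.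
      rewrite /eps pow_inv pow_add; field; split; lra.
    have := hc xi x 0%N (j + b)%N; rewrite add0n /= -/N => h.
    rewrite Rmult_assoc -pow_add plusE addnC; apply: Rle_trans h _.
    rewrite Rpow_mult_distr.
    have Aj : 0 <= K * A ^ (j + b) by apply: Rmult_le_pos => //; apply: pow_le; lra.
    have := Rmult_le_compat_l _ _ _ Aj (hH j b); rewrite -/W; lra.
  rewrite Rle_div_l // => h.
  rewrite /G; apply/Rle_div_r => //; lra.
have := hu xi G hG t.
have Kab : 0 <= Cu * (K * (A * H) ^ b * W b).
  have := wfact_ge0 hm b; have : 0 <= (A * H) ^ b by apply: pow_le; lra.
  by move=> ? ?; Rmult_pos.
have := Rmult_le_compat_l _ _ _ Kab (hCe xi).
rewrite -/N /G => h1 h2.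
have dd := d0 xi.
apply: (Rmult_le_reg_r (den xi)) => //; apply: (Rmult_le_reg_l Ce) => //.
have -> : Ce * (Cu * K / Ce * (A * H) ^ b * W b * den xi) = Cu * (K * (A * H) ^ b * W b) * den xi.
  by field; lra.
apply: Rle_trans h1.
have := Rmult_le_compat_r _ _ _ (Rmult_le_pos _ _ (Rlt_le _ _ Ce0) (Rlt_le _ _ Nb)) h2.
have -> : Cu * (K * (A * H) ^ b * W b * gevrey_inf eps N / N ^ b) * (Ce * N ^ b) = Cu * (K * (A * H) ^ b * W b) * (Ce * gevrey_inf eps N).
  by field; lra.
lra.
Qed.

End Families.

(** * The system of coefficient equations *)

Lemma cexp_eq1 (z : C) : cexp z = RtoC 1 -> exists k : Z, z = (Ci * RtoC (2 * PI * IZR k))%C.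
Proof.
move=> h.
have e : exp (Re z) = 1 by rewrite -Cmod_cexp h Cmod_1.
have r0 : Re z = 0 by apply: exp_inv; rewrite e exp_0.
have c1 : cos (Im z) = 1.
  by move: (f_equal Re h); rewrite /cexp /= e Rmult_1_l.
(* By the half-angle formula cos (Im z) = 1 means sin (Im z / 2) = 0, and the zeros of the sine are
   known. *)
have [k hk] : exists k : Z, Im z / 2 = IZR k * PI.
  apply: sin_eq_0_0.
  have := cos_2a_sin (Im z / 2); rewrite (_ : 2 * (Im z / 2) = Im z); last by field.
  by rewrite c1 => h2; nra.
exists k; apply: C_eq => /=; [rewrite r0; ring|lra].
Qed.

Section System.
Variables (m : nat -> R) (hm : weight_sequence m) (n : nat).
Variables (alpha : C) (delta : R) (lam p0 : 'I_n -> R) (q s : R -> R).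
Hypotheses (halpha : alpha <> RtoC 0) (hq : EMfun m q) (hs : EMfun m s).
Hypothesis q_ge0 : forall t, 0 <= q t.
Variable rho : ('I_n -> Z) -> C.
Hypothesis hrho : forall xi,
  (rho xi ^ 2 = (RtoC (dotR lam (ZtoR xi)) - Ci * RtoC delta) ^ 2 + RtoC (Cmod alpha) ^ 2)%C /\
  0 <= Re (rho xi).
Hypothesis hI : Cmod alpha <> Rabs delta.
Let q0 := RInt q 0 (2 * PI).
Let s0 := RInt s 0 (2 * PI).
Let kap (xi : 'I_n -> Z) := dotR (ZtoR xi) p0.
Let X (xi : 'I_n -> Z) := dotR lam (ZtoR xi).
Let A0 := (RtoC s0 + Ci * RtoC delta * RtoC q0)%C.
Let B0 := (alpha * RtoC q0)%C.
Let C0 := fun j : 'I_n => (RtoC (2 * PI * p0 j) + Ci * RtoC (lam j) * RtoC q0)%C.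
Hypothesis hII : ~ (exists (xi : 'I_n -> Z) (tau : Z),
       Re (A0 * (RtoC (2 * PI * IZR tau) + dotC (ZtoC xi) (fun j => Cconj (C0 j))))%C = 0 /\
       Cmod (RtoC (2 * PI * IZR tau) + dotC (ZtoC xi) C0)%C ^ 2 = Cmod A0 ^ 2 - Cmod B0 ^ 2).
Hypothesis hIII : forall eps : R, 0 < eps ->
     exists Ceps geps : R, 0 < Ceps /\ 0 < geps /\
       forall xi : 'I_n -> Z, geps <= enorm (ZtoR xi) ->
         Ceps * gevrey_inf m eps (freq xi)
         <= Rmin
              (Cmod (cexp (- rho xi * RtoC q0) - cexp (RtoC s0 + Ci * RtoC (2 * PI * dotR (ZtoR xi) p0)))%C)
              (Cmod (RtoC 1 - cexp (- rho xi * RtoC q0 + RtoC s0 + Ci * RtoC (2 * PI * dotR (ZtoR xi) p0)))%C).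

(** The sign [sg] serves C0 (sg = 1) and its conjugate (sg = -1) at once. *)
Let dotC_C0 xi (sg : R) :
  dotC (ZtoC xi) (fun j => RtoC (2 * PI * p0 j) + Ci * RtoC (lam j) * RtoC (sg * q0))%C
  = (RtoC (2 * PI * kap xi) + Ci * RtoC (X xi * (sg * q0)))%C.
Proof.
rewrite /dotC /kap /X /dotR.
elim/big_rec3: _ => [|j c x y _ ->]; first by apply: C_eq => /=; ring.
by rewrite /ZtoC /ZtoR; apply: C_eq => /=; ring.
Qed.

Let rho_sq xi : (rho xi * rho xi = (RtoC (X xi) - Ci * RtoC delta) * (RtoC (X xi) - Ci * RtoC delta)
  + alpha * Cconj alpha)%C.
Proof.
have [h _] := hrho xi; rewrite -Cmod2_conj.
have -> : (rho xi * rho xi)%C = (rho xi ^ 2)%C by rewrite /=; ring.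
rewrite h RtoC_pow /X; by rewrite /=; ring.
Qed.

(** Only r^2 enters, so both roots are covered. Monodromy 1 gives r q0 = -(s0 + 2 pi i (tau +
    xi.p0)) with tau = -k; the real and imaginary parts of (r q0)^2 = rho^2 q0^2 are then equivalent
    to the second and the first equation of (II). *)
Lemma nonresonance xi r : (r * r = rho xi * rho xi)%C -> monodromy s q (kap xi) r <> RtoC 1.
Proof.
move=> hr /cexp_eq1 [k hk]; apply: hII.
rewrite -/s0 -/q0 in hk.
have rq : (r * RtoC q0 = - (RtoC s0 + Ci * RtoC (2 * PI * (IZR (- k) + kap xi))))%C.
  have -> : (r * RtoC q0)%C = (RtoC s0 + Ci * RtoC (2 * PI * kap xi) + r * RtoC q0 - (RtoC s0 + Ci * RtoC (2 * PI * kap xi)))%C by ring.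
  by rewrite hk opp_IZR; apply: C_eq => /=; ring.
have sq : ((r * RtoC q0) * (r * RtoC q0) = ((RtoC (X xi) - Ci * RtoC delta) * (RtoC (X xi) - Ci * RtoC delta)
  + alpha * Cconj alpha) * RtoC q0 * RtoC q0)%C by rewrite -rho_sq -hr; ring.
rewrite rq in sq.
have e1 := f_equal Re sq; have e2 := f_equal Im sq.
exists xi, (- k)%Z.
have d1 : dotC (ZtoC xi) C0 = (RtoC (2 * PI * kap xi) + Ci * RtoC (X xi * q0))%C.
  have := dotC_C0 xi 1; rewrite Rmult_1_l; exact.
have d2 : dotC (ZtoC xi) (fun j => Cconj (C0 j)) = (RtoC (2 * PI * kap xi) - Ci * RtoC (X xi * q0))%C.
  transitivity (RtoC (2 * PI * kap xi) + Ci * RtoC (X xi * (-1 * q0)))%C; last by apply: C_eq => /=; ring.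
  rewrite -dotC_C0; apply: eq_bigr => j _; congr Cmult.
  by rewrite /C0; apply: C_eq => /=; ring.
rewrite d1 d2 !Cmod2_alt /A0 /B0.
set T := IZR (- k) in e1 e2 *.
case: alpha e1 e2 => a1 a2 /= e1 e2.
split; lra.
Qed.

Let m11 xi : C := (- RtoC (X xi) + Ci * RtoC delta)%C.

Let Dl := Rabs (delta ^ 2 - Cmod alpha ^ 2).

Let Dl_gt0 : 0 < Dl.
Proof.
apply: Rabs_pos_lt => h; apply: hI.
have := Cmod_ge_0 alpha; rewrite /Rabs; case: Rcase_abs => ? ?; nra.
Qed.

(** With z = lam.xi - i delta, rho^2 = (z + i |alpha|) (z - i |alpha|), and each factor is at least
    its imaginary part, which does not depend on xi. By (I) the product of these two constants is
    not 0. *)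
Let rho_lower xi : Dl <= Cmod (rho xi) ^ 2.
Proof.
have -> : Cmod (rho xi) ^ 2 = Cmod (rho xi * rho xi) by rewrite Cmod_mult /=; ring.
rewrite rho_sq -Cmod2_conj.
set a := Cmod alpha; set z := (RtoC (X xi) - Ci * RtoC delta)%C.
have -> : (z * z + RtoC (a ^ 2))%C = ((z + Ci * RtoC a) * (z - Ci * RtoC a))%C.
  by apply: C_eq => /=; ring.
rewrite Cmod_mult /Dl -/a.
have -> : delta ^ 2 - a ^ 2 = (a - delta) * (- a - delta) by ring.
rewrite Rabs_mult; apply: Rmult_le_compat; try exact: Rabs_pos.
- apply: Rle_trans (Rabs_Im_le _); apply: Req_le; congr Rabs; rewrite /z /=; ring.
- apply: Rle_trans (Rabs_Im_le _); apply: Req_le; congr Rabs; rewrite /z /=; ring.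
Qed.

Let rho_neq0 xi : rho xi <> RtoC 0.
Proof. by move=> h; have := rho_lower xi; rewrite h Cmod_0 /=; have := Dl_gt0; lra. Qed.

Let rho_inv xi : Cmod (/ rho xi) <= / sqrt Dl.
Proof.
rewrite Cmod_inv //; apply: Rinv_le_contravar; first exact: sqrt_lt_R0.
have := sqrt_le_1_alt _ _ (rho_lower xi).
by rewrite sqrt_pow2 //; exact: Cmod_ge_0.
Qed.

Let rho_sq' xi : (rho xi * rho xi = m11 xi * m11 xi + alpha * Cconj alpha)%C.
Proof. by rewrite rho_sq /m11; ring. Qed.

Let bounds : exists2 K, 0 <= K & forall xi,
  [/\ Cmod (m11 xi) <= K * freq xi, Cmod (rho xi) <= K * freq xi & Rabs (kap xi) <= K * freq xi].
Proof.
have [K1 K10 h1] := dotR_le_freq lam; have [K2 K20 h2] := dotR_le_freq p0.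
have a0 := Cmod_ge_0 alpha; have d0 := Rabs_pos delta.
exists (K1 + K2 + Rabs delta + Cmod alpha); first lra.
move=> xi; have N1 := freq_ge1 xi; have hX := h1 xi; rewrite -/(X xi) in hX.
have hm11 : Cmod (m11 xi) <= (K1 + Rabs delta) * freq xi.
  apply: Rle_trans (Cmod_triangle _ _) _; rewrite Cmod_opp Cmod_R Cmod_mult Cmod_Ci Cmod_R.
  have := Rmult_le_compat_l _ _ _ d0 N1; lra.
have z1 : 0 <= K2 * freq xi by apply: Rmult_le_pos; lra.
have z2 : 0 <= K1 * freq xi by apply: Rmult_le_pos; lra.
have z3 : 0 <= Rabs delta * freq xi by apply: Rmult_le_pos; lra.
have z4 : 0 <= Cmod alpha * freq xi by apply: Rmult_le_pos; lra.
split; [lra| |].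
(* From rho^2 = m11^2 + |alpha|^2, by comparing squares. *)
- suff : Cmod (rho xi) <= Cmod (m11 xi) + Cmod alpha.
    have := Rmult_le_compat_l _ _ _ a0 N1; lra.
  have p1 := Cmod_ge_0 (m11 xi).
  apply: Rsqr_incr_0_var; last lra.
  rewrite /Rsqr -Cmod_mult rho_sq'.
  apply: Rle_trans (Cmod_triangle _ _) _; rewrite !Cmod_mult Cmod_conj.
  nra.
- have -> : kap xi = dotR p0 (ZtoR xi) by apply: eq_bigr => j _; ring.
  have := h2 xi; lra.
Qed.

(** Both eigenvalues are treated alike: [den] is whichever of |1 - E| and |1 - 1/E| matches the sign
    of Re r. Its positivity comes from (II), its lower bound at high frequencies from (III). *)
Let branch r (den : ('I_n -> Z) -> R) g :
  (forall xi, r xi = rho xi \/ r xi = (- rho xi)%C) ->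
  (forall xi, Re (r xi) <= 0 /\ den xi = Cmod (RtoC 1 - monodromy s q (kap xi) (r xi)) \/
    0 <= Re (r xi) /\ den xi = Cmod (RtoC 1 - / monodromy s q (kap xi) (r xi))) ->
  (forall eps, 0 < eps -> exists Ce gam, 0 < Ce /\ forall xi, gam <= enorm (ZtoR xi) ->
     Ce * gevrey_inf m eps (freq xi) <= den xi) ->
  EMfam m g -> exists2 u, EMfam m u &
    forall xi t, cderiv (u xi) t (ode_coef s q (kap xi) (r xi) t * u xi t + g xi t)%C.
Proof.
move=> hr hden hinf hg.
have [K K0 hK] := bounds.
have E1 xi : monodromy s q (kap xi) (r xi) <> RtoC 1.
  by apply: nonresonance; case: (hr xi) => ->; ring.
have den0 xi : 0 < den xi.
  case: (hden xi) => -[_ ->]; apply/Cmod_gt_0 => h; apply: (E1 xi).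
  - have -> : monodromy s q (kap xi) (r xi) = (RtoC 1 - (RtoC 1 - monodromy s q (kap xi) (r xi)))%C by ring.
    by rewrite h; ring.
  - have E0 : monodromy s q (kap xi) (r xi) <> RtoC 0 by apply: cexp_neq0.
    have -> : monodromy s q (kap xi) (r xi) = (monodromy s q (kap xi) (r xi) * (RtoC 1 - / monodromy s q (kap xi) (r xi)) + RtoC 1)%C by field.
    by rewrite h; ring.
have [[_ ps [Ks [hs' [Ks0 _ bs]]]] [_ pq _]] := (hs, hq).
have [_ pg _] := hg.
have bs0 t : Rabs (s t) <= Ks by have := bs 0%N t; rewrite /= wfact0 //; lra.
have cg xi : Rcont (g xi) by apply: csmooth_cont; case: hg.
have ex xi := @periodic_ode s q (kap xi) (r xi) (g xi) Ks (EMfun_cont hs) (EMfun_cont hq) ps pq (pg xi) (cg xi) q_ge0 bs0 (E1 xi).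
pose u xi := proj1_sig (constructive_indefinite_description _ (ex xi)).
have hu xi := proj2_sig (constructive_indefinite_description _ (ex xi)); rewrite -/(u _) in hu.
exists u; last by move=> xi t; case: (hu xi) => _ [].
apply: (@EMfam_ode m hm n s q kap r K g u) => //.
- by move=> xi; case: (hK xi).
- by move=> xi; case: (hr xi) => ->; rewrite ?Cmod_opp; case: (hK xi).
- by move=> xi; case: (hu xi).
- by move=> xi t; case: (hu xi) => _ [].
have pi0 := PI_RGT_0.
apply: (@gevrey_division m hm n den g u (4 * PI * exp (2 * PI * Ks))) => //.
- move=> eps eps0; have [Ce [gam [Ce0 h]]] := hinf eps eps0.
  have [c c0 hc] := low_freq_min gam den0.
  (* At low frequencies the constant c suffices, because [gevrey_inf] is at most 1. *)
  exists (Rmin Ce c); first exact: Rmin_glb_lt.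
  move=> xi.
  have gi0 : 0 <= gevrey_inf m eps (freq xi).
    apply: le_gevrey_inf => j; apply: Rmult_le_pos; first exact: (wfact_ge0 hm).
    by apply/Rlt_le/Rinv_0_lt_compat/Rmult_lt_0_compat; apply: pow_lt => //; exact: freq_gt0.
  have gi1 : gevrey_inf m eps (freq xi) <= 1 by apply: gevrey_inf_le1 => //; exact: freq_gt0.
  have [hx|hx] := Rle_lt_dec gam (enorm (ZtoR xi)).
    by apply: Rle_trans (h xi hx); apply: Rmult_le_compat_r => //; exact: Rmin_l.
  apply: Rle_trans (hc xi hx).
  have := Rmult_le_compat_r _ _ _ gi0 (Rmin_r Ce c); nra.
- by have := exp_pos (2 * PI * Ks); nra.
- move=> xi G hG t; have [_ [_ /(_ G hG) [b1 b2]]] := hu xi.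
  by case: (hden xi) => -[hre ->]; [exact: b1|exact: b2].
Qed.

(** Since Re (-rho) <= 0 the relevant denominator is |1 - E|, which is the second quantity of
    (III). *)
Let minus_branch g : EMfam m g -> exists2 u, EMfam m u &
  forall xi t, cderiv (u xi) t (ode_coef s q (kap xi) (- rho xi) t * u xi t + g xi t)%C.
Proof.
apply: (@branch (fun xi => - rho xi)%C (fun xi => Cmod (RtoC 1 - monodromy s q (kap xi) (- rho xi)))).
- by right.
- by left; split=> //=; have [_ H] := hrho xi; rewrite /Re in H *; lra.
- move=> eps /hIII [Ce [gam [Ce0 [_ h]]]]; exists Ce, gam; split=> // xi /h H.
  apply: Rle_trans H _; apply: Rle_trans (Rmin_r _ _) _; apply: Req_le; congr (Cmod (_ - cexp _)).
  by rewrite /kap -/s0 -/q0; ring.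
Qed.

(** The first quantity of (III), multiplied by |exp (-s0 - 2 pi i xi.p0)| = exp (-s0), becomes |1 -
    1/E|; this is the origin of the factor exp (-s0). *)
Let plus_branch g : EMfam m g -> exists2 u, EMfam m u &
  forall xi t, cderiv (u xi) t (ode_coef s q (kap xi) (rho xi) t * u xi t + g xi t)%C.
Proof.
apply: (@branch rho (fun xi => Cmod (RtoC 1 - / monodromy s q (kap xi) (rho xi)))).
- by left.
- by right; split=> //; case: (hrho xi).
- move=> eps /hIII [Ce [gam [Ce0 [_ h]]]]; exists (Ce * exp (- s0)), gam; split.
    by apply: Rmult_lt_0_compat => //; exact: exp_pos.
  move=> xi /h H.
  have {}H := Rle_trans _ _ _ H (Rmin_l _ _).
  rewrite (Rmult_comm Ce) Rmult_assoc.
  apply: Rle_trans (Rmult_le_compat_l _ _ _ (Rlt_le _ _ (exp_pos _)) H) _.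
  have -> : exp (- s0) = Cmod (cexp (- (RtoC s0 + Ci * RtoC (2 * PI * kap xi)))).
    by rewrite Cmod_cexp; congr exp => /=; ring.
  rewrite -Cmod_mult -Cmod_opp; apply: Req_le; congr Cmod.
  rewrite /monodromy -/s0 -/q0 -cexp_opp.
  set w := (RtoC s0 + Ci * RtoC (2 * PI * kap xi))%C.
  have -> : (- (w + rho xi * RtoC q0))%C = (- w + - rho xi * RtoC q0)%C by ring.
  rewrite -/(kap xi) -/w cexp_add [cexp (- w)]cexp_opp; field; exact: cexp_neq0.
Qed.

Lemma solve_frequency_system (F : ('I_n -> Z) -> R -> C) : EMfam m F ->
  exists2 c, EMfam m c & forall xi t, cderiv (c xi) t
    (((RtoC (s t) + Ci * RtoC (kap xi)) * c xi t
      + RtoC (q t) * ((- RtoC (X xi) + Ci * RtoC delta) * c xi t + alpha * Cconj (c (zopp xi) t)))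
     + F xi t)%C.
Proof.
move=> hF.
have [K K0 hK] := bounds.
pose F2 xi t := Cconj (F (zopp xi) t).
have hF2 : EMfam m F2 by exact: EMfam_conj.
(* The first component of the spectral projection (1 + M / r) / 2 applied to (F, F2). *)
pose gr (r : ('I_n -> Z) -> C) xi t := ((RtoC (/ 2) * (RtoC 1 + m11 xi / r xi)) * F xi t
   + (RtoC (/ 2) * alpha / r xi) * F2 xi t)%C.
have sD : 0 < / sqrt Dl by apply/Rinv_0_lt_compat/sqrt_lt_R0.
have half : Cmod (RtoC (/ 2)) = / 2 by rewrite Cmod_R Rabs_pos_eq //; lra.
have hgr r : (forall xi, r xi = rho xi \/ r xi = (- rho xi)%C) -> EMfam m (gr r).
  move=> hr.
  have ri xi : Cmod (/ r xi) <= / sqrt Dl.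
    have r0 := @rho_neq0 xi.
    case: (hr xi) => ->; first exact: rho_inv.
    have -> : (/ - rho xi)%C = (- / rho xi)%C by field.
    by rewrite Cmod_opp; exact: rho_inv.
  apply: (EMfam_plus hm).
  - apply: (@EMfam_scale m hm n (fun xi => RtoC (/ 2) * (RtoC 1 + m11 xi / r xi))%C (1 + K * / sqrt Dl) F) => // xi.
    have [h1 _ _] := hK xi; have N1 := freq_ge1 xi.
    rewrite Cmod_mult half.
    have := Cmod_triangle (RtoC 1) (m11 xi / r xi); rewrite Cmod_1 [Cmod (_ / _)]Cmod_mult.
    have := Rmult_le_compat _ _ _ _ (Cmod_ge_0 _) (Cmod_ge_0 _) h1 (ri xi).
    have : 0 <= K * freq xi * / sqrt Dl by apply: Rmult_le_pos; [apply: Rmult_le_pos|]; lra.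
    lra.
  - apply: (@EMfam_scale m hm n (fun xi => RtoC (/ 2) * alpha / r xi)%C (Cmod alpha * / sqrt Dl) F2) => // xi.
    have N1 := freq_ge1 xi.
    rewrite !Cmod_mult half.
    have a0 := Cmod_ge_0 alpha.
    have h2 := Rmult_le_compat_l _ _ _ a0 (ri xi).
    have h3 : 0 <= Cmod alpha * / sqrt Dl by apply: Rmult_le_pos; lra.
    have := Cmod_ge_0 (/ r xi); have := Rmult_le_compat_l _ _ _ h3 N1.
    nra.
have [up hup dup] := plus_branch (hgr rho (fun xi => or_introl erefl)).
have [um hum dum] := minus_branch (hgr (fun xi => - rho xi)%C (fun xi => or_intror erefl)).
pose u1 xi t := (up xi t + um xi t)%C.
(* (u, (r - m11) / alpha * u) is an eigenvector of M for the eigenvalue r. *)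
pose zp xi := ((rho xi - m11 xi) / alpha)%C.
pose zm xi := ((- rho xi - m11 xi) / alpha)%C.
pose v1 xi t := (zp xi * up xi t + zm xi * um xi t)%C.
have hu1 : EMfam m u1 by apply: (EMfam_plus hm).
have zb xi (r : C) : Cmod r <= K * freq xi -> Cmod ((r - m11 xi) / alpha)%C <= (2 * K * Cmod (/ alpha)) * freq xi.
  move=> h; have [h1 _ _] := hK xi.
  rewrite Cmod_mult.
  have h3 : Cmod (r - m11 xi)%C <= 2 * K * freq xi by apply: Rle_trans (Cmod_sub_le _ _) _; lra.
  have := Rmult_le_compat_r _ _ _ (Cmod_ge_0 (/ alpha)) h3; lra.
have hv1 : EMfam m v1.
  apply: (EMfam_plus hm); [apply: (@EMfam_scale m hm n zp (2 * K * Cmod (/ alpha)) up)|apply: (@EMfam_scale m hm n zm (2 * K * Cmod (/ alpha)) um)] => // xi; apply: zb.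
  - by case: (hK xi).
  - by rewrite Cmod_opp; case: (hK xi).
pose v1c xi t := Cconj (v1 (zopp xi) t).
have hv1c : EMfam m v1c by exact: EMfam_conj.
pose c xi t := (RtoC (/ 2) * (u1 xi t + v1c xi t))%C.
have du1 xi t : cderiv (u1 xi) t ((RtoC (s t) + Ci * RtoC (kap xi)) * u1 xi t
   + RtoC (q t) * (m11 xi * u1 xi t + alpha * v1 xi t) + F xi t)%C.
  apply: cderiv_eq (cderiv_plus (dup xi t) (dum xi t)) _.
  rewrite /gr /v1 /u1 /zp /zm /ode_coef.
  have r0 := @rho_neq0 xi.
  rewrite (_ : RtoC (/ 2) = (/ RtoC 2)%C); last by rewrite RtoC_inv //; lra.
  have two : RtoC 2 <> RtoC 0 by move=> /RtoC_inj; lra.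
  by field; repeat split => //; move=> h; apply: r0; rewrite -[rho xi]Copp_involutive h Copp_0.
have dv1 xi t : cderiv (v1 xi) t ((RtoC (s t) + Ci * RtoC (kap xi)) * v1 xi t
   + RtoC (q t) * (Cconj alpha * u1 xi t - m11 xi * v1 xi t) + F2 xi t)%C.
  apply: cderiv_eq (cderiv_plus (cderiv_scal (zp xi) (dup xi t)) (cderiv_scal (zm xi) (dum xi t))) _.
  (* Expressing conj alpha through rho, m11 and alpha makes the eigenvector identity a rational one,
     which [field] decides. *)
  have e : Cconj alpha = ((rho xi * rho xi - m11 xi * m11 xi) / alpha)%C.
    by rewrite rho_sq'; field.
  rewrite /gr /v1 /u1 /zp /zm /ode_coef e.
  have r0 := @rho_neq0 xi.
  rewrite (_ : RtoC (/ 2) = (/ RtoC 2)%C); last by rewrite RtoC_inv //; lra.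
  have two : RtoC 2 <> RtoC 0 by move=> /RtoC_inj; lra.
  by field; repeat split => //; move=> h; apply: r0; rewrite -[rho xi]Copp_involutive h Copp_0.
have kapN xi : kap (zopp xi) = - kap xi.
  have kE z : kap z = dotR p0 (ZtoR z) by apply: eq_bigr => j _; ring.
  by rewrite !kE dotR_zopp.
(* Conjugation combined with xi -> -xi fixes s + i [kap] and sends -m11 to m11; hence conj v1(-xi)
   solves the equation of u1, with conj u1(-xi) in the place of v1. *)
have dv1c xi t : cderiv (v1c xi) t ((RtoC (s t) + Ci * RtoC (kap xi)) * v1c xi t
   + RtoC (q t) * (m11 xi * v1c xi t + alpha * Cconj (u1 (zopp xi) t)) + F xi t)%C.
  apply: cderiv_eq (cderiv_conj (dv1 (zopp xi) t)) _.
  rewrite /v1c /F2 /m11 /X kapN dotR_zopp zoppK.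
  move: (v1 (zopp xi) t) (u1 (zopp xi) t) (F xi t) => V U Y.
  have RC x : Cconj (RtoC x) = RtoC x by apply: C_eq => /=; ring.
  have IC : Cconj Ci = (- Ci)%C by apply: C_eq => /=; ring.
  rewrite !(Cplus_conj, Cminus_conj, Cmult_conj, Copp_conj, Cconj_conj, RC, IC).
  by rewrite !RtoC_opp; ring.
exists c.
  apply: (@EMfam_scale m hm n (fun=> RtoC (/ 2)) (/ 2) (fun xi t => u1 xi t + v1c xi t)%C).
    by move=> xi; rewrite half; have := freq_ge1 xi; lra.
  exact: (EMfam_plus hm).
move=> xi t.
apply: cderiv_eq (cderiv_scal (RtoC (/ 2)) (cderiv_plus (du1 xi t) (dv1c xi t))) _.
rewrite /c Cmult_conj Cplus_conj /v1c zoppK Cconj_conj.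
have -> : Cconj (RtoC (/ 2)) = RtoC (/ 2) by apply: C_eq => /=; ring.
rewrite /m11.
rewrite (_ : RtoC (/ 2) = (/ RtoC 2)%C); last by rewrite RtoC_inv //; lra.
by field => /RtoC_inj; lra.
Qed.
End System.

(** * Fourier coefficients in one coordinate *)

Definition cis (x : R) : C := (cos x, sin x).

Lemma cis_add x y : cis (x + y) = (cis x * cis y)%C.
Proof. by rewrite /cis cos_plus sin_plus; apply: C_eq => /=; ring. Qed.

Lemma cis0 : cis 0 = RtoC 1.
Proof. by rewrite /cis cos_0 sin_0. Qed.

Lemma Cmod_cis x : Cmod (cis x) = 1.
Proof.
rewrite /Cmod /= -[RHS]sqrt_1; congr sqrt.
by have := sin2_cos2 x; rewrite /Rsqr; lra.
Qed.

Lemma cis_conj x : Cconj (cis x) = cis (- x).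
Proof. by rewrite /cis cos_neg sin_neg. Qed.

Lemma cderiv_cis (f : R -> R) x l : is_derive f x l ->
  cderiv (fun t => cis (f t)) x (Ci * RtoC l * cis (f x))%C.
Proof.
move=> h; split.
- have := is_derive_comp cos f x _ _ (is_derive_cos _) h.
  by congr is_derive; rewrite /scal /= /mult /=; ring.
- have := is_derive_comp sin f x _ _ (is_derive_sin _) h.
  by congr is_derive; rewrite /scal /= /mult /=; ring.
Qed.

Lemma cis_periodicZ x (k : Z) : cis (x + 2 * PI * IZR k) = cis x.
Proof.
have nn (a : nat) y : cis (y + 2 * PI * INR a) = cis y.
  by rewrite (_ : 2 * PI * INR a = 2 * INR a * PI) /cis ?cos_period ?sin_period //; ring.
have [a [->|->]] : exists a : nat, k = Z.of_nat a \/ k = (- Z.of_nat a)%Z.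
  by exists (Z.abs_nat k); lia.
- by rewrite -INR_IZR_INZ nn.
- by rewrite opp_IZR -INR_IZR_INZ -[LHS](nn a); congr cis; ring.
Qed.

Section Coordinates.
Variable N : nat.
Implicit Types (x y : 'I_N -> R) (i j : 'I_N) (f g : ('I_N -> R) -> C).

Lemma upd_same x j r : upd x j r j = r.
Proof. by rewrite /upd eqxx. Qed.

Lemma upd_neq x i j r : i != j -> upd x j r i = x i.
Proof. by rewrite /upd => /negbTE ->. Qed.

Lemma upd_upd x j r r' : upd (upd x j r) j r' = upd x j r'.
Proof. by apply: functional_extensionality => k; rewrite /upd; case: (k == j). Qed.

Lemma upd_id x j : upd x j (x j) = x.
Proof. by apply: functional_extensionality => k; rewrite /upd; case: eqP => // ->. Qed.

Lemma upd_comm x i j r r' : i != j -> upd (upd x i r) j r' = upd (upd x j r') i r.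
Proof.
move=> ij; apply: functional_extensionality => k; rewrite /upd.
by case: (k =P j) => // ->; rewrite eq_sym (negbTE ij).
Qed.

Lemma smooth_cont f : smooth f -> forall x, continuous f x.
Proof. by move=> h x; case: (h [::] x). Qed.

Lemma smooth_pderiv f j : smooth f -> smooth (pderiv j f).
Proof. by move=> h l; move: (h (rcons l j)); rewrite -cats1 foldr_cat. Qed.

Lemma smooth_iter_pderiv f j k : smooth f -> smooth (iter k (@pderiv N j) f).
Proof. by move=> h; elim: k => //= k; exact: smooth_pderiv. Qed.

(** Coinduction for [smooth]: closure of a class under [pderiv] replaces the computation of iterated
    derivatives. *)
Lemma smooth_coind (S : (('I_N -> R) -> C) -> Prop) :
  (forall f, S f -> (forall x, continuous f x) /\
     forall j, (forall x, ex_pderiv j f x) /\ S (pderiv j f)) ->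
  forall f, S f -> smooth f.
Proof.
move=> H f Sf l.
have Sl : S (foldr (@pderiv N) f l) by elim: l => //= j l IH; case: (H _ IH) => _ /(_ j) [].
by move=> x; have [h1 h2] := H _ Sl; split=> // j; case: (h2 j).
Qed.

Lemma smooth_cderiv f : smooth f -> forall j x r,
  cderiv (fun t => f (upd x j t)) r (pderiv j f (upd x j r)).
Proof.
move=> h j x r; have [_ /(_ j) []] := h [::] (upd x j r).
rewrite /= upd_same => h1 h2.
have e : (fun t => f (upd (upd x j r) j t)) = (fun t => f (upd x j t)).
  by apply: functional_extensionality => t; rewrite upd_upd.
have := @cderiv_CD (fun t => f (upd (upd x j r) j t)) r h1 h2.
by rewrite e /pderiv upd_same => H; apply: cderiv_eq H _; rewrite -e.
Qed.

Lemma pderiv_cderiv f j (df : ('I_N -> R) -> C) :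
  (forall x r, cderiv (fun t => f (upd x j t)) r (df (upd x j r))) ->
  (forall x, ex_pderiv j f x) /\ pderiv j f = df.
Proof.
move=> h; split=> [x|].
  by have [h1 h2] := h x (x j); split; eexists; eauto.
apply: functional_extensionality => x.
by have := cderiv_unique (h x (x j)); rewrite upd_id.
Qed.

Lemma upd_cont x j (r : R) : continuous (fun t => upd x j t) r.
Proof.
apply/filterlim_locally => eps; exists eps => t ht k.
by rewrite /upd; case: (k == j) => //; exact: ball_center.
Qed.

Lemma upd2_cont x i j (z : R * R) : continuous (fun w : R * R => upd (upd x i w.1) j w.2) z.
Proof.
apply/filterlim_locally => eps; exists eps => -[u v] [hu hv] k.
by rewrite /upd; case: (k == j) => //; case: (k == i) => //; exact: ball_center.
Qed.

Lemma upd_ccont f x j : (forall y, continuous f y) -> Rcont (fun t => f (upd x j t)).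
Proof.
by move=> h r; apply/ccontP; apply: (continuous_comp (fun t => upd x j t) f); [exact: upd_cont|exact: h].
Qed.

Lemma periodic_upd f x j (k : Z) r : torus_periodic f -> f (upd x j (r + 2 * PI * IZR k)) = f (upd x j r).
Proof.
move=> h; rewrite -(h (upd x j r) (fun i => if i == j then k else 0%Z)); congr f.
by apply: functional_extensionality => i; rewrite /upd; case: (i == j); ring.
Qed.

Lemma torus_periodic_pderiv f j : smooth f -> torus_periodic f -> torus_periodic (pderiv j f).
Proof.
move=> sf pf x k; set z := fun i => _.
have h := smooth_cderiv sf j z (x j + 2 * PI * IZR (k j)).
have e0 : upd z j (x j + 2 * PI * IZR (k j)) = z by exact: upd_id.
rewrite e0 in h.
have h2 := cderiv_shift h.
have h3 := smooth_cderiv sf j x (x j); rewrite upd_id in h3.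
rewrite -(cderiv_unique h2) -(cderiv_unique h3); congr CD.
apply: functional_extensionality => t.
rewrite -(pf (upd x j t) k); congr f.
by apply: functional_extensionality => i; rewrite /upd /z; case: (i =P j) => [->|].
Qed.

(** Kept as a function of all N variables, constant in the j-th, so that coefficients in several
    variables can be iterated. *)
Definition fcoef (j : 'I_N) (k : Z) f x : C :=
  (RtoC (/ (2 * PI)) * CInt (fun r => f (upd x j r) * cis (- (IZR k * r))) 0 (2 * PI))%C.

Lemma cis_lin_ccont a : Rcont (fun r => cis (- (a * r))).
Proof.
by move=> r; apply: cderiv_ccont; apply: cderiv_cis; auto_derive.
Qed.

Lemma fcoef_integrand_cont f x j a : (forall y, continuous f y) ->
  Rcont (fun r => f (upd x j r) * cis (- (a * r)))%C.
Proof. by move=> h r; apply: ccont_mult; [exact: upd_ccont|exact: cis_lin_ccont]. Qed.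

Lemma fcoef_upd j k f x r : fcoef j k f (upd x j r) = fcoef j k f x.
Proof. by rewrite /fcoef; congr Cmult; apply: CInt_ext => t; rewrite upd_upd. Qed.

Lemma fcoef_plus j k f g : (forall y, continuous f y) -> (forall y, continuous g y) ->
  fcoef j k (fun y => f y + g y)%C = fun x => (fcoef j k f x + fcoef j k g x)%C.
Proof.
move=> hf hg; apply: functional_extensionality => x; rewrite /fcoef -Cmult_plus_distr_l.
rewrite -CInt_plus; try exact: fcoef_integrand_cont.
by congr Cmult; apply: CInt_ext => t; ring.
Qed.

Lemma fcoef_scal j k c f : (forall y, continuous f y) ->
  fcoef j k (fun y => c * f y)%C = fun x => (c * fcoef j k f x)%C.
Proof.
move=> hf; apply: functional_extensionality => x; rewrite /fcoef.
rewrite Cmult_assoc (Cmult_comm c) -Cmult_assoc -(CInt_scal c); last exact: fcoef_integrand_cont.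
by congr Cmult; apply: CInt_ext => t; ring.
Qed.

Lemma fcoef_bound j k f M x : (forall y, continuous f y) ->
  (forall r, 0 <= r <= 2 * PI -> Cmod (f (upd x j r)) <= M) -> Cmod (fcoef j k f x) <= 2 * M.
Proof.
move=> hf hM; have pi0 := PI_RGT_0.
rewrite /fcoef Cmod_mult Cmod_R Rabs_pos_eq; last by apply/Rlt_le/Rinv_0_lt_compat; lra.
have h := @CInt_le _ 0 (2 * PI) M ltac:(lra) (fcoef_integrand_cont x j (IZR k) hf) _.
apply: Rle_trans (Rmult_le_compat_l _ _ _ _ (h _)) _.
- by apply/Rlt_le/Rinv_0_lt_compat; lra.
- by move=> t ht; rewrite Cmod_mult Cmod_cis Rmult_1_r; exact: hM.
- by apply: Req_le; field; lra.
Qed.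

Lemma fcoef_periodic j k f : torus_periodic f -> torus_periodic (fcoef j k f).
Proof.
move=> pf x z; rewrite /fcoef; congr Cmult; apply: CInt_ext => t; congr Cmult.
rewrite -(pf (upd x j t) (fun i => if i == j then 0%Z else z i)); congr f.
by apply: functional_extensionality => i; rewrite /upd; case: (i == j); ring.
Qed.

(** Compactness of the segment makes continuity uniform along it. A quarter of eps per component
    gives eps / 2 for the modulus, and two comparisons with a common centre give eps. *)
Lemma tube_cont f x j (eps : R) : 0 < eps -> (forall y, continuous f y) ->
  exists d : posreal, forall y, ball x d y -> forall r, 0 <= r <= 2 * PI ->
    Cmod (f (upd y j r) - f (upd x j r)) <= eps.
Proof.
move=> e0 hf.
have e4 : 0 < eps / 4 by lra.
have ex r : exists d : posreal, forall z, ball (upd x j r) d z -> Cmod (f z - f (upd x j r)) <= eps / 2.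
  have /filterlim_locally /(_ (mkposreal _ e4)) [d hd] := hf (upd x j r).
  exists d => z /hd [/= h1 h2]; apply: Rle_trans (Cmod_le_abs _) _.
  by move: h1 h2; rewrite /ball /= /AbsRing_ball /abs /minus /plus /opp /= /Rminus => h1 h2; lra.
pose dl r := proj1_sig (constructive_indefinite_description _ (ex r)).
have hdl r := proj2_sig (constructive_indefinite_description _ (ex r)); rewrite -/(dl _) in hdl.
have [d hd] := compactness_value_1d 0 (2 * PI) dl.
exists d => y hy r hr.
(* The compactness lemma provides the centre t only up to double negation, hence the argument by
   contradiction. *)
apply: Rnot_lt_le => lt; apply: (hd r hr) => -[t [ht [rt dt]]].
have b1 : ball (upd x j t) (dl t) (upd y j r).
  move=> i; rewrite /upd; case: (i == j).
    exact: rt.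
  exact: (ball_le _ _ _ dt _ (hy i)).
have b2 : ball (upd x j t) (dl t) (upd x j r).
  move=> i; rewrite /upd; case: (i == j); [exact: rt|exact: ball_center].
have := hdl t _ b1; have := hdl t _ b2.
have := Cmod_sub_le (f (upd y j r) - f (upd x j t)) (f (upd x j r) - f (upd x j t)).
rewrite (_ : (f (upd y j r) - f (upd x j t) - (f (upd x j r) - f (upd x j t)))%C = (f (upd y j r) - f (upd x j r))%C); last by ring.
lra.
Qed.

Lemma fcoef_cont j k f : (forall y, continuous f y) -> forall x, continuous (fcoef j k f) x.
Proof.
move=> hf x.
have key (eps : posreal) : locally x (fun y => Cmod (fcoef j k f y - fcoef j k f x) < eps).
  have e2 : 0 < eps / 4 by have := cond_pos eps; lra.
  have [d hd] := @tube_cont f x j (eps / 4) e2 hf.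
  exists d => y hy.
  have -> : (fcoef j k f y - fcoef j k f x)%C =
     (RtoC (/ (2 * PI)) * CInt (fun r => f (upd y j r) * cis (- (IZR k * r)) + RtoC (-1) * (f (upd x j r) * cis (- (IZR k * r)))) 0 (2 * PI))%C.
    rewrite CInt_plus ?CInt_scal; try exact: fcoef_integrand_cont.
      by rewrite /fcoef; ring.
    by move=> t; apply: ccont_scal; exact: fcoef_integrand_cont.
  have pi0 := PI_RGT_0.
  rewrite Cmod_mult Cmod_R Rabs_pos_eq; last by apply/Rlt_le/Rinv_0_lt_compat; lra.
  have := @CInt_le (fun r => f (upd y j r) * cis (- (IZR k * r)) + RtoC (-1) * (f (upd x j r) * cis (- (IZR k * r))))%C 0 (2 * PI) (eps / 4) ltac:(lra).
  move=> /(_ _ _) H.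
  apply: Rle_lt_trans (Rmult_le_compat_l _ _ _ _ (H _ _)) _.
  - by apply/Rlt_le/Rinv_0_lt_compat; lra.
  - by move=> t; apply: ccont_plus; [exact: fcoef_integrand_cont|apply: ccont_scal; exact: fcoef_integrand_cont].
  - move=> t ht.
    have -> : (f (upd y j t) * cis (- (IZR k * t)) + RtoC (-1) * (f (upd x j t) * cis (- (IZR k * t))))%C = ((f (upd y j t) - f (upd x j t)) * cis (- (IZR k * t)))%C by ring.
    by rewrite Cmod_mult Cmod_cis Rmult_1_r; exact: hd.
  - have -> : / (2 * PI) * (2 * (eps / 4) * (2 * PI - 0)) = eps / 2 by field; lra.
    by have := cond_pos eps; lra.
apply/ccontP; split; apply/filterlim_locally => eps; apply: filter_imp (key eps) => y hy.
- by apply: Rle_lt_trans (Rabs_Re_le _) hy.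
- by apply: Rle_lt_trans (Rabs_Im_le _) hy.
Qed.

Lemma RInt_param_deriv (H H' : R -> R -> R) a b u :
  (forall u v, is_derive (fun u => H u v) u (H' u v)) ->
  (forall u v, continuous (H u) v) ->
  (forall z : R * R, continuous (fun w : R * R => H' w.1 w.2) z) ->
  is_derive (fun u => RInt (H u) a b) u (RInt (H' u) a b).
Proof.
move=> dH cH cH'.
have e w v : Derive (fun u => H u v) w = H' w v by exact: is_derive_unique.
have -> : RInt (H' u) a b = RInt (fun t => Derive (fun u => H u t) u) a b.
  by apply: RInt_ext => t _; rewrite e.
apply: is_derive_RInt_param.
- by apply: filter_forall => w t _; eexists; exact: dH.
- move=> t _; apply/continuity_2d_pt_filterlim.
  rewrite e; apply: filterlim_ext (cH' (u, t)) => w; by rewrite e.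
- by apply: filter_forall => w; exact: ex_RInt_cont.
Qed.

Lemma fcoef_pderiv_neq i j k f : i != j -> smooth f ->
  (forall x, ex_pderiv i (fcoef j k f) x) /\
  pderiv i (fcoef j k f) = fcoef j k (pderiv i f).
Proof.
move=> ij sf; apply: pderiv_cderiv => x r.
apply: cderiv_scal.
have c1 := smooth_cont sf; have c2 := smooth_cont (smooth_pderiv i sf).
pose H u v := (f (upd (upd x i u) j v) * cis (- (IZR k * v)))%C.
pose H' u v := (pderiv i f (upd (upd x i u) j v) * cis (- (IZR k * v)))%C.
have dH u v : cderiv (fun u => H u v) u (H' u v).
  have h := smooth_cderiv sf i (upd x j v) u.
  have h2 := cderiv_mult h (cderiv_const (cis (- (IZR k * v))) u).
  apply: cderiv_ext (cderiv_eq h2 _) => [t|]; first by rewrite /H (upd_comm x t v ij).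
  by rewrite /H' (upd_comm x u v ij); ring.
have cH u : Rcont (H u) by exact: fcoef_integrand_cont.
have cH' (z : R * R) : ccont (fun w : R * R => H' w.1 w.2) z.
  apply: ccont_mult.
    apply/ccontP; apply: (continuous_comp (fun w : R * R => upd (upd x i w.1) j w.2)); [exact: upd2_cont|exact: c2].
  apply/ccontP; apply: (continuous_comp (fun w : R * R => w.2) (fun r => cis (- (IZR k * r)))).
    exact: continuous_snd.
  by apply/ccontP; exact: cis_lin_ccont.
split.
- apply: (@RInt_param_deriv (fun u v => Re (H u v)) (fun u v => Re (H' u v))) => [u v|u v|z].
  + by case: (dH u v).
  + by case: (cH u v).
  + by case: (cH' z).
- apply: (@RInt_param_deriv (fun u v => Im (H u v)) (fun u v => Im (H' u v))) => [u v|u v|z].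
  + by case: (dH u v).
  + by case: (cH u v).
  + by case: (cH' z).
Qed.

Lemma fcoef_smooth j k f : smooth f -> smooth (fcoef j k f).
Proof.
move=> sf.
(* The zero function belongs to the class because a coefficient in the variable j has zero
   derivative in that variable. *)
apply: (@smooth_coind (fun F => F = (fun=> RtoC 0) \/ exists2 g, smooth g & F = fcoef j k g)).
  have z0 i : (forall x, ex_pderiv i (fun _ : 'I_N -> R => RtoC 0) x) /\ pderiv i (fun _ : 'I_N -> R => RtoC 0) = fun=> RtoC 0.
    by apply: pderiv_cderiv => x r; exact: cderiv_const.
  move=> F [->|[g sg ->]].
    split=> [x|i]; first by apply/ccontP; exact: ccont_const.
    by have [h1 h2] := z0 i; split=> //; left.
  split=> [x|i]; first by apply: fcoef_cont; exact: smooth_cont.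
  have [->|ij] := eqVneq i j.
    have [|h1 h2] := @pderiv_cderiv (fcoef j k g) j (fun=> RtoC 0).
      move=> x r; apply: cderiv_ext (cderiv_const (fcoef j k g x) r) => t.
      by rewrite fcoef_upd.
    by split=> //; left.
  have [h1 h2] := fcoef_pderiv_neq k ij sg.
  by split=> //; right; exists (pderiv i g) => //; exact: smooth_pderiv.
by right; exists f.
Qed.

(** Integration by parts: f times the exponential is periodic, so its derivative integrates to 0. *)
Lemma fcoef_pderiv_same j k f x : smooth f -> torus_periodic f ->
  fcoef j k (pderiv j f) x = (Ci * RtoC (IZR k) * fcoef j k f x)%C.
Proof.
move=> sf pf.
have c1 := smooth_cont sf; have c2 := smooth_cont (smooth_pderiv j sf).
have dl (a : R) r : is_derive (fun r => - (a * r)) r (- a).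
  by auto_derive => //; ring.
have H1 : Rcont (fun r => pderiv j f (upd x j r) * cis (- (IZR k * r)) + (- Ci * RtoC (IZR k)) * (f (upd x j r) * cis (- (IZR k * r))))%C.
  move=> t; apply: ccont_plus; first exact: fcoef_integrand_cont.
  by apply: ccont_scal; exact: fcoef_integrand_cont.
have H2 t : cderiv (fun r => f (upd x j r) * cis (- (IZR k * r)))%C t
    (pderiv j f (upd x j t) * cis (- (IZR k * t)) + (- Ci * RtoC (IZR k)) * (f (upd x j t) * cis (- (IZR k * t))))%C.
  apply: cderiv_eq (cderiv_mult (smooth_cderiv sf j x t) (cderiv_cis (dl (IZR k) t))) _.
  by rewrite RtoC_opp; ring.
have := CInt_FTC 0 (2 * PI) H1 H2.
rewrite CInt_plus ?CInt_scal; try exact: fcoef_integrand_cont; last first.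
  by move=> t; apply: ccont_scal; exact: fcoef_integrand_cont.
rewrite Rmult_0_r Ropp_0 -(periodic_upd x j 1 0 pf) Rplus_0_l Rmult_1_r.
have -> : cis (- (IZR k * (2 * PI))) = cis 0.
  by rewrite -(cis_periodicZ 0 (- k)); congr cis; rewrite opp_IZR; ring.
rewrite /fcoef.
set A := CInt (fun t => pderiv j f _ * _)%C _ _; set B := CInt _ _ _ => H.
have -> : A = (A + - Ci * RtoC (IZR k) * B + Ci * RtoC (IZR k) * B)%C by ring.
rewrite H; ring.
Qed.

End Coordinates.

(** * Partial Fourier coefficients in x *)

Section PartialFourier.
Variable n : nat.
Implicit Types (l : seq 'I_n) (xi : 'I_n -> Z) (f : ('I_n.+1 -> R) -> C) (y : 'I_n.+1 -> R).
Local Notation xvar j := (lift ord0 j : 'I_n.+1).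

Definition coef l xi f : ('I_n.+1 -> R) -> C := foldr (fun j g => fcoef (xvar j) (xi j) g) f l.

Lemma coef_smooth l xi f : smooth f -> smooth (coef l xi f).
Proof. by move=> sf; elim: l => //= j l IH; exact: fcoef_smooth. Qed.

Lemma coef_cont l xi f : (forall y, continuous f y) -> forall y, continuous (coef l xi f) y.
Proof. by move=> sf; elim: l => //= j l IH; exact: fcoef_cont. Qed.

Lemma coef_periodic l xi f : torus_periodic f -> torus_periodic (coef l xi f).
Proof. by move=> sf; elim: l => //= j l IH; exact: fcoef_periodic. Qed.

Lemma coef_pderiv l xi f (i : 'I_n.+1) : smooth f -> i \notin [seq xvar j | j <- l] ->
  pderiv i (coef l xi f) = coef l xi (pderiv i f).
Proof.
move=> sf; elim: l => //= j l IH; rewrite inE negb_or => /andP [ij il].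
by rewrite (fcoef_pderiv_neq (xi j) ij (coef_smooth l xi sf)).2 IH.
Qed.

Lemma coef_pderiv_in l xi f j : smooth f -> torus_periodic f -> uniq l -> j \in l ->
  coef l xi (pderiv (xvar j) f) = fun y => (Ci * RtoC (IZR (xi j)) * coef l xi f y)%C.
Proof.
move=> sf pf; elim: l => //= i l IH /andP [il ul]; rewrite inE.
have [-> _|ji /= jl] := eqVneq j i.
  rewrite -coef_pderiv //; last by rewrite mem_map //; exact: lift_inj.
  apply: functional_extensionality => y; rewrite fcoef_pderiv_same //; [exact: coef_smooth|exact: coef_periodic].
by rewrite IH // fcoef_scal //; exact/smooth_cont/coef_smooth.
Qed.

Lemma coef_bound l xi f M : (forall y, continuous f y) -> (forall y, Cmod (f y) <= M) ->
  forall y, Cmod (coef l xi f y) <= 2 ^ size l * M.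
Proof.
move=> cf hM; elim: l => [|j l IH] y /=; first by rewrite Rmult_1_l.
rewrite Rmult_assoc; apply: fcoef_bound => [z|r _]; last exact: IH.
exact: coef_cont.
Qed.

Lemma coef_agree l xi f y z : (forall i, i \notin [seq xvar j | j <- l] -> y i = z i) ->
  coef l xi f y = coef l xi f z.
Proof.
elim: l y z => [|j l IH] y z /= h; first by congr f; apply: functional_extensionality => i; exact: h.
rewrite /fcoef; congr Cmult; apply: CInt_ext => t; congr Cmult; apply: IH => i il.
rewrite /upd; case: eqP => // /eqP ij; apply: h.
by rewrite inE negb_or ij.
Qed.

Lemma eq_coef l xi xi' f : {in l, xi =1 xi'} -> coef l xi f = coef l xi' f.
Proof.
elim: l => //= j l IH h; rewrite IH => [|i il]; last by apply: h; rewrite inE il orbT.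
by rewrite h // inE eqxx.
Qed.

(** After a coefficient has been taken in every x_j only t matters, so the point may have any
    x-coordinates; the constant point t is convenient. *)
Definition fhat f xi (t : R) : C := coef (enum 'I_n) xi f (fun=> t).

Lemma coef_fhat xi f y : coef (enum 'I_n) xi f y = fhat f xi (y ord0).
Proof.
apply: coef_agree => i; case: (unliftP ord0 i) => [j ->|->] //.
by rewrite mem_map ?mem_enum //; exact: lift_inj.
Qed.

Lemma ord0_notin_xvar l : ord0 \notin [seq xvar j | j <- l].
Proof. by apply/mapP => -[j _ /eqP]; rewrite (negbTE (neq_lift _ _)). Qed.

Lemma fhat_cderiv f xi t : smooth f -> cderiv (fhat f xi) t (fhat (pderiv ord0 f) xi t).
Proof.
move=> sf.
have h := smooth_cderiv (coef_smooth (enum 'I_n) xi sf) ord0 (fun=> t) t.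
rewrite coef_pderiv ?ord0_notin_xvar // coef_fhat upd_same in h.
by apply: cderiv_ext h => r; rewrite coef_fhat upd_same.
Qed.

Lemma fhat_iter f xi : smooth f ->
  (forall k, iter k CD (fhat f xi) = fhat (iter k (@pderiv n.+1 ord0) f) xi) /\ csmooth (fhat f xi).
Proof.
move=> sf; apply: (@csmooth_seq (fun k => fhat (iter k (@pderiv n.+1 ord0) f) xi)) => k t.
exact/fhat_cderiv/smooth_iter_pderiv.
Qed.

Lemma fhat_iter_x f xi j b : smooth f -> torus_periodic f ->
  torus_periodic (iter b (@pderiv n.+1 (xvar j)) f) /\
  fhat (iter b (@pderiv n.+1 (xvar j)) f) xi = fun t => ((Ci * RtoC (IZR (xi j))) ^ b * fhat f xi t)%C.
Proof.
move=> sf pf; elim: b => [|b [IH1 IH2]] /=.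
  by split=> //; apply: functional_extensionality => t; ring.
have sb := smooth_iter_pderiv (xvar j) b sf.
split; first exact: torus_periodic_pderiv.
apply: functional_extensionality => t.
rewrite {1}/fhat coef_pderiv_in ?enum_uniq ?mem_enum //.
by have := f_equal (fun g => g t) IH2; rewrite /fhat => ->; ring.
Qed.

(** Derivatives in t and a single x_j suffice, because the largest |xi_j| controls the whole
    frequency. *)
Lemma mderiv_tx (j : 'I_n) k b f :
  let beta := fun i : 'I_n.+1 => if i == ord0 then k else if i == xvar j then b else 0%N in
  mderiv beta f = iter k (@pderiv n.+1 ord0) (iter b (@pderiv n.+1 (xvar j)) f) /\ mlength beta = (k + b)%N.
Proof.
move=> beta.
have l0 (i : 'I_n) : (xvar i == ord0) = false by rewrite eq_sym (negbTE (neq_lift _ _)).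
split.
- rewrite /mderiv enum_ordSl /= /beta eqxx; congr iter.
  have : uniq (enum 'I_n) by exact: enum_uniq.
  have : j \in enum 'I_n by rewrite mem_enum.
  elim: (enum 'I_n) => //= i l IH; rewrite inE => /orP [/eqP <-|jl] /andP [il ul].
    rewrite eqxx.
    have -> : foldr (fun j0 g => iter (beta j0) (@pderiv n.+1 j0) g) f [seq xvar i | i <- l] = f; last by [].
    elim: l il {IH ul} => //= i' l IH; rewrite inE negb_or => /andP [ji il]; rewrite IH // /beta.
    by rewrite l0 (inj_eq lift_inj) eq_sym (negbTE ji).
  rewrite (inj_eq lift_inj).
  case: eqP => [e|_]; last exact: IH.
  by rewrite e jl in il.
- rewrite /mlength big_ord_recl /beta eqxx; congr addn.
  rewrite (bigD1 j) //= eqxx big1 ?addn0 // => i ij.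
  by rewrite (inj_eq lift_inj) (negbTE ij).
Qed.

(** The sum of squares is at most n times the largest one; n is used in place of its square root. *)
Lemma freq_le_max (hn : (0 < n)%N) xi : exists j, freq xi <= 1 + INR n * Rabs (IZR (xi j)).
Proof.
pose F (i : 'I_n) := Z.abs_nat (xi i).
case: (@arg_maxnP _ (Ordinal hn) predT F) => // j _ hj; exists j.
have n0 := pos_INR n; have x0 := Rabs_pos (IZR (xi j)).
rewrite /freq; apply: Rplus_le_compat_l.
rewrite /enorm -[X in _ <= X]sqrt_Rsqr; last exact: Rmult_le_pos.
apply: sqrt_le_1_alt.
apply: (Rle_trans _ (INR n * Rsqr (Rabs (IZR (xi j))))).
  rewrite /dotR.
  have -> : INR n = \big[Rplus/0]_(i < n) 1.
    rewrite big_const card_ord; elim: (n) => [|k IH] //; by rewrite S_INR iterS -IH; ring.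
  rewrite Rmult_comm rsum_scal; apply: rsum_le => i.
  have h : (F i <= F j)%N by exact: hj.
  have : Rabs (IZR (xi i)) <= Rabs (IZR (xi j)).
    rewrite -!abs_IZR -!Nat2Z.inj_abs_nat -!INR_IZR_INZ; exact: INR_leq.
  rewrite -Rsqr_abs /ZtoR => h2.
  have := Rsqr_le_abs_1 _ _ h2; rewrite /Rsqr; lra.
have n1 : 1 <= INR n by apply: (INR_leq hn).
rewrite /Rsqr; have : 0 <= Rabs (IZR (xi j)) * Rabs (IZR (xi j)) by nra.
nra.
Qed.

(** Powers of the largest |xi_j| are turned into x_j-derivatives of f. Each of the n coefficient
    integrals costs a factor 2, whence 2^n. *)
Lemma fhat_EMfam (m : nat -> R) (hm : weight_sequence m) (hn : (0 < n)%N) f :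
  class_EM m f -> EMfam m (fhat f).
Proof.
move=> [pf [sf [K [h [K0 [h0 hK]]]]]].
split=> [xi|xi t|].
- by case: (fhat_iter xi sf).
- rewrite /fhat -[RHS](coef_periodic (enum 'I_n) xi pf _ (fun=> 1%Z)).
  by congr coef; apply: functional_extensionality => i; ring.
have n1 : 1 <= INR n by apply: (INR_leq hn).
pose h1 := Rmax 1 h; have h11 : 1 <= h1 by apply: Rmax_l.
have hh1 : h <= h1 by apply: Rmax_r.
(* The factor 2n comes from bounding the b-th power of 1 + n |xi_j| by 2^b (1 + n^b |xi_j|^b). *)
pose A := 2 * INR n * h1.
have A1 : 1 <= A by rewrite /A; nra.
exists (2 * (2 ^ n * K)), A.
have p2 : 0 < 2 ^ n by apply: pow_lt; lra.
split=> //; first by Rmult_pos.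
move=> xi t k b; rewrite (proj1 (fhat_iter xi sf)).
have [j hj] := freq_le_max hn xi.
set x := Rabs (IZR (xi j)) in hj *.
have x0 : 0 <= x by apply: Rabs_pos.
have key b' : Cmod (fhat (iter k (@pderiv n.+1 ord0) f) xi t) * x ^ b' <= 2 ^ n * (K * h1 ^ (k + b') * wfact m (k + b')).
  have [pb eb] := fhat_iter_x xi j b' sf pf.
  have sb := smooth_iter_pderiv (xvar j) b' sf.
  have [e1 _] := fhat_iter xi sb; have [e2 s2] := fhat_iter xi sf.
  have [e3 _] := csmooth_seq (fun k t => cderiv_scal ((Ci * RtoC (IZR (xi j))) ^ b')%C (s2 k t)).
  have := f_equal (fun g => Cmod (g t)) (e3 k); rewrite /= -eb e1 e2 Cmod_mult Cmod_pow Cmod_mult Cmod_Ci Cmod_R Rmult_1_l -/x Rmult_comm => <-.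
  have := @coef_bound (enum 'I_n) xi (iter k (@pderiv n.+1 ord0) (iter b' (@pderiv n.+1 (xvar j)) f)) (K * h1 ^ (k + b') * wfact m (k + b')).
  rewrite size_enum_ord; apply.
    exact/smooth_cont/smooth_iter_pderiv.
  have [<- el] := mderiv_tx j k b' f.
  move=> y; have := hK (fun i : 'I_n.+1 => if i == ord0 then k else if i == xvar j then b' else 0%N) y.
  rewrite el => H; apply: Rle_trans H _.
  rewrite Rmult_assoc -/(wfact m _); apply: Rmult_le_compat_r; first exact: wfact_ge0.
  by apply: Rmult_le_compat_l; [lra|apply: pow_incr; lra].
set c := Cmod _; have c0 : 0 <= c by exact: Cmod_ge_0.
set V := wfact m (k + b).
have V0 : 0 <= V by exact: wfact_ge0.
have k0 := key 0%N; have kb := key b; rewrite -/c in k0 kb.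
have [X1 hX1] : exists X1, X1 = 2 ^ n * (K * h1 ^ (k + b) * V) by eexists.
have nb1 : 1 <= INR n ^ b by apply: pow_R1_Rle.
have hc : c <= X1.
  rewrite /= Rmult_1_r addn0 in k0; apply: Rle_trans k0 _; rewrite hX1.
  apply: Rmult_le_compat_l; first lra.
  have W1 : wfact m k <= V by apply: wfact_mono; rewrite ?leq_addr.
  have W0 := wfact_ge0 hm k.
  apply: Rmult_le_compat => //; first by apply: Rmult_le_pos; [lra|apply: pow_le; lra].
  apply: Rmult_le_compat_l; first lra.
  by apply: Rle_pow => //; apply/leP; rewrite leq_addr.
have hcb : c * x ^ b <= X1 by rewrite hX1.
have X0 : 0 <= X1 by lra.
have N0 := freq_gt0 xi.
have fb : freq xi ^ b <= 2 ^ b * (1 + INR n ^ b * x ^ b).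
  have nx : 0 <= INR n * x by apply: Rmult_le_pos; lra.
  have nxb : 0 <= (INR n * x) ^ b by apply: pow_le.
  rewrite -Rpow_mult_distr.
  have [le1|le1] := Rle_lt_dec (INR n * x) 1.
    apply: (Rle_trans _ (2 ^ b)); first by apply: pow_incr; lra.
    have : 0 < 2 ^ b by apply: pow_lt; lra.
    nra.
  apply: (Rle_trans _ ((2 * (INR n * x)) ^ b)); first by apply: pow_incr; lra.
  rewrite Rpow_mult_distr; apply: Rmult_le_compat_l; last lra.
  by apply: pow_le; lra.
have b2 : 0 < 2 ^ b by apply: pow_lt; lra.
apply: (Rle_trans _ (2 ^ b * (INR n ^ b * (2 * X1)))).
  apply: Rle_trans (Rmult_le_compat_l _ _ _ c0 fb) _.
  have -> : c * (2 ^ b * (1 + INR n ^ b * x ^ b)) = 2 ^ b * (c + INR n ^ b * (c * x ^ b)) by ring.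
  apply: Rmult_le_compat_l; first lra.
  have := Rmult_le_compat_l (INR n ^ b) _ _ ltac:(lra) hcb; nra.
rewrite hX1.
have hk : 0 <= h1 ^ (k + b) by apply: pow_le; lra.
have -> : 2 ^ b * (INR n ^ b * (2 * (2 ^ n * (K * h1 ^ (k + b) * V)))) =
  2 * (2 ^ n * K) * ((2 * INR n) ^ b * h1 ^ (k + b)) * V by rewrite Rpow_mult_distr; ring.
apply: Rmult_le_compat_r => //; apply: Rmult_le_compat_l; first by Rmult_pos.
rewrite /A (Rpow_mult_distr (2 * INR n) h1); apply: Rmult_le_compat_r => //.
by apply: Rle_pow; [lra|apply/leP; rewrite leq_addl].
Qed.

End PartialFourier.

(** * Fejer means *)

Fixpoint dirichlet (M : nat) (x : R) : R :=
  if M is M'.+1 then dirichlet M' x + 2 * cos (INR M * x) else 1.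

(** Unnormalised: M + 1 times the usual Fejer kernel, so that both kernels obey a plain
    recursion. *)
Fixpoint fejer (M : nat) (x : R) : R :=
  if M is M'.+1 then fejer M' x + dirichlet M x else 1.

(** Telescoping. The factor 1 - cos x is kept on the left, so the identity also holds where it
    vanishes. *)
Lemma dirichlet_closed M x :
  2 * (1 - cos x) * dirichlet M x = 2 * (cos (INR M * x) - cos (INR M.+1 * x)).
Proof.
elim: M => [|M IH]; first by rewrite /= Rmult_0_l cos_0 !Rmult_1_l Rmult_1_r.
rewrite [dirichlet _ _]/= -/(INR M.+1) Rmult_plus_distr_l IH.
have e1 : INR M.+2 * x = INR M.+1 * x + x by rewrite (S_INR M.+1); ring.
have e2 : INR M * x = INR M.+1 * x - x by rewrite (S_INR M); ring.
by rewrite e1 e2 cos_plus cos_minus; ring.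
Qed.

Lemma fejer_closed M x : 2 * (1 - cos x) * fejer M x = 2 * (1 - cos (INR M.+1 * x)).
Proof.
elim: M => [|M IH]; first by rewrite /= !Rmult_1_l Rmult_1_r.
by rewrite [fejer _ _]/= -/(dirichlet M.+1 x) Rmult_plus_distr_l IH dirichlet_closed; ring.
Qed.

Lemma fejer_ge0 M x : 0 <= fejer M x.
Proof.
have c1 := COS_bound x.
have [e|ne] := Req_dec (cos x) 1.
  (* Where cos x = 1 the closed form is void, but there every cosine in the kernel equals 1. *)
  have s0 : sin x = 0 by have := sin2_cos2 x; rewrite e /Rsqr => ?; nra.
  have ck k : cos (INR k * x) = 1 /\ sin (INR k * x) = 0.
    elim: k => [|k [ck sk]]; first by rewrite /= Rmult_0_l cos_0 sin_0.
    rewrite S_INR Rmult_plus_distr_r Rmult_1_l cos_plus sin_plus ck sk e s0; split; ring.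
  have dk k : 0 <= dirichlet k x.
    elim: k => [|k IH]; first by rewrite /=; lra.
    by rewrite [dirichlet _ _]/= -/(INR k.+1) (ck k.+1).1; lra.
  elim: M => [|k IH]; first by rewrite /=; lra.
  by rewrite [fejer _ _]/= -/(dirichlet k.+1 x); have := dk k.+1; lra.
have p : 0 < 2 * (1 - cos x) by lra.
apply: (Rmult_le_reg_l _ _ _ p); rewrite fejer_closed.
by have := COS_bound (INR M.+1 * x); lra.
Qed.

Lemma fejer_concentration M x : 2 * (1 - cos x) * fejer M x <= 4.
Proof. by rewrite fejer_closed; have := COS_bound (INR M.+1 * x); lra. Qed.

Lemma fejer_cont M : forall x : R, continuous (fejer M) x.
Proof.
have dc k x : continuous (dirichlet k) x.
  elim: k => [|k IH]; first exact: continuous_const.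
  apply: (@continuous_plus R_UniformSpace R_AbsRing R_NormedModule (dirichlet k)) => //.
  apply: (@ex_derive_continuous R_AbsRing R_NormedModule); auto_derive => //.
move=> x; elim: M => [|k IH]; first exact: continuous_const.
by apply: (@continuous_plus R_UniformSpace R_AbsRing R_NormedModule (fejer k)) => //; exact: dc.
Qed.

Fixpoint zr (M : nat) : seq Z :=
  if M is M'.+1 then Z.of_nat M :: (- Z.of_nat M)%Z :: zr M' else [:: 0%Z].

Lemma zrS M : zr M.+1 = Z.of_nat M.+1 :: (- Z.of_nat M.+1)%Z :: zr M.
Proof. by []. Qed.

(* The truncation at 0 lets Fejer means of different orders be compared as sums
   over one common box. *)
Definition fweight (M : nat) (k : Z) : R := Rmax 0 (1 - Rabs (IZR k) / INR M.+1).

Lemma fweight_ge0 M k : 0 <= fweight M k.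
Proof. exact: Rmax_l. Qed.

Lemma fweight_le1 M k : fweight M k <= 1.
Proof.
apply: Rmax_lub; first lra.
have := Rmult_le_pos _ _ (Rabs_pos (IZR k)) (Rlt_le _ _ (Rinv_0_lt_compat _ (lt_0_INR M.+1 ltac:(lia)))).
rewrite /Rdiv; lra.
Qed.

Lemma fweight_dist M k : Rabs (1 - fweight M k) <= Rabs (IZR k) / INR M.+1.
Proof.
rewrite Rabs_pos_eq; last by have := fweight_le1 M k; lra.
by rewrite /fweight; have := Rmax_r 0 (1 - Rabs (IZR k) / INR M.+1); lra.
Qed.

Lemma fweight_out M k : (Z.of_nat M < Z.abs k)%Z -> fweight M k = 0.
Proof.
move=> h; apply: Rmax_left.
have p : 0 < INR M.+1 by apply: lt_0_INR; lia.
have : INR M.+1 <= Rabs (IZR k) by rewrite -abs_IZR INR_IZR_INZ; apply: IZR_le; lia.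
move=> h2; have := (proj1 (Rle_div_r 1 (Rabs (IZR k)) (INR M.+1) p)); rewrite Rmult_1_l => h3; have := h3 h2; lra.
Qed.

Lemma fweight_opp M k : fweight M (- k) = fweight M k.
Proof. by rewrite /fweight opp_IZR Rabs_Ropp. Qed.

Lemma eq_zr_sum M (F G : Z -> C) : (forall k, (Z.abs k <= Z.of_nat M)%Z -> F k = G k) ->
  \big[Cplus/RtoC 0]_(k <- zr M) F k = \big[Cplus/RtoC 0]_(k <- zr M) G k.
Proof.
elim: M => [|M IH] h; first by rewrite !big_cons !big_nil h.
rewrite zrS !big_cons !h; try lia.
by congr (_ + (_ + _))%C; apply: IH => k hk; apply: h; lia.
Qed.

Lemma zr_sum_opp M (F : Z -> C) :
  \big[Cplus/RtoC 0]_(k <- zr M) F (- k)%Z = \big[Cplus/RtoC 0]_(k <- zr M) F k.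
Proof.
elim: M => [|M IH]; first by rewrite !big_cons !big_nil.
rewrite zrS !big_cons IH Z.opp_involutive; ring.
Qed.

Lemma cis_pair x : (cis x + cis (- x))%C = RtoC (2 * cos x).
Proof. by rewrite /cis cos_neg sin_neg; apply: C_eq => /=; ring. Qed.

Lemma zr_dirichlet M x : \big[Cplus/RtoC 0]_(k <- zr M) cis (IZR k * x) = RtoC (dirichlet M x).
Proof.
elim: M => [|M IH]; first by rewrite /= big_cons big_nil Rmult_0_l cis0; ring.
rewrite zrS !big_cons IH opp_IZR -Ropp_mult_distr_l Cplus_assoc cis_pair.
by rewrite [dirichlet _ _]/= RtoC_plus -INR_IZR_INZ Cplus_comm.
Qed.

Lemma zr_fejer M x :
  \big[Cplus/RtoC 0]_(k <- zr M) (RtoC (INR M.+1 - Rabs (IZR k)) * cis (IZR k * x))%C = RtoC (fejer M x).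
Proof.
elim: M => [|M IH].
  rewrite /= big_cons big_nil Rmult_0_l cis0 Rabs_R0; apply: C_eq => /=; ring.
rewrite [fejer _ _]/= -/(dirichlet M.+1 x) RtoC_plus -zr_dirichlet -IH zrS !big_cons.
have a1 : Rabs (IZR (Z.of_nat M.+1)) = INR M.+1.
  by rewrite -INR_IZR_INZ Rabs_pos_eq //; exact: pos_INR.
rewrite opp_IZR Rabs_Ropp a1.
have -> : INR M.+2 - INR M.+1 = 1 by rewrite (S_INR M.+1); ring.
have -> : \big[Cplus/RtoC 0]_(k <- zr M) (RtoC (INR M.+2 - Rabs (IZR k)) * cis (IZR k * x))%C =
  (\big[Cplus/RtoC 0]_(k <- zr M) (RtoC (INR M.+1 - Rabs (IZR k)) * cis (IZR k * x)) +
   \big[Cplus/RtoC 0]_(k <- zr M) cis (IZR k * x))%C.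
  rewrite -big_split; apply: eq_bigr => k _ /=.
  rewrite -/(INR M.+2) -/(INR M.+1) (S_INR M.+1) !RtoC_minus RtoC_plus; ring.
ring.
Qed.

Lemma zr_fweight M x :
  \big[Cplus/RtoC 0]_(k <- zr M) (RtoC (fweight M k) * cis (IZR k * x))%C = RtoC (fejer M x / INR M.+1).
Proof.
have p : 0 < INR M.+1 by apply: lt_0_INR; lia.
rewrite /Rdiv Rmult_comm RtoC_mult -zr_fejer csum_scal; apply: eq_zr_sum => k hk.
rewrite Cmult_assoc -RtoC_mult; congr (RtoC _ * _)%C.
have : Rabs (IZR k) <= INR M.+1 by rewrite -abs_IZR INR_IZR_INZ; apply: IZR_le; lia.
move=> h; rewrite /fweight Rmax_right; first by field; lra.
by have := proj2 (Rle_div_l (Rabs (IZR k)) 1 (INR M.+1) p); rewrite Rmult_1_l => h2; have := h2 h; lra.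
Qed.

(** With z = |x| / 2 <= 2, sin z >= z - z^3 / 6 >= z / 3, so 1 - cos x = 2 sin^2 z >= x^2 / 18. *)
Lemma sqr_le_cos x : Rabs x <= PI -> x ^ 2 <= 18 * (1 - cos x).
Proof.
move=> hx.
have e : Rabs x = 2 * (Rabs x / 2) by field.
have -> : cos x = cos (Rabs x) by rewrite /Rabs; case: Rcase_abs => _ //; rewrite cos_neg.
have -> : x ^ 2 = Rabs x ^ 2 by rewrite pow2_abs.
set z := Rabs x / 2 in e *.
have z0 : 0 <= z by rewrite /z; have := Rabs_pos x; lra.
have z2 : z <= 2 by have := PI_4; rewrite /z; lra.
have := proj1 (pre_sin_bound z 0 z0 ltac:(lra)).
rewrite /sin_approx /= /sin_term /= => hs.
have {hs} : z / 3 <= sin z.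
  apply: Rle_trans hs; rewrite [X in _ <= X](_ : _ = z - z ^ 3 / 6); last by field.
  nra.
rewrite e cos_2a_sin => hs; nra.
Qed.

(** Kernel estimates need an integrable majorant: the mass of the Fejer kernel is bounded in M, its
    supremum is not. *)
Lemma RInt_ge_Cmod f (B : R -> R) a b : a <= b -> Rcont f -> (forall t : R, continuous B t) ->
  (forall t, Cmod (f t) <= B t) -> Cmod (CInt f a b) <= 2 * RInt B a b.
Proof.
move=> ab cf cB h.
have aux (g : R -> R) : (forall t : R, continuous g t) -> (forall t, Rabs (g t) <= B t) -> Rabs (RInt g a b) <= RInt B a b.
  move=> cg hg; apply: Rle_trans (abs_RInt_le _ _ _ ab (ex_RInt_cont a b cg)) _.
  have cn : ex_RInt (fun t => norm (g t)) a b.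
    apply: ex_RInt_cont => t; apply: (@continuous_comp R_UniformSpace R_UniformSpace R_UniformSpace g Rabs) => //.
    exact: continuous_Rabs.
  by apply: (RInt_le _ _ _ _ ab cn (ex_RInt_cont a b cB)) => t _; exact: hg.
apply: Rle_trans (Cmod_le_abs _) _.
have h1 := aux (fun r => Re (f r)) (fun t => proj1 (cf t)) (fun t => Rle_trans _ _ _ (Rabs_Re_le _) (h t)).
have h2 := aux (fun r => Im (f r)) (fun t => proj2 (cf t)) (fun t => Rle_trans _ _ _ (Rabs_Im_le _) (h t)).
apply: Rle_trans (Rplus_le_compat _ _ _ _ h1 h2) _; lra.
Qed.

Lemma CInt_csum (I : Type) (l : seq I) (F : I -> R -> C) a b : (forall i, Rcont (F i)) ->
  CInt (fun t => \big[Cplus/RtoC 0]_(i <- l) F i t) a b = \big[Cplus/RtoC 0]_(i <- l) CInt (F i) a b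
  /\ Rcont (fun t => \big[Cplus/RtoC 0]_(i <- l) F i t).
Proof.
move=> cF; elim: l => [|i l [IH1 IH2]].
  split.
    rewrite big_nil (@CInt_ext _ (fun=> RtoC 0)) => [|t]; last by rewrite big_nil.
    rewrite (@CInt_FTC (fun=> RtoC 0) (fun=> RtoC 0)); [by ring|by move=> t; exact: ccont_const|by move=> t; exact: cderiv_const].
  move=> t; apply: ccont_ext (ccont_const (RtoC 0) t) => r; by rewrite big_nil.
have e t : (F i t + \big[Cplus/RtoC 0]_(i <- l) F i t)%C = \big[Cplus/RtoC 0]_(i <- i :: l) F i t by rewrite big_cons.
split; last by move=> t; apply: ccont_ext (ccont_plus (cF i t) (IH2 t)).
by rewrite big_cons -IH1 -CInt_plus //; apply: CInt_ext => t; rewrite big_cons.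
Qed.

Section FejerMeans.
Variable N : nat.
Implicit Types (f g : ('I_N -> R) -> C) (y : 'I_N -> R) (j : 'I_N).

Definition fejer_mean M j f y : C :=
  \big[Cplus/RtoC 0]_(k <- zr M) (RtoC (fweight M k) * cis (IZR k * y j) * fcoef j k f y)%C.

Let ker M x := fejer M x / INR M.+1.

Let ker_shift_cont M a (r : R) : continuous (fun r => ker M (a - r)) r.
Proof.
apply: (@continuous_mult R_UniformSpace R_AbsRing (fun r => fejer M (a - r)) (fun=> / INR M.+1)); last exact: continuous_const.
apply: (@continuous_comp R_UniformSpace R_UniformSpace R_UniformSpace (fun r => a - r) (fejer M)); last exact: fejer_cont.
by apply: (@ex_derive_continuous R_AbsRing R_NormedModule); auto_derive.
Qed.

Let ker_ge0 M x : 0 <= ker M x.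
Proof. by apply: Rmult_le_pos; [exact: fejer_ge0|apply/Rlt_le/Rinv_0_lt_compat/lt_0_INR; lia]. Qed.

(** The coefficient form serves for expansions, this convolution form for estimates. *)
Lemma fejer_mean_int M j f y : (forall y, continuous f y) ->
  fejer_mean M j f y = (RtoC (/ (2 * PI)) * CInt (fun r => RtoC (fejer M (y j - r) / INR M.+1) * f (upd y j r)) 0 (2 * PI))%C.
Proof.
move=> cf.
have cF k : Rcont (fun r => (RtoC (fweight M k) * cis (IZR k * y j)) * (f (upd y j r) * cis (- (IZR k * r))))%C.
  by move=> t; apply: ccont_scal; exact: fcoef_integrand_cont.
rewrite (@CInt_ext _ (fun r => \big[Cplus/RtoC 0]_(k <- zr M) ((RtoC (fweight M k) * cis (IZR k * y j)) * (f (upd y j r) * cis (- (IZR k * r))))%C)) => [|r].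
  rewrite (CInt_csum (zr M) 0 (2 * PI) cF).1 csum_scal; apply: eq_bigr => k _.
  by rewrite CInt_scal /fcoef; [ring|exact: fcoef_integrand_cont].
rewrite -zr_fweight Cmult_comm csum_scal; apply: eq_bigr => k _.
rewrite (_ : IZR k * (y j - r) = IZR k * y j + - (IZR k * r)); last by ring.
by rewrite cis_add; ring.
Qed.

Lemma fejer_mean_one M j y : fejer_mean M j (fun=> RtoC 1) y = RtoC 1.
Proof.
have pi0 := PI_RGT_0.
have s1 : smooth (fun _ : 'I_N -> R => RtoC 1).
  apply: (@smooth_coind _ (fun F => exists c, F = fun=> c)); last by exists (RtoC 1).
  move=> f [c ->]; split=> [x|i]; first by apply/ccontP; exact: ccont_const.
  have [|h1 h2] := @pderiv_cderiv N (fun=> c) i (fun=> RtoC 0); first by move=> x r; exact: cderiv_const.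
  by split=> //; exists (RtoC 0).
have fc k : k <> 0%Z -> fcoef j k (fun=> RtoC 1) y = RtoC 0.
  move=> k0.
  have := @fcoef_pderiv_same N j k (fun=> RtoC 1) y s1 (fun _ _ => erefl).
  have -> : pderiv j (fun _ : 'I_N -> R => RtoC 1) = fun=> (RtoC 0 * RtoC 1)%C.
    have [|_ ->] := @pderiv_cderiv N (fun=> RtoC 1) j (fun=> RtoC 0); first by move=> x r; exact: cderiv_const.
    by apply: functional_extensionality => x; ring.
  rewrite fcoef_scal; last exact: smooth_cont.
  rewrite Cmult_0_l => /esym h.
  have kn : (Ci * RtoC (IZR k))%C <> RtoC 0.
    by move=> /(f_equal Im); rewrite /= => h2; apply: k0; apply: eq_IZR; lra.
  set X := fcoef _ _ _ _ in h *.
  have -> : X = (/ (Ci * RtoC (IZR k)) * (Ci * RtoC (IZR k) * X))%C.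
    by field; split=> h'; apply: kn; rewrite h'; ring.
  by rewrite h; ring.
have fc0 : fcoef j 0 (fun=> RtoC 1) y = RtoC 1.
  rewrite /fcoef (@CInt_ext _ (fun=> RtoC 1)) => [|r]; last by rewrite Rmult_0_l Ropp_0 cis0; ring.
  rewrite (@CInt_FTC (fun r => RtoC r) (fun=> RtoC 1)).
  - by rewrite -RtoC_minus -RtoC_mult; congr RtoC; field; lra.
  - by move=> t; exact: ccont_const.
  - by move=> t; apply: cderiv_RtoC; exact: is_derive_id.
rewrite /fejer_mean.
(* Induction on the range M' of summation with the weights of order M held fixed; only k = 0
   contributes. *)
have sum0 : forall M', \big[Cplus/RtoC 0]_(k <- zr M') (RtoC (fweight M k) * cis (IZR k * y j) * fcoef j k (fun=> RtoC 1) y)%C = RtoC 1.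
  elim=> [|M' IH].
    rewrite big_cons big_nil fc0 Rmult_0_l cis0 /fweight Rabs_R0 /Rdiv Rmult_0_l Rminus_0_r Rmax_right; last lra.
    by ring.
  rewrite zrS !big_cons IH !fc; try lia.
  by ring.
exact: sum0.
Qed.

(** The mass is read off from the mean of the constant 1, without integrating the kernel. *)
Lemma ker_mass M j y : RInt (fun r => ker M (y j - r)) 0 (2 * PI) = 2 * PI.
Proof.
have pi0 := PI_RGT_0.
have := @fejer_mean_int M j (fun=> RtoC 1) y (fun z => proj1 (@ccontP _ _ z) (ccont_const (RtoC 1) z)).
rewrite fejer_mean_one => /(f_equal Re); rewrite /CInt /=.
rewrite (@RInt_ext R_CompleteNormedModule _ (fun r => ker M (y j - r))) => [h|r _]; last by rewrite /ker; change (@eq R (fejer M (y j - r) / INR M.+1 * 1 - 0 * 0) (fejer M (y j - r) / INR M.+1)); ring.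
have : / (2 * PI) * RInt (fun r => ker M (y j - r)) 0 (2 * PI) = 1 by lra.
by move=> h2; rewrite -[LHS]Rmult_1_l -{1}(Rinv_r (2 * PI)); [rewrite Rmult_assoc h2; ring|lra].
Qed.

(** A nonnegative kernel of fixed mass gives a bound independent of M, as iterating the means
    requires. *)
Lemma fejer_mean_bound M j f B y : (forall y, continuous f y) ->
  (forall r, Cmod (f (upd y j r)) <= B) -> Cmod (fejer_mean M j f y) <= 2 * B.
Proof.
move=> cf hB; have pi0 := PI_RGT_0.
rewrite fejer_mean_int // Cmod_mult Cmod_R Rabs_pos_eq; last by apply/Rlt_le/Rinv_0_lt_compat; lra.
have cB t : continuous (fun r => B * ker M (y j - r)) t.
  by apply: (@continuous_mult R_UniformSpace R_AbsRing (fun=> B)); [exact: continuous_const|exact: ker_shift_cont].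
have H := @RInt_ge_Cmod (fun r => RtoC (ker M (y j - r)) * f (upd y j r))%C
  (fun r => B * ker M (y j - r)) 0 (2 * PI) ltac:(lra) _ cB _.
apply: Rle_trans (Rmult_le_compat_l _ _ _ _ (H _ _)) _.
- by apply/Rlt_le/Rinv_0_lt_compat; lra.
- move=> t; apply: ccont_mult; last exact: upd_ccont.
  by split; [exact: ker_shift_cont|exact: continuous_const].
- move=> t; rewrite Cmod_mult Cmod_R Rabs_pos_eq // Rmult_comm; apply: Rmult_le_compat_r => //.
- rewrite (@RInt_scal R_CompleteNormedModule) ?ker_mass; last by apply: ex_RInt_cont => t; exact: ker_shift_cont.
  by rewrite /scal /= /mult /=; apply: Req_le; field; lra.
Qed.

Lemma fejer_mean_cont M j f : (forall y, continuous f y) -> forall y, continuous (fejer_mean M j f) y.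
Proof.
move=> cf y; apply/ccontP; rewrite /fejer_mean.
elim: (zr M) => [|k l IH].
  by apply: ccont_ext (ccont_const (RtoC 0) y) => x; rewrite big_nil.
apply: (@ccont_ext _ (fun y => (RtoC (fweight M k) * cis (IZR k * y j) * fcoef j k f y) + \big[Cplus/RtoC 0]_(k <- l) (RtoC (fweight M k) * cis (IZR k * y j) * fcoef j k f y))%C) => [x|].
  by rewrite big_cons.
apply: ccont_plus => //; apply: ccont_mult; last by apply/ccontP; exact: fcoef_cont.
apply: ccont_scal; apply/ccontP.
apply: (@continuous_comp _ _ _ (fun y : 'I_N -> R => y j) (fun r => cis (IZR k * r))).
  by apply/filterlim_locally => eps; exists eps => z; exact.
by apply/ccontP; apply: cderiv_ccont; apply: cderiv_cis; auto_derive.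
Qed.

Lemma fejer_mean_sub M j f g y : (forall y, continuous f y) -> (forall y, continuous g y) ->
  fejer_mean M j (fun y => f y - g y)%C y = (fejer_mean M j f y - fejer_mean M j g y)%C.
Proof.
move=> cf cg.
have cm x : continuous (fun y => - RtoC 1 * g y)%C x by apply/ccontP/ccont_scal/ccontP.
have -> : (fun y => f y - g y)%C = (fun y => f y + - RtoC 1 * g y)%C by apply: functional_extensionality => x; ring.
rewrite /fejer_mean.
transitivity (\big[Cplus/RtoC 0]_(k <- zr M) ((RtoC (fweight M k) * cis (IZR k * y j) * fcoef j k f y) + - RtoC 1 * (RtoC (fweight M k) * cis (IZR k * y j) * fcoef j k g y))%C).
  by apply: eq_bigr => k _; rewrite fcoef_plus // fcoef_scal //; ring.
by rewrite big_split /= -csum_scal; ring.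
Qed.

(* This form of continuity is adapted to the kernel: 2 (1 - cos x) * fejer M x
   is bounded by 4. *)
Definition osc_bounded j f := forall eta, 0 < eta -> exists K, 0 <= K /\
  forall y r, Cmod (f (upd y j r) - f y) <= eta + K * (2 * (1 - cos (y j - r))).

(** The Lipschitz bound 2 L |x| is split by |x| <= c + x^2 / c, and x^2 <= 18 (1 - cos x) gives the
    constant 9 / c; c is chosen so that 2 L c <= eta. *)
Lemma osc_bounded_smooth j f L : smooth f -> torus_periodic f ->
  (forall y, Cmod (pderiv j f y) <= L) -> osc_bounded j f.
Proof.
move=> sf pf hL eta eta0; have pi0 := PI_RGT_0.
have L0 : 0 <= L by apply: Rle_trans (hL (fun=> 0)); exact: Cmod_ge_0.
have lip y a b : Cmod (f (upd y j b) - f (upd y j a)) <= 2 * L * Rabs (b - a).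
  have [ab|ba] := Rle_lt_dec a b.
    rewrite Rabs_pos_eq; last lra.
    apply: (@cderiv_bound (fun r => f (upd y j r)) (fun r => pderiv j f (upd y j r))) => // t _.
    by split; [exact: smooth_cderiv|].
  rewrite -Cmod_opp Rabs_minus_sym Rabs_pos_eq; last lra.
  rewrite (_ : (- (f (upd y j b) - f (upd y j a)))%C = (f (upd y j a) - f (upd y j b))%C); last by ring.
  apply: (@cderiv_bound (fun r => f (upd y j r)) (fun r => pderiv j f (upd y j r))); first lra.
  by move=> t _; split; [exact: smooth_cderiv|].
pose c := eta / (2 * L + 1).
have c0 : 0 < c by apply: Rdiv_lt_0_compat; lra.
exists (2 * L * (9 / c)); split.
  by apply: Rmult_le_pos; [lra|apply/Rlt_le/Rdiv_lt_0_compat; lra].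
move=> y r.
(* A nearest integer, so that x below lies in [-pi, pi]. *)
pose k := up ((y j - r) / (2 * PI) - / 2).
have [k1 k2] := archimed ((y j - r) / (2 * PI) - / 2); rewrite -/k in k1 k2.
pose x := y j - r - 2 * PI * IZR k.
have ex : (y j - r) / (2 * PI) = (x + 2 * PI * IZR k) / (2 * PI) by congr Rdiv; rewrite /x; ring.
have ex2 : (x + 2 * PI * IZR k) / (2 * PI) = x / (2 * PI) + IZR k by field; lra.
have hx : Rabs x <= PI.
  have e : x = (x / (2 * PI)) * (2 * PI) by field; lra.
  rewrite ex ex2 in k1 k2; apply: Rabs_le; rewrite e; nra.
have hc := sqr_le_cos hx.
have cosx : cos (y j - r) = cos x.
  have := cis_periodicZ x k; rewrite /x (_ : y j - r - 2 * PI * IZR k + 2 * PI * IZR k = y j - r); last by ring.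
  by case.
rewrite -{2}(upd_id y j) -(periodic_upd y j k r pf).
apply: Rle_trans (lip _ _ _) _.
have -> : Rabs (r + 2 * PI * IZR k - y j) = Rabs x by rewrite /x -Rabs_Ropp; congr Rabs; ring.
rewrite cosx.
have amgm : Rabs x <= c + x ^ 2 / c.
  have : 0 <= (Rabs x - c) ^ 2 by apply: pow2_ge_0.
  have -> : (Rabs x - c) ^ 2 = x ^ 2 - 2 * Rabs x * c + c ^ 2 by rewrite -(pow2_abs x); ring.
  move=> h; have x0 := Rabs_pos x.
  apply: (Rmult_le_reg_r c) => //; rewrite Rmult_plus_distr_r /Rdiv Rmult_assoc Rinv_l; nra.
have : x ^ 2 / c <= 9 / c * (2 * (1 - cos x)).
  have ci := Rinv_0_lt_compat _ c0; rewrite /Rdiv; nra.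
move=> h3.
have : 2 * L * Rabs x <= 2 * L * (c + 9 / c * (2 * (1 - cos x))) by apply: Rmult_le_compat_l; lra.
have : 2 * L * c <= eta.
  have -> : eta = (2 * L + 1) * c by rewrite /c; field; lra.
  lra.
lra.
Qed.

(** In [osc_bounded], eta is integrated against the mass of the kernel and the cosine term against
    its concentration, at most 4 K / (M + 1); no splitting into near and far points is needed. *)
Lemma fejer_mean_converges j f : (forall y, continuous f y) -> osc_bounded j f ->
  forall eps, 0 < eps -> exists M0, forall M, (M0 <= M)%N -> forall y,
    Cmod (fejer_mean M j f y - f y) <= eps.
Proof.
move=> cf osc eps eps0; have pi0 := PI_RGT_0.
have [K [K0 hK]] := osc (eps / 4) ltac:(lra).
(* The integral bound is eps / 2 + 8 K / (M + 1); from this order on the second term is at most eps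
   / 2. *)
pose M0 := Z.to_nat (up (16 * K / eps)).
exists M0 => M hM y.
have Mp : 0 < INR M.+1 by apply: lt_0_INR; lia.
have hM' : 16 * K / eps <= INR M.+1.
  have [u1 _] := archimed (16 * K / eps).
  have k0 : 0 <= 16 * K / eps by apply: Rmult_le_pos; [lra|apply/Rlt_le/Rinv_0_lt_compat].
  have : IZR (up (16 * K / eps)) <= INR M.+1.
    rewrite INR_IZR_INZ; apply: IZR_le; move/leP: hM; rewrite /M0; lia.
  lra.
have cc x : continuous (fun _ : 'I_N -> R => (f y * RtoC 1)%C) x by apply/ccontP; exact: ccont_const.
(* The value f y is frozen as a constant function, which every mean reproduces. *)
have -> : f y = fejer_mean M j (fun=> (f y * RtoC 1)%C) y.
  transitivity (f y * fejer_mean M j (fun=> RtoC 1) y)%C; first by rewrite fejer_mean_one; ring.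
  rewrite /fejer_mean csum_scal; apply: eq_bigr => k _.
  by rewrite (@fcoef_scal N j k (f y) (fun=> RtoC 1)); [ring|by move=> z; apply/ccontP; exact: ccont_const].
rewrite -fejer_mean_sub // fejer_mean_int; last first.
  by move=> x; apply/ccontP; apply: (@ccont_plus _ f (fun=> - (f y * RtoC 1))%C); [exact/ccontP|exact: ccont_const].
rewrite Cmod_mult Cmod_R Rabs_pos_eq; last by apply/Rlt_le/Rinv_0_lt_compat; lra.
pose B r := (eps / 4) * ker M (y j - r) + 4 * K / INR M.+1.
have c1 (t : R) : continuous (fun r => (eps / 4) * ker M (y j - r)) t.
  by apply: (@continuous_mult R_UniformSpace R_AbsRing (fun=> eps / 4)); [exact: continuous_const|exact: ker_shift_cont].
have cB (t : R) : continuous B t.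
  apply: (@continuous_plus R_UniformSpace R_AbsRing R_NormedModule _ (fun=> 4 * K / INR M.+1)) => //; exact: continuous_const.
have H := @RInt_ge_Cmod (fun r => RtoC (ker M (y j - r)) * (f (upd y j r) - f y * RtoC 1))%C B 0 (2 * PI) ltac:(lra) _ cB _.
apply: Rle_trans (Rmult_le_compat_l _ _ _ _ (H _ _)) _.
- by apply/Rlt_le/Rinv_0_lt_compat; lra.
- move=> t; apply: ccont_mult; first by split; [exact: ker_shift_cont|exact: continuous_const].
  apply: (@ccont_plus _ _ (fun=> - (f y * RtoC 1))%C); last exact: ccont_const.
  exact: upd_ccont.
- move=> t; rewrite Cmod_mult Cmod_R Rabs_pos_eq // Cmult_1_r.
  have k0 := ker_ge0 M (y j - t).
  apply: Rle_trans (Rmult_le_compat_l _ _ _ k0 (hK y t)) _.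
  have fc := fejer_concentration M (y j - t).
  have : K * (2 * (1 - cos (y j - t)) * fejer M (y j - t)) / INR M.+1 <= 4 * K / INR M.+1.
    apply: Rmult_le_compat_r; first exact/Rlt_le/Rinv_0_lt_compat.
    nra.
  rewrite /B /ker /Rdiv; lra.
- rewrite (@RInt_plus R_CompleteNormedModule _ (fun=> 4 * K / INR M.+1)); [|exact: ex_RInt_cont|exact: ex_RInt_const].
  rewrite (@RInt_scal R_CompleteNormedModule) ?ker_mass; last by apply: ex_RInt_cont => t; exact: ker_shift_cont.
  rewrite RInt_const /plus /scal /= /mult /= Rminus_0_r.
  have -> : / (2 * PI) * (2 * (eps / 4 * (2 * PI) + 2 * PI * (4 * K / INR M.+1))) = eps / 2 + 8 * K / INR M.+1 by field; lra.
  have : 8 * K / INR M.+1 <= eps / 2.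
    apply/Rle_div_l => //.
    have := proj1 (Rle_div_l (16 * K) (INR M.+1) eps eps0) hM'; lra.
  lra.
Qed.
End FejerMeans.

(** * Sums over boxes of frequencies *)

Section Boxes.
Variable n : nat.
Implicit Types (l : seq 'I_n) (xi : 'I_n -> Z) (f : ('I_n.+1 -> R) -> C) (y : 'I_n.+1 -> R).
Local Notation xvar j := (lift ord0 j : 'I_n.+1).

Definition updZ xi j k : 'I_n -> Z := fun i => if i == j then k else xi i.

(** Entries outside [l] are 0; the recursion is that of [coef] and [iter_mean], so all three unfold
    together. *)
Fixpoint box l (M : nat) : seq ('I_n -> Z) :=
  if l is j :: l' then [seq updZ xi j k | k <- zr M, xi <- box l' M] else [:: fun=> 0%Z].

Definition wt M l xi : R := \big[Rmult/1]_(j <- l) fweight M (xi j).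

Definition phase l xi y : R := \big[Rplus/0]_(j <- l) (IZR (xi j) * y (xvar j)).

Lemma big_updZ (T : Type) (op : T -> T -> T) (x : T) (F : 'I_n -> Z -> T) l xi j k : j \notin l ->
  \big[op/x]_(i <- l) F i (updZ xi j k i) = \big[op/x]_(i <- l) F i (xi i).
Proof.
move=> jl; rewrite big_seq [RHS]big_seq; apply: eq_bigr => i il.
by rewrite /updZ; case: eqP => // e; rewrite -e il in jl.
Qed.

Lemma updZ_same xi j k : updZ xi j k j = k.
Proof. by rewrite /updZ eqxx. Qed.

Lemma box_cons_sum (T : Type) (x : T) (op : Monoid.com_law x) j l M (F : ('I_n -> Z) -> T) :
  \big[op/x]_(xi <- box (j :: l) M) F xi =
  \big[op/x]_(k <- zr M) \big[op/x]_(xi <- box l M) F (updZ xi j k).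
Proof. by rewrite /= big_allpairs_dep. Qed.

Lemma zopp_updZ xi j k : zopp (updZ xi j k) = updZ (zopp xi) j (- k)%Z.
Proof. by apply: functional_extensionality => i; rewrite /zopp /updZ; case: eqP. Qed.

Lemma box_opp l M (F : ('I_n -> Z) -> C) :
  \big[Cplus/RtoC 0]_(xi <- box l M) F (zopp xi) = \big[Cplus/RtoC 0]_(xi <- box l M) F xi.
Proof.
elim: l F => [|j l IH] F; first by rewrite !big_cons !big_nil.
rewrite !box_cons_sum.
under eq_bigr => k _ do under eq_bigr => xi _ do rewrite zopp_updZ.
rewrite (zr_sum_opp M (fun k => \big[Cplus/RtoC 0]_(xi <- box l M) F (updZ (zopp xi) j k))).
by apply: eq_bigr => k _; exact: (IH (fun xi => F (updZ xi j k))).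
Qed.

Lemma zr_widen M K (G : Z -> C) : (M <= K)%N -> (forall k, (Z.of_nat M < Z.abs k)%Z -> G k = RtoC 0) ->
  \big[Cplus/RtoC 0]_(k <- zr K) G k = \big[Cplus/RtoC 0]_(k <- zr M) G k.
Proof.
move=> MK h; rewrite -(subnK MK); elim: (K - M)%N => [|d IH]; first by rewrite add0n.
rewrite addSn zrS !big_cons IH !h; first by ring.
- by rewrite -plusE; lia.
- by rewrite -plusE; lia.
Qed.

Lemma box_widen M K l (F : ('I_n -> Z) -> C) : (M <= K)%N -> uniq l ->
  (forall xi j, j \in l -> (Z.of_nat M < Z.abs (xi j))%Z -> F xi = RtoC 0) ->
  \big[Cplus/RtoC 0]_(xi <- box l K) F xi = \big[Cplus/RtoC 0]_(xi <- box l M) F xi.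
Proof.
move=> MK; elim: l F => [|j l IH] F; first by rewrite !big_cons !big_nil.
move=> /= /andP [jl ul] h; rewrite !box_cons_sum (zr_widen MK) => [|k hk].
  apply: eq_zr_sum => k hk; apply: IH => // xi i il hi; apply: (h _ i); first by rewrite inE il orbT.
  by rewrite /updZ; case: eqP => // e; rewrite -e il in jl.
apply: big1 => xi _; apply: (h _ j); first by rewrite inE eqxx.
by rewrite updZ_same.
Qed.

(** A summable majorant whose product over the coordinates factorises the sum over a box. *)
Definition pker (k : Z) : R := / (1 + IZR k ^ 2).

Lemma pker_gt0 k : 0 < pker k.
Proof. by apply: Rinv_0_lt_compat; nra. Qed.

Lemma zr_pker M : \big[Rplus/0]_(k <- zr M) pker k <= 5.
Proof.
(* The strengthened bound telescopes: with x = M + 1, the two new terms 2 / (1 + x^2) are at most 4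
   / x - 4 / (x + 1). *)
suff : \big[Rplus/0]_(k <- zr M) pker k <= 5 - 4 / INR M.+1.
  have := Rdiv_lt_0_compat 4 (INR M.+1) ltac:(lra) (lt_0_INR M.+1 ltac:(lia)); lra.
elim: M => [|M IH]; first by rewrite /= big_cons big_nil /pker /=; lra.
rewrite zrS !big_cons; move: (\big[Rplus/0]_(k <- zr M) pker k) IH => S IH.
rewrite /pker opp_IZR -INR_IZR_INZ.
have -> : (- INR M.+1) ^ 2 = INR M.+1 ^ 2 by ring.
have m0 := pos_INR M; rewrite (S_INR M) in IH *; rewrite (S_INR M.+1) (S_INR M).
set x := INR M in m0 IH *.
have : / (1 + (x + 1) ^ 2) + / (1 + (x + 1) ^ 2) <= 4 / (x + 1) - 4 / (x + 1 + 1).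
  have -> : 4 / (x + 1) - 4 / (x + 1 + 1) = 4 / ((x + 1) * (x + 2)) by field; lra.
  have -> : / (1 + (x + 1) ^ 2) + / (1 + (x + 1) ^ 2) = 2 / (1 + (x + 1) ^ 2) by field; nra.
  apply/Rle_div_l; first nra.
  have -> : 4 / ((x + 1) * (x + 2)) * (1 + (x + 1) ^ 2) = (4 * (1 + (x + 1) ^ 2)) / ((x + 1) * (x + 2)) by field; lra.
  apply/Rle_div_r; nra.
lra.
Qed.

Lemma box_pker l M : uniq l ->
  \big[Rplus/0]_(xi <- box l M) \big[Rmult/1]_(j <- l) pker (xi j) <= 5 ^ size l.
Proof.
elim: l => [|j l IH] /=; first by rewrite big_cons !big_nil; lra.
move=> /andP [jl ul].
rewrite -/(box (j :: l) M) box_cons_sum.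
rewrite (eq_bigr (fun k => (\big[Rplus/0]_(xi <- box l M) \big[Rmult/1]_(j <- l) pker (xi j)) * pker k)) => [|k _].
  rewrite -rsum_scal; apply: (Rle_trans _ ((5 ^ size l) * 5)); last by lra.
  apply: Rmult_le_compat; [| |exact: IH|exact: zr_pker].
  - apply: big_ind => [|x y ? ?|xi _]; [lra|lra|].
    by apply: big_ind => [|x y ? ?|i _]; [lra|nra|exact/Rlt_le/pker_gt0].
  - by apply: big_ind => [|x y ? ?|k _]; [lra|lra|exact/Rlt_le/pker_gt0].
rewrite Rmult_comm rsum_scal; apply: eq_bigr => xi _.
by rewrite big_cons updZ_same (big_updZ _ _ (fun _ => pker)).
Qed.

Lemma box_sum_bound l M (a : ('I_n -> Z) -> C) B : uniq l -> 0 <= B ->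
  (forall xi, Cmod (a xi) <= B * \big[Rmult/1]_(j <- l) pker (xi j)) ->
  Cmod (\big[Cplus/RtoC 0]_(xi <- box l M) a xi) <= B * 5 ^ size l.
Proof.
move=> ul B0 h; apply: Rle_trans (Cmod_csum_le _ _) _.
apply: Rle_trans (rsum_le _ h) _; rewrite -rsum_scal.
by apply: Rmult_le_compat_l => //; exact: box_pker.
Qed.

Lemma wt_bounds M l xi : 0 <= wt M l xi <= 1.
Proof.
rewrite /wt; apply: (big_ind (fun x => 0 <= x <= 1)) => [|x y ? ?|j _]; [lra|nra|].
by split; [exact: fweight_ge0|exact: fweight_le1].
Qed.

Lemma wt_opp M l xi : wt M l (zopp xi) = wt M l xi.
Proof. by apply: eq_bigr => j _; rewrite /zopp fweight_opp. Qed.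

Lemma phase_opp l xi y : phase l (zopp xi) y = - phase l xi y.
Proof.
rewrite /phase -[RHS]Rmult_1_l -Ropp_mult_distr_r Ropp_mult_distr_l rsum_scal.
by apply: eq_bigr => j _; rewrite /zopp opp_IZR; ring.
Qed.

Lemma wt_out M l xi j : j \in l -> (Z.of_nat M < Z.abs (xi j))%Z -> wt M l xi = 0.
Proof.
rewrite /wt; elim: l => //= i l IH; rewrite inE big_cons => /orP [/eqP <-|jl] h.
  by rewrite fweight_out //; ring.
by rewrite IH //; ring.
Qed.

(** Each factor of the weight differs from 1 by at most [freq xi] / (M + 1), and all lie in [0, 1].
    One extra power of decay thus buys the rate 1 / (M + 1). *)
Lemma wt_dist M l xi : Rabs (1 - wt M l xi) <= INR (size l) * freq xi / INR M.+1.
Proof.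
have p : 0 < / INR M.+1 by apply/Rinv_0_lt_compat/lt_0_INR; lia.
elim: l => [|j l IH].
  by rewrite /wt big_nil /Rdiv !Rmult_0_l Rminus_diag Rabs_R0; lra.
rewrite /wt big_cons -/(wt M l xi) [size _]/= S_INR.
have -> : 1 - fweight M (xi j) * wt M l xi = (1 - wt M l xi) * fweight M (xi j) + (1 - fweight M (xi j)) by ring.
apply: Rle_trans (Rabs_triang _ _) _.
have h1 : Rabs (1 - fweight M (xi j)) <= freq xi / INR M.+1.
  apply: Rle_trans (fweight_dist _ _) _; apply: Rmult_le_compat_r; [lra|exact: Rabs_freq].
have h2 : Rabs ((1 - wt M l xi) * fweight M (xi j)) <= Rabs (1 - wt M l xi).
  rewrite Rabs_mult (Rabs_pos_eq (fweight M (xi j))); last exact: fweight_ge0.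
  have := fweight_le1 M (xi j); have := Rabs_pos (1 - wt M l xi); nra.
have -> : (INR (size l) + 1) * freq xi / INR M.+1 = INR (size l) * freq xi / INR M.+1 + freq xi / INR M.+1 by rewrite /Rdiv; ring.
lra.
Qed.

Lemma phase_upd_notin l xi y i r : i \notin [seq xvar j | j <- l] -> phase l xi (upd y i r) = phase l xi y.
Proof.
move=> il; rewrite /phase big_seq [RHS]big_seq; apply: eq_bigr => j jl.
by rewrite upd_neq //; apply: contra il => /eqP <-; exact: map_f.
Qed.

Lemma phase_cont l xi y : ccont (fun y => cis (phase l xi y)) y.
Proof.
have ph : continuous (phase l xi) y.
  elim: l => [|j l IH].
    by apply: (continuous_ext (fun=> 0)) (continuous_const _ _) => x; rewrite /phase big_nil.
  apply: (continuous_ext (fun y => IZR (xi j) * y (xvar j) + phase l xi y)) => [x|].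
    by rewrite /phase big_cons.
  apply: (@continuous_plus _ R_AbsRing R_NormedModule (fun y => IZR (xi j) * y (xvar j))) => //.
  apply: (@continuous_mult _ R_AbsRing (fun=> IZR (xi j)) (fun y => y (xvar j))); first exact: continuous_const.
  by apply/filterlim_locally => eps; exists eps => z; exact.
by split; [apply: (continuous_comp (phase l xi) cos) => //; exact: continuous_cos|apply: (continuous_comp (phase l xi) sin) => //; exact: continuous_sin].
Qed.

Lemma fcoef_csum (N : nat) (I : Type) (s : seq I) (j : 'I_N) k (F : I -> ('I_N -> R) -> C) :
  (forall i z, continuous (F i) z) ->
  fcoef j k (fun z => \big[Cplus/RtoC 0]_(i <- s) F i z) =
    (fun z => \big[Cplus/RtoC 0]_(i <- s) fcoef j k (F i) z)
  /\ forall z, continuous (fun z => \big[Cplus/RtoC 0]_(i <- s) F i z) z.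
Proof.
move=> cF.
have c0 (c : C) z : continuous (fun _ : 'I_N -> R => c) z by apply/ccontP; exact: ccont_const.
elim: s => [|i s [IH1 IH2]].
  split; last by move=> z; apply: continuous_ext (c0 (RtoC 0) z) => x; rewrite big_nil.
  have -> : (fun z => \big[Cplus/RtoC 0]_(i <- [::]) F i z) = (fun z => RtoC 0 * RtoC 0)%C.
    by apply: functional_extensionality => z; rewrite big_nil; ring.
  rewrite fcoef_scal //; apply: functional_extensionality => z; rewrite big_nil; ring.
have -> : (fun z => \big[Cplus/RtoC 0]_(i <- i :: s) F i z) = (fun z => F i z + \big[Cplus/RtoC 0]_(i <- s) F i z)%C.
  by apply: functional_extensionality => z; rewrite big_cons.
split; first by rewrite fcoef_plus // IH1; apply: functional_extensionality => z; rewrite big_cons.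
by move=> z; apply/ccontP; apply: ccont_plus; apply/ccontP.
Qed.

Lemma fcoef_mul_indep (N : nat) (j : 'I_N) k (phi g : ('I_N -> R) -> C) z : (forall z, continuous g z) ->
  (forall z r, phi (upd z j r) = phi z) ->
  fcoef j k (fun z => phi z * g z)%C z = (phi z * fcoef j k g z)%C.
Proof.
move=> cg hp; rewrite /fcoef (@CInt_ext _ (fun r => phi z * (g (upd z j r) * cis (- (IZR k * r))))%C) => [|r].
  by rewrite CInt_scal; [ring|exact: fcoef_integrand_cont].
by rewrite hp; ring.
Qed.

Definition iter_mean M l f : ('I_n.+1 -> R) -> C := foldr (fun j g => fejer_mean M (xvar j) g) f l.

Lemma iter_mean_cont M l f : (forall y, continuous f y) -> forall y, continuous (iter_mean M l f) y.
Proof. by move=> cf; elim: l => //= j l IH; exact: fejer_mean_cont. Qed.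

(** The phase in the remaining variables does not involve the variable j, so it passes through
    [fcoef]. *)
Lemma iter_mean_expand M l f : (forall y, continuous f y) -> uniq l -> forall y,
  iter_mean M l f y = \big[Cplus/RtoC 0]_(xi <- box l M) (RtoC (wt M l xi) * cis (phase l xi y) * coef l xi f y)%C.
Proof.
move=> cf; elim: l => [|j l IH] /= => [_ y|/andP [jl ul] y].
  by rewrite big_cons big_nil /wt /phase !big_nil cis0; ring.
rewrite -/(box (j :: l) M) box_cons_sum /fejer_mean; apply: eq_bigr => k _.
have -> : iter_mean M l f = fun y => \big[Cplus/RtoC 0]_(xi <- box l M) ((RtoC (wt M l xi) * cis (phase l xi y)) * coef l xi f y)%C.
  by apply: functional_extensionality => z; exact: IH.
rewrite (fcoef_csum _ _ _ _).1 => [|xi z]; last first.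
  by apply/ccontP; apply: ccont_mult; [apply: ccont_scal; exact: phase_cont|apply/ccontP; exact: coef_cont].
rewrite csum_scal; apply: eq_bigr => xi _.
rewrite (@fcoef_mul_indep _ _ _ (fun y => RtoC (wt M l xi) * cis (phase l xi y))%C); first last.
- move=> z r; congr (_ * cis _)%C; apply: phase_upd_notin.
  by rewrite mem_map //; exact: lift_inj.
- exact: coef_cont.
rewrite updZ_same (@eq_coef n l (updZ xi j k) xi) => [|i il]; last first.
  by rewrite /updZ; case: eqP => // e; rewrite -e il in jl.
rewrite /wt /phase !big_cons updZ_same (big_updZ _ _ (fun _ => fweight M)) // (big_updZ _ _ (fun i k => IZR k * y (xvar i))) //.
by rewrite cis_add RtoC_mult; ring.
Qed.

Lemma iter_mean_converges l f : (forall y, continuous f y) -> (forall j, osc_bounded (xvar j) f) ->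
  forall eps, 0 < eps -> exists M0, forall M, (M0 <= M)%N -> forall y,
    Cmod (iter_mean M l f y - f y) <= eps.
Proof.
move=> cf osc; elim: l => [|j l IH] eps e0 /=.
  by exists 0%N => M _ y; rewrite (_ : (f y - f y)%C = RtoC 0) ?Cmod_0; [lra|ring].
have [M1 h1] := IH (eps / 4) ltac:(lra).
have [M2 h2] := fejer_mean_converges cf (osc j) (eps := eps / 4) ltac:(lra).
exists (maxn M1 M2) => M; rewrite geq_max => /andP [m1 m2] y.
have ci : forall y, continuous (iter_mean M l f) y by exact: iter_mean_cont.
have -> : (fejer_mean M (xvar j) (iter_mean M l f) y - f y)%C =
  (fejer_mean M (xvar j) (fun y => iter_mean M l f y - f y)%C y + (fejer_mean M (xvar j) f y - f y))%C.
  by rewrite fejer_mean_sub //; ring.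
apply: Rle_trans (Cmod_triangle _ _) _.
have := @fejer_mean_bound n.+1 M (xvar j) (fun y => iter_mean M l f y - f y)%C (eps / 4) y.
have := h2 M m2 y.
move=> a /(_ _ _) b.
have := b _ (fun r => h1 M m1 _); move=> /(_ _) c.
have : Cmod (fejer_mean M (xvar j) (fun y0 => iter_mean M l f y0 - f y0)%C y) <= 2 * (eps / 4).
  apply: c => z; apply/ccontP; apply: (@ccont_plus _ _ (fun y => - f y)%C); first exact/ccontP.
  apply: (@ccont_ext _ (fun y => - RtoC 1 * f y)%C) => [t|]; first by ring.
  by apply: ccont_scal; exact/ccontP.
lra.
Qed.

End Boxes.

(** * Trigonometric series with rapidly decaying coefficients *)

Definition clim (u : nat -> C) (l : C) :=
  is_lim_seq (fun k => Re (u k)) (Re l) /\ is_lim_seq (fun k => Im (u k)) (Im l).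

Lemma clim_unique u l l' : clim u l -> clim u l' -> l = l'.
Proof.
move=> [a b] [c d]; apply: C_eq.
- by have := is_lim_seq_unique _ _ a; rewrite (is_lim_seq_unique _ _ c) => -[].
- by have := is_lim_seq_unique _ _ b; rewrite (is_lim_seq_unique _ _ d) => -[].
Qed.

Lemma clim_ext u v l : (forall k, u k = v k) -> clim u l -> clim v l.
Proof. by move=> e [h1 h2]; split; [move: h1|move: h2]; apply: is_lim_seq_ext => k; rewrite e. Qed.

Lemma clim_const c : clim (fun=> c) c.
Proof. by split; apply: is_lim_seq_const. Qed.

Lemma clim_plus u v a b : clim u a -> clim v b -> clim (fun k => u k + v k)%C (a + b)%C.
Proof. by move=> [? ?] [? ?]; split; apply: is_lim_seq_plus'. Qed.

Lemma clim_scal c u a : clim u a -> clim (fun k => c * u k)%C (c * a)%C.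
Proof.
have sc (r : R) (v : nat -> R) (x : R) : is_lim_seq v x -> is_lim_seq (fun k => r * v k) (r * x).
  by move=> h; exact: (is_lim_seq_scal_l v r x h).
move=> [h1 h2]; split.
- by apply: is_lim_seq_minus'; apply: sc.
- by apply: is_lim_seq_plus'; apply: sc.
Qed.

Lemma clim_minus u v a b : clim u a -> clim v b -> clim (fun k => u k - v k)%C (a - b)%C.
Proof. by move=> [? ?] [? ?]; split; apply: is_lim_seq_minus'. Qed.

Lemma clim_conj u a : clim u a -> clim (fun k => Cconj (u k)) (Cconj a).
Proof. by move=> [h1 h2]; split => //; exact: (proj1 (is_lim_seq_opp (fun k => Im (u k)) (Rbar.Finite (Im a))) h2). Qed.

Lemma clim_csum (I : Type) (s : seq I) (u : I -> nat -> C) (a : I -> C) : (forall i, clim (u i) (a i)) ->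
  clim (fun k => \big[Cplus/RtoC 0]_(i <- s) u i k) (\big[Cplus/RtoC 0]_(i <- s) a i).
Proof.
move=> h; elim: s => [|i s IH].
  by rewrite big_nil; apply: clim_ext (clim_const _) => k; rewrite big_nil.
by rewrite big_cons; apply: clim_ext (clim_plus (h i) IH) => k; rewrite big_cons.
Qed.

Lemma clim_bound u l B : clim u l -> (forall k, Cmod (u k) <= B) -> Cmod l <= 2 * B.
Proof.
have aux (v : nat -> R) (x : R) : is_lim_seq v x -> (forall k, Rabs (v k) <= B) -> Rabs x <= B.
  move=> h hB; apply: Rabs_le; split.
  - by apply: (is_lim_seq_le (fun=> - B) v (- B) x) => // [k|]; [case: (Rabs_le_between (v k) B) => /(_ (hB k)) []|exact: is_lim_seq_const].
  - by apply: (is_lim_seq_le v (fun=> B) x B) => // [k|]; [case: (Rabs_le_between (v k) B) => /(_ (hB k)) []|exact: is_lim_seq_const].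
move=> [h1 h2] hB; apply: Rle_trans (Cmod_le_abs _) _.
have := aux _ _ h1 (fun k => Rle_trans _ _ _ (Rabs_Re_le _) (hB k)).
have := aux _ _ h2 (fun k => Rle_trans _ _ _ (Rabs_Im_le _) (hB k)).
lra.
Qed.

Lemma clim_of_dist u l : (forall eps, 0 < eps -> exists M0, forall M, (M0 <= M)%N -> Cmod (u M - l) <= eps) -> clim u l.
Proof.
move=> h; split; apply/is_lim_seq_spec => eps; have := cond_pos eps => e0;
have [M0 hM] := h (eps / 2) ltac:(lra); exists M0 => M /leP /hM hh.
- by apply: Rle_lt_trans (Rle_trans _ _ _ (Rabs_Re_le (u M - l)) hh) _; lra.
- by apply: Rle_lt_trans (Rle_trans _ _ _ (Rabs_Im_le (u M - l)) hh) _; lra.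
Qed.

Lemma clim_cauchy u K : (forall M Q : nat, (M <= Q)%N -> Cmod (u M - u Q) <= K / INR M.+1) ->
  exists l, clim u l.
Proof.
move=> h.
have K0 : 0 <= K.
  have := h 0%N 0%N (leqnn _); rewrite /= /Rdiv Rinv_1 Rmult_1_r; apply: Rle_trans; exact: Cmod_ge_0.
have aux (v : nat -> R) : (forall M Q : nat, (M <= Q)%N -> Rabs (v M - v Q) <= K / INR M.+1) -> ex_finite_lim_seq v.
  move=> hv; apply/ex_lim_seq_cauchy_corr => eps; have e0 := cond_pos eps.
  exists (Z.to_nat (up (K / eps))) => M Q hM hQ.
  have [u1 _] := archimed (K / eps).
  have key (M' : nat) : (Z.to_nat (up (K / eps)) <= M')%coq_nat -> K / INR M'.+1 < eps.
    move=> hM'; have p : 0 < INR M'.+1 by apply: lt_0_INR; lia.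
    have k0 : 0 <= K / eps by apply: Rmult_le_pos => //; apply/Rlt_le/Rinv_0_lt_compat.
    have : IZR (up (K / eps)) <= INR M'.+1 by rewrite INR_IZR_INZ; apply: IZR_le; lia.
    move=> h2; apply/Rlt_div_l => //; rewrite Rmult_comm; apply/Rlt_div_l => //; lra.
  have [mq|qm] := leqP M Q; first by apply: Rle_lt_trans (hv M Q mq) (key M hM).
  by rewrite Rabs_minus_sym; apply: Rle_lt_trans (hv Q M (ltnW qm)) (key Q hQ).
have [a ha] := aux (fun k => Re (u k)) (fun M Q MQ => Rle_trans _ _ _ (Rabs_Re_le (u M - u Q)) (h M Q MQ)).
have [b hb] := aux (fun k => Im (u k)) (fun M Q MQ => Rle_trans _ _ _ (Rabs_Im_le (u M - u Q)) (h M Q MQ)).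
by exists (a, b).
Qed.

Lemma cderiv_bound_abs (f df : R -> C) (D a b : R) :
  (forall t, Rabs (t - a) <= Rabs (b - a) -> cderiv f t (df t) /\ Cmod (df t) <= D) ->
  Cmod (f b - f a) <= 2 * D * Rabs (b - a).
Proof.
move=> h; have [ab|ba] := Rle_lt_dec a b.
  rewrite Rabs_pos_eq; last lra.
  apply: (@cderiv_bound f df) => // t [t1 t2]; apply: h; rewrite !Rabs_pos_eq; lra.
rewrite Rabs_left; last lra.
rewrite -Cmod_opp (_ : (- (f b - f a))%C = (f a - f b)%C); last by ring.
rewrite Ropp_minus_distr; apply: (@cderiv_bound f df); first lra.
move=> t [t1 t2]; apply: h; rewrite (Rabs_left (b - a)); last lra.
by rewrite Rabs_left1; lra.
Qed.

Lemma is_derive_quadratic (f : R -> R) a l K :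
  (forall b, Rabs (f b - f a - l * (b - a)) <= K * (b - a) ^ 2) -> is_derive f a l.
Proof.
move=> h; apply/is_derive_Reals => eps e0.
have K0 : 0 <= K.
  have := h (a + 1); have := Rabs_pos (f (a + 1) - f a - l * (a + 1 - a)).
  rewrite (_ : K * (a + 1 - a) ^ 2 = K); [lra|ring].
(* K + 1 instead of K keeps the radius defined when K = 0. *)
have d0 : 0 < eps / (K + 1) by apply: Rdiv_lt_0_compat; lra.
exists (mkposreal _ d0) => x x0 /= hx.
have := h (a + x); rewrite (_ : a + x - a = x); last ring.
have -> : (f (a + x) - f a) / x - l = (f (a + x) - f a - l * x) / x by field.
rewrite Rabs_div // => hq.
have ax : 0 < Rabs x by apply: Rabs_pos_lt.
apply/Rlt_div_l => //; apply: Rle_lt_trans hq _.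
rewrite -(pow2_abs x).
have : (K + 1) * Rabs x < eps by rewrite Rmult_comm; apply/Rlt_div_r => //; lra.
nra.
Qed.

Section Series.
Variable n : nat.
Implicit Types (c : ('I_n -> Z) -> R -> C) (xi : 'I_n -> Z) (y : 'I_n.+1 -> R).
Local Notation xvar j := (lift ord0 j : 'I_n.+1).
Local Notation L := (enum 'I_n).

(** Rapid decay without uniformity in k and b: the smooth counterpart of [EMfam], and stable under
    [famD]. *)
Definition gfam c := (forall xi, csmooth (c xi)) /\
  forall k b : nat, exists K, forall xi t, Cmod (iter k CD (c xi) t) * freq xi ^ b <= K.

(** The action on coefficients of the i-th partial derivative of the series. *)
Definition famD (i : 'I_n.+1) c : ('I_n -> Z) -> R -> C :=
  match unlift ord0 i with
  | Some j => fun xi t => (Ci * RtoC (IZR (xi j)) * c xi t)%C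
  | None => fun xi => CD (c xi)
  end.

Lemma famD0 c : famD ord0 c = fun xi => CD (c xi).
Proof. by rewrite /famD unlift_none. Qed.

Lemma famDx j c : famD (xvar j) c = fun xi t => (Ci * RtoC (IZR (xi j)) * c xi t)%C.
Proof. by rewrite /famD liftK. Qed.

Lemma famD_form i c : (forall xi, csmooth (c xi)) -> exists (z : ('I_n -> Z) -> C) (k d : nat),
  [/\ (k + d = 1)%N, forall xi, Cmod (z xi) <= freq xi ^ d,
     forall xi, csmooth (famD i c xi) &
     forall xi k' t, iter k' CD (famD i c xi) t = (z xi * iter (k' + k) CD (c xi) t)%C].
Proof.
move=> sc; case: (unliftP ord0 i) => [j ->|->].
  have S xi := csmooth_seq (fun k t => cderiv_scal (Ci * RtoC (IZR (xi j)))%C (sc xi k t)).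
  exists (fun xi => Ci * RtoC (IZR (xi j)))%C, 0%N, 1%N; split=> // [xi|xi|xi k' t].
  - by rewrite pow_1 Cmod_mult Cmod_Ci Cmod_R Rmult_1_l; exact: Rabs_freq.
  - by rewrite famDx; case: (S xi).
  - by rewrite famDx addn0; have [e _] := S xi; have := f_equal (fun g => g t) (e k').
exists (fun=> RtoC 1), 1%N, 0%N; split=> // [xi|xi|xi k' t].
- by rewrite Cmod_1 /=; lra.
- by rewrite famD0 => k t; have := sc xi k.+1 t; rewrite !iterSr.
- by rewrite famD0 Cmult_1_l addn1 iterSr.
Qed.

(** A derivative of total order p becomes k derivatives in t and a multiplier of degree d with k + d
    = p, which is exactly the index that [EMfam] bounds. *)
Lemma foldr_famD_form (s : seq 'I_n.+1) c : (forall xi, csmooth (c xi)) -> exists (z : ('I_n -> Z) -> C) (k d : nat),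
  [/\ (k + d = size s)%N, forall xi, Cmod (z xi) <= freq xi ^ d,
     forall xi, csmooth (foldr famD c s xi) &
     forall xi k' t, iter k' CD (foldr famD c s xi) t = (z xi * iter (k' + k) CD (c xi) t)%C].
Proof.
move=> sc; elim: s => [|i s [z [k [d [e hz hs hi]]]]] /=.
  exists (fun=> RtoC 1), 0%N, 0%N; split=> // [xi|xi k' t]; first by rewrite Cmod_1 /=; lra.
  by rewrite addn0 Cmult_1_l.
have [z' [k1 [d1 [e1 hz1 hs1 hi1]]]] := famD_form i hs.
exists (fun xi => z' xi * z xi)%C, (k1 + k)%N, (d1 + d)%N; split=> // [|xi|xi k' t].
- by rewrite -addnA (addnCA k) addnA e1 e add1n.
- rewrite Cmod_mult pow_add; apply: Rmult_le_compat => //; exact: Cmod_ge_0.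
- by rewrite hi1 hi addnA; ring.
Qed.

Lemma gfam_famD i c : gfam c -> gfam (famD i c).
Proof.
move=> [sc hc]; have [z [k [d [e hz hs hi]]]] := famD_form i sc.
split=> // k' b; have [K hK] := hc (k' + k)%N (d + b)%N; exists K => xi t.
rewrite hi Cmod_mult; apply: Rle_trans (hK xi t); rewrite pow_add.
have p1 : 0 <= freq xi ^ b by apply: pow_le; have := freq_gt0 xi; lra.
have p2 := Cmod_ge_0 (iter (k' + k) CD (c xi) t).
have := Rmult_le_compat_r _ _ _ (Rmult_le_pos _ _ p2 p1) (hz xi); lra.
Qed.

(** The Fejer weights are kept although the series of u converges absolutely, so that u and f are
    truncated alike. *)
Definition psum M c y : C :=
  \big[Cplus/RtoC 0]_(xi <- box L M) (RtoC (wt M L xi) * cis (phase L xi y) * c xi (y ord0))%C.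

(** [freq xi]^2 >= 1 + xi_j^2 for each j, so 2n powers of the frequency pay for summability. *)
Lemma freq_pker xi : 1 <= freq xi ^ (2 * n) * \big[Rmult/1]_(j <- L) pker (xi j).
Proof.
have [l el] : exists l, l = L by exists L.
have -> : (2 * n)%N = (2 * size l)%N by rewrite el size_enum_ord.
rewrite -el; elim: l {el} => [|j l IH]; first by rewrite big_nil muln0 /=; lra.
rewrite [size _]/= mulnS pow_add big_cons.
have h : 1 <= freq xi ^ 2 * pker (xi j).
  rewrite /pker; apply/Rle_div_r; first by nra.
  have N1 : freq xi = 1 + enorm (ZtoR xi) by [].
  have hx := Rabs_le_enorm (ZtoR xi) j; have x0 := Rabs_pos (ZtoR xi j).
  have := pow_incr _ _ 2 (conj x0 hx); rewrite pow2_abs N1 -/(ZtoR xi j); nra.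
have -> : freq xi ^ 2 * freq xi ^ (2 * size l) * (pker (xi j) * \big[Rmult/1]_(j0 <- l) pker (xi j0)) =
 (freq xi ^ 2 * pker (xi j)) * (freq xi ^ (2 * size l) * \big[Rmult/1]_(j0 <- l) pker (xi j0)) by ring.
nra.
Qed.

Lemma pker_prod_ge0 xi : 0 <= \big[Rmult/1]_(j <- L) pker (xi j).
Proof. by apply: big_ind => [|x y ? ?|i _]; [lra|nra|exact/Rlt_le/pker_gt0]. Qed.

Lemma box_sum_freq M (a : ('I_n -> Z) -> C) B : 0 <= B ->
  (forall xi, Cmod (a xi) * freq xi ^ (2 * n) <= B) ->
  Cmod (\big[Cplus/RtoC 0]_(xi <- box L M) a xi) <= B * 5 ^ n.
Proof.
move=> B0 h; rewrite -[X in 5 ^ X](size_enum_ord n); apply: box_sum_bound => //; first exact: enum_uniq.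
move=> xi.
have h1 := freq_pker xi; have h2 := pker_prod_ge0 xi.
apply: Rle_trans (Rmult_le_compat_r _ _ _ h2 (h xi)).
have := Rmult_le_compat_l _ _ _ (Cmod_ge_0 (a xi)) h1; rewrite Rmult_1_r -Rmult_assoc; exact.
Qed.

Lemma psum_bound c B : 0 <= B -> (forall xi t, Cmod (c xi t) * freq xi ^ (2 * n) <= B) ->
  forall M y, Cmod (psum M c y) <= B * 5 ^ n.
Proof.
move=> B0 h M y; apply: box_sum_freq => // xi.
rewrite !Cmod_mult Cmod_cis Cmod_R Rabs_pos_eq; last by case: (wt_bounds M L xi).
have [w0 w1] := wt_bounds M L xi.
have p : 0 <= Cmod (c xi (y ord0)) * freq xi ^ (2 * n).
  by apply: Rmult_le_pos; [exact: Cmod_ge_0|apply: pow_le; have := freq_gt0 xi; lra].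
have := h xi (y ord0); have := Rmult_le_compat_r _ _ _ p w1; lra.
Qed.

Lemma gfam_psum_bound c : gfam c -> exists2 B, 0 <= B & forall M y, Cmod (psum M c y) <= B.
Proof.
move=> [_ hc]; have [K hK] := hc 0%N (2 * n)%N.
have m0 : 0 <= Rmax 0 K by apply: Rmax_l.
exists (Rmax 0 K * 5 ^ n); first by apply: Rmult_le_pos => //; apply: pow_le; lra.
apply: psum_bound => // xi t; exact: Rle_trans (hK xi t) (Rmax_r _ _).
Qed.

Lemma psum_cauchy c y : gfam c -> exists l, clim (fun M => psum M c y) l.
Proof.
(* 2n powers make the box sum bounded; the last one is spent on the difference of weights in
   [wt_dist]. *)
move=> [_ hc]; have [K hK] := hc 0%N (2 * n).+1.
pose B := 2 * INR n * Rmax 0 K.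
have m0 : 0 <= Rmax 0 K by apply: Rmax_l.
have n0 := pos_INR n.
have B0 : 0 <= B by rewrite /B; nra.
apply: (@clim_cauchy _ (B * 5 ^ n)) => M Q MQ.
have wide : psum M c y = \big[Cplus/RtoC 0]_(xi <- box L Q) (RtoC (wt M L xi) * cis (phase L xi y) * c xi (y ord0))%C.
  rewrite (box_widen MQ) ?enum_uniq // => xi j jl hj.
  by rewrite (wt_out jl hj); ring.
have -> : (psum M c y - psum Q c y)%C = \big[Cplus/RtoC 0]_(xi <- box L Q)
   (RtoC (wt M L xi - wt Q L xi) * cis (phase L xi y) * c xi (y ord0))%C.
  have -> : (psum M c y - psum Q c y)%C = (psum M c y + RtoC (-1) * psum Q c y)%C by ring.
  rewrite wide /psum csum_scal -big_split; apply: eq_bigr => xi _ /=.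
  by rewrite RtoC_minus; ring.
have pM : 0 < INR M.+1 by apply: lt_0_INR; lia.
have pQ : INR M.+1 <= INR Q.+1 by apply: INR_leq.
have iM : 0 < / INR M.+1 by apply: Rinv_0_lt_compat.
have iQ : / INR Q.+1 <= / INR M.+1 by apply: Rinv_le_contravar.
rewrite /Rdiv Rmult_assoc (Rmult_comm (5 ^ n)) -Rmult_assoc.
apply: box_sum_freq => [|xi]; first by apply: Rmult_le_pos; lra.
have N0 := freq_gt0 xi.
rewrite !Cmod_mult Cmod_cis Cmod_R Rmult_1_r.
have hw : Rabs (wt M L xi - wt Q L xi) <= 2 * INR n * freq xi * / INR M.+1.
  have := wt_dist M L xi; have := wt_dist Q L xi; rewrite size_enum_ord /Rdiv => h1 h2.
  have -> : wt M L xi - wt Q L xi = (1 - wt Q L xi) - (1 - wt M L xi) by ring.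
  apply: Rle_trans (Rabs_triang _ _) _; rewrite Rabs_Ropp.
  have : INR n * freq xi * / INR Q.+1 <= INR n * freq xi * / INR M.+1.
    by apply: Rmult_le_compat_l => //; apply: Rmult_le_pos; lra.
  lra.
have hk := hK xi (y ord0); rewrite /= -/(Cmod _) in hk.
set v := Cmod _ in hk *; have v0 : 0 <= v by exact: Cmod_ge_0.
have p2 : 0 <= freq xi ^ (2 * n) by apply: pow_le; lra.
have := Rmult_le_compat_r _ _ _ (Rmult_le_pos _ _ v0 p2) hw.
have : v * (freq xi * freq xi ^ (2 * n)) <= Rmax 0 K by apply: Rle_trans hk (Rmax_r _ _).
move=> h3; have := Rmult_le_compat_l (2 * INR n * / INR M.+1) _ _ ltac:(apply: Rmult_le_pos; lra) h3.
rewrite /B; lra.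
Qed.

(** [Lim_seq] is total; the value is known to be the limit only for a [gfam], through
    [fseries_clim]. *)
Definition fseries c y : C :=
  (real (Lim_seq (fun M => Re (psum M c y))), real (Lim_seq (fun M => Im (psum M c y)))).

Lemma fseries_clim c y : gfam c -> clim (fun M => psum M c y) (fseries c y).
Proof.
move=> gc; have [l [h1 h2]] := psum_cauchy y gc.
by split; rewrite /= ?(is_lim_seq_unique _ _ h1) ?(is_lim_seq_unique _ _ h2).
Qed.

Lemma phase_split xi y j r : phase L xi (upd y (xvar j) r) =
  IZR (xi j) * r + \big[Rplus/0]_(i <- L | i != j) (IZR (xi i) * y (xvar i)).
Proof.
rewrite /phase (bigD1_seq j) ?mem_enum ?enum_uniq //= upd_same; congr Rplus.
apply: eq_bigr => i ij; rewrite upd_neq //; apply: contra ij => /eqP /lift_inj ->; exact: eqxx.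
Qed.

Lemma psum_cderiv M c i y r : (forall xi, csmooth (c xi)) ->
  cderiv (fun t => psum M c (upd y i t)) r (psum M (famD i c) (upd y i r)).
Proof.
move=> sc; apply: cderiv_csum => xi.
case: (unliftP ord0 i) => [j ->|->].
- rewrite famDx.
  have o0 t : upd y (xvar j) t ord0 = y ord0 by rewrite upd_neq // neq_lift.
  have dph : is_derive (fun t => phase L xi (upd y (xvar j) t)) r (IZR (xi j)).
    apply: (is_derive_ext (fun t => IZR (xi j) * t + \big[Rplus/0]_(i <- L | i != j) (IZR (xi i) * y (xvar i)))).
      by move=> t; rewrite phase_split.
    by auto_derive => //; ring.
  have h := cderiv_mult (cderiv_scal (RtoC (wt M L xi)) (cderiv_cis dph)) (cderiv_const (c xi (y ord0)) r).
  apply: cderiv_ext (cderiv_eq h _) => [t|]; first by rewrite o0.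
  by rewrite o0; ring.
- rewrite famD0.
  have ph t : phase L xi (upd y ord0 t) = phase L xi y by apply: phase_upd_notin; exact: ord0_notin_xvar.
  have h := cderiv_scal (RtoC (wt M L xi) * cis (phase L xi y))%C (sc xi 0%N r).
  by apply: cderiv_ext (cderiv_eq h _) => [t|]; rewrite ph upd_same.
Qed.

(* A second-order Taylor bound, uniform in the order of the partial sum, passes
   to the pointwise limit; no uniform convergence is needed. *)
Lemma fseries_cderiv c i y r : gfam c ->
  cderiv (fun t => fseries c (upd y i t)) r (fseries (famD i c) (upd y i r)).
Proof.
move=> gc; have g1 := gfam_famD i gc; have g2 := gfam_famD i g1.
have [B B0 hB] := gfam_psum_bound g2.
(* 8 = 2 x 2 x 2: two mean value bounds and one passage to the limit, each costing a factor 2. *)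
have key b : Cmod (fseries c (upd y i b) - fseries c (upd y i r) - RtoC (b - r) * fseries (famD i c) (upd y i r)) <= 8 * B * (b - r) ^ 2.
  have lim := clim_minus (clim_minus (fseries_clim (upd y i b) gc) (fseries_clim (upd y i r) gc))
     (clim_scal (RtoC (b - r)) (fseries_clim (upd y i r) g1)).
  have -> : 8 * B * (b - r) ^ 2 = 2 * (4 * B * (b - r) ^ 2) by ring.
  apply: clim_bound lim _ => M.
  pose h t := (psum M c (upd y i t) - RtoC (t - r) * psum M (famD i c) (upd y i r))%C.
  have dh t : cderiv h t (psum M (famD i c) (upd y i t) - psum M (famD i c) (upd y i r))%C.
    apply: cderiv_minus; first by apply: psum_cderiv; case: gc.
    have dl : is_derive (fun t : R => t - r) t 1 by auto_derive => //; ring.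
    apply: cderiv_eq (cderiv_mult (cderiv_RtoC dl) (cderiv_const (psum M (famD i c) (upd y i r)) t)) _.
    ring.
  have -> : (psum M c (upd y i b) - psum M c (upd y i r) - RtoC (b - r) * psum M (famD i c) (upd y i r))%C = (h b - h r)%C.
    by rewrite /h Rminus_diag; ring.
  apply: (Rle_trans _ (2 * (2 * B * Rabs (b - r)) * Rabs (b - r))); last first.
    by rewrite -(pow2_abs (b - r)); apply: Req_le; ring.
  apply: (cderiv_bound_abs (df := fun t => (psum M (famD i c) (upd y i t) - psum M (famD i c) (upd y i r))%C)) => t ht.
  split=> //.
  apply: (Rle_trans _ (2 * B * Rabs (t - r))); last by apply: Rmult_le_compat_l => //; lra.
  apply: (cderiv_bound_abs (f := fun t => psum M (famD i c) (upd y i t)) (df := fun t => psum M (famD i (famD i c)) (upd y i t))) => x _.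
  by split=> //; apply: psum_cderiv; case: g1.
split; apply: (@is_derive_quadratic _ _ _ (8 * B)) => b.
- apply: Rle_trans (key b); apply: Rle_trans (Rabs_Re_le _); apply: Req_le; congr Rabs; rewrite /Re /=; ring.
- apply: Rle_trans (key b); apply: Rle_trans (Rabs_Im_le _); apply: Req_le; congr Rabs; rewrite /Im /=; ring.
Qed.

(** Replacing the coordinates one at a time turns separate Lipschitz bounds into joint
    continuity. *)
Lemma lipschitz_coordinates (N : nat) (F : ('I_N -> R) -> C) K : 0 <= K ->
  (forall i w r, Cmod (F (upd w i r) - F w) <= K * Rabs (r - w i)) ->
  forall w z d, (forall i, Rabs (z i - w i) <= d) -> Cmod (F z - F w) <= INR N * K * d.
Proof.
move=> K0 h w z d hd.
have H (l : seq 'I_N) (w0 : 'I_N -> R) : (forall i, Rabs (z i - w0 i) <= d) -> (forall i, i \notin l -> w0 i = z i) ->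
   Cmod (F z - F w0) <= INR (size l) * K * d.
  elim: l w0 => [|i l IH] w0 hd' hl.
    have -> : w0 = z by apply: functional_extensionality => i; exact: hl.
    by rewrite (_ : (F z - F z)%C = RtoC 0) ?Cmod_0 /=; [lra|ring].
  have d0 := Rle_trans _ _ _ (Rabs_pos _) (hd' i).
  have -> : (F z - F w0)%C = (F z - F (upd w0 i (z i)) + (F (upd w0 i (z i)) - F w0))%C by ring.
  apply: Rle_trans (Cmod_triangle _ _) _; rewrite [size _]/= S_INR.
  have h1 : Cmod (F z - F (upd w0 i (z i))) <= INR (size l) * K * d.
    apply: IH => k; rewrite /upd; case: eqP => [->|/eqP ki] //.
      by rewrite Rminus_diag Rabs_R0.
    by move=> kl; apply: hl; rewrite inE negb_or ki.
  have := h i w0 (z i); have := Rmult_le_compat_l _ _ _ K0 (hd' i); lra.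
by rewrite -(size_enum_ord N); apply: H => // i; rewrite mem_enum.
Qed.

Lemma fseries_bound c B : gfam c -> 0 <= B -> (forall xi t, Cmod (c xi t) * freq xi ^ (2 * n) <= B) ->
  forall y, Cmod (fseries c y) <= 2 * (B * 5 ^ n).
Proof. by move=> gc B0 h y; apply: clim_bound (fseries_clim y gc) _ => M; exact: psum_bound. Qed.

Lemma fseries_cont c y : gfam c -> continuous (fseries c) y.
Proof.
move=> gc.
have lip : exists2 K, 0 <= K & forall i z r, Cmod (fseries c (upd z i r) - fseries c z) <= K * Rabs (r - z i).
  have ex (i : 'I_n.+1) : exists K, 0 <= K /\ forall z r, Cmod (fseries c (upd z i r) - fseries c z) <= K * Rabs (r - z i).
    have [B B0 hB] := gfam_psum_bound (gfam_famD i gc).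
    exists (2 * (2 * B)); split; first lra.
    move=> z r; rewrite -{2}(upd_id z i).
    apply: (cderiv_bound_abs (f := fun t => fseries c (upd z i t)) (df := fun t => fseries (famD i c) (upd z i t))) => t _.
    split; first exact: fseries_cderiv.
    exact: clim_bound (fseries_clim _ (gfam_famD i gc)) _.
  pose K i := proj1_sig (constructive_indefinite_description _ (ex i)).
  have hK i : 0 <= K i /\ forall z r, Cmod (fseries c (upd z i r) - fseries c z) <= K i * Rabs (r - z i) := proj2_sig (constructive_indefinite_description _ (ex i)).
  have Ksum (l : seq 'I_n.+1) i : i \in l -> K i <= \big[Rplus/0]_(j <- l) K j.
    elim: l => //= j l IH; rewrite inE big_cons => /orP [/eqP ->|/IH].
      suff : 0 <= \big[Rplus/0]_(j0 <- l) K j0 by lra.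
      by apply: big_ind => [|? ? ? ?|k _]; [lra|lra|case: (hK k)].
    by move=> hS; have [? _] := hK j; lra.
  exists (\big[Rplus/0]_(j <- enum 'I_n.+1) K j).
    by apply: big_ind => [|? ? ? ?|k _]; [lra|lra|case: (hK k)].
  move=> i z r; have [_ h] := hK i; apply: Rle_trans (h z r) _.
  by apply: Rmult_le_compat_r; [exact: Rabs_pos|apply: Ksum; rewrite mem_enum].
have [K K0 hK] := lip.
have key (eps : posreal) : locally y (fun z => Cmod (fseries c z - fseries c y) < eps).
  have e0 := cond_pos eps; have n0 := pos_INR n.+1.
  have nk : 0 <= INR n.+1 * K by apply: Rmult_le_pos.
  have d0 : 0 < eps / (INR n.+1 * K + 1) by apply: Rdiv_lt_0_compat => //; lra.
  exists (mkposreal _ d0) => z hz.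
  apply: Rle_lt_trans (lipschitz_coordinates K0 hK (d := eps / (INR n.+1 * K + 1)) _) _.
    by move=> i; apply: Rlt_le; exact: (hz i).
  have -> : INR n.+1 * K * (eps / (INR n.+1 * K + 1)) = eps - eps / (INR n.+1 * K + 1).
    by field; lra.
  lra.
apply/ccontP; split; apply/filterlim_locally => eps; apply: filter_imp (key eps) => z hz.
- by apply: Rle_lt_trans (Rabs_Re_le _) hz.
- by apply: Rle_lt_trans (Rabs_Im_le _) hz.
Qed.

Lemma fseries_pderiv c i : gfam c ->
  (forall y, ex_pderiv i (fseries c) y) /\ pderiv i (fseries c) = fseries (famD i c).
Proof. by move=> gc; apply: pderiv_cderiv => y r; exact: fseries_cderiv. Qed.

Lemma fseries_smooth c : gfam c -> smooth (fseries c).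
Proof.
move=> gc; apply: (@smooth_coind _ (fun F => exists2 c, gfam c & F = fseries c)); last by exists c.
move=> F [c' gc' ->]; split=> [y|i]; first exact: fseries_cont.
have [h1 h2] := fseries_pderiv i gc'; split=> //.
by exists (famD i c') => //; exact: gfam_famD.
Qed.

Lemma foldr_pderiv_fseries (s : seq 'I_n.+1) c : gfam c ->
  gfam (foldr famD c s) /\ foldr (@pderiv n.+1) (fseries c) s = fseries (foldr famD c s).
Proof.
move=> gc; elim: s => //= i s [g ->]; split; first exact: gfam_famD.
by have [_ ->] := fseries_pderiv i g.
Qed.

Lemma fseries_periodic c : gfam c -> (forall xi, periodic (c xi)) -> torus_periodic (fseries c).
Proof.
move=> gc pc y k; apply: clim_unique (fseries_clim _ gc) _.
apply: clim_ext (fseries_clim y gc) => M; apply: eq_bigr => xi _.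
have perZ (g : R -> C) t (a : Z) : periodic g -> g (t + 2 * PI * IZR a) = g t.
  move=> pg.
  have nn (b : nat) x : g (x + 2 * PI * INR b) = g x.
    elim: b => [|b IH]; first by rewrite /= Rmult_0_r Rplus_0_r.
    by rewrite S_INR -IH -[RHS]pg; congr g; ring.
  have [b [->|->]] : exists b : nat, a = Z.of_nat b \/ a = (- Z.of_nat b)%Z by exists (Z.abs_nat a); lia.
  - by rewrite -INR_IZR_INZ nn.
  - by rewrite opp_IZR -INR_IZR_INZ -[LHS](nn b); congr g; ring.
rewrite (perZ (c xi)) //; congr (_ * _ * _)%C.
suff [a ->] : exists a : Z, phase L xi (fun j => y j + 2 * PI * IZR (k j)) = phase L xi y + 2 * PI * IZR a by rewrite cis_periodicZ.
rewrite /phase; elim: (enum 'I_n) => [|j l [a IH]]; first by exists 0%Z; rewrite !big_nil; ring.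
exists (a + xi j * k (xvar j))%Z; rewrite !big_cons IH plus_IZR mult_IZR; ring.
Qed.

Lemma mderiv_foldr (N : nat) (beta : 'I_N -> nat) : exists s : seq 'I_N,
  size s = mlength beta /\ forall f, mderiv beta f = foldr (@pderiv N) f s.
Proof.
rewrite /mlength /mderiv -big_enum /=.
elim: (enum 'I_N) => [|j l [s [e h]]]; first by exists [::]; rewrite big_nil.
exists (nseq (beta j) j ++ s); rewrite size_cat size_nseq big_cons e; split=> // f.
by rewrite foldr_cat -h /=; elim: (beta j) => //= k ->.
Qed.

Variables (m : nat -> R) (hm : weight_sequence m).

Lemma EMfam_gfam c : EMfam m c -> gfam c.
Proof. by move=> [sc _ [K [A [K0 A1 h]]]]; split=> // k b; eexists => xi t; exact: h. Qed.

(** A derivative of order p needs index p, and summation over frequencies another 2n; moderate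
    growth splits W_(p+2n) and turns W_(2n) into a constant. *)
Lemma fseries_EM c : EMfam m c -> class_EM m (fseries c).
Proof.
move=> hc; have gc := EMfam_gfam hc; have [sc pc [K [A [K0 A1 h]]]] := hc.
split; first exact: fseries_periodic.
split; first exact: fseries_smooth.
have [H [H1 hH]] := wfact_moderate hm.
pose W0 := wfact m (2 * n).
have W00 : 0 <= W0 by apply: (wfact_ge0 hm).
have AH1 : 1 <= A * H by nra.
pose K1 := K * (A * H) ^ (2 * n) * W0.
have K10 : 0 <= K1 by apply: Rmult_le_pos => //; apply: Rmult_le_pos => //; apply: pow_le; lra.
(* The added 1 makes the constant strictly positive, as [class_EM] demands. *)
exists (2 * (K1 * 5 ^ n) + 1), (A * H); split.
  have : 0 <= K1 * 5 ^ n by apply: Rmult_le_pos => //; apply: pow_le; lra.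
  lra.
split; first lra.
move=> beta y; have [s [es ->]] := mderiv_foldr beta.
have [gs ->] := foldr_pderiv_fseries s gc.
rewrite -es; set p := size s.
have [z [k [d [e hz hs hi]]]] := foldr_famD_form s sc.
have Wp := wfact_ge0 hm p.
have AHp : 0 <= (A * H) ^ p by apply: pow_le; lra.
have hb xi t : Cmod (foldr famD c s xi t) * freq xi ^ (2 * n) <= K1 * (A * H) ^ p * wfact m p.
  have := hi xi 0%N t; rewrite /= add0n => ->; rewrite Cmod_mult.
  have N0 := freq_gt0 xi.
  have pn : 0 <= freq xi ^ (2 * n) by apply: pow_le; lra.
  set v := Cmod (iter _ _ _ _); have v0 : 0 <= v by exact: Cmod_ge_0.
  apply: (Rle_trans _ (v * freq xi ^ (d + 2 * n))).
    rewrite (pow_add _ d (2 * n)); have := Rmult_le_compat_r _ _ _ (Rmult_le_pos _ _ v0 pn) (hz xi); lra.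
  apply: Rle_trans (h xi t k (d + 2 * n)%N) _.
  rewrite addnA e -/p.
  have Ap : 0 <= A ^ (p + 2 * n) by apply: pow_le; lra.
  apply: (Rle_trans _ (K * A ^ (p + 2 * n) * (H ^ (p + 2 * n) * wfact m p * W0))).
    by apply: Rmult_le_compat_l; [exact: Rmult_le_pos|exact: hH].
  by rewrite /K1 !(pow_add _ p (2 * n)) !Rpow_mult_distr; apply: Req_le; ring.
have B0 : 0 <= K1 * (A * H) ^ p * wfact m p by apply: Rmult_le_pos => //; exact: Rmult_le_pos.
apply: Rle_trans (fseries_bound gs B0 hb y) _.
apply: (Rle_trans _ ((2 * (K1 * 5 ^ n) + 1) * (A * H) ^ p * wfact m p)); last first.
  by rewrite /wfact; apply: Req_le; ring.
have X0 : 0 <= (A * H) ^ p * wfact m p by apply: Rmult_le_pos.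
have -> : (2 * (K1 * 5 ^ n) + 1) * (A * H) ^ p * wfact m p = (2 * (K1 * 5 ^ n)) * ((A * H) ^ p * wfact m p) + (A * H) ^ p * wfact m p by ring.
lra.
Qed.

End Series.

(** * Solvability *)

Lemma EMfun_of_class (m : nat -> R) (hm : weight_sequence m) (g : R -> R) : class_EM1_real m g -> EMfun m g.
Proof.
move=> [pg [sg [K [h [K0 [h0 hK]]]]]].
pose G (x : 'I_1 -> R) := RtoC (g (x ord0)).
have it k : iter k (@pderiv 1 ord0) G = fun x => RtoC (Derive_n g k (x ord0)).
  elim: k => // k IH; rewrite iterS IH; apply: functional_extensionality => x.
  apply: C_eq; last exact: Derive_const.
  change (Derive (fun r => Derive_n g k (upd x ord0 r ord0)) (x ord0) = Derive (Derive_n g k) (x ord0)).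
  by apply: Derive_ext => r; rewrite upd_same.
have sd k t : ex_derive (Derive_n g k) t.
  have := sg (nseq k ord0) (fun=> t); rewrite -/G.
  have -> : foldr (@pderiv 1) G (nseq k ord0) = iter k (@pderiv 1 ord0) G by elim: k => //= k ->.
  rewrite it => -[_ /(_ ord0) [h1 _]].
  by apply: ex_derive_ext h1 => r /=; rewrite upd_same.
split.
- by move=> k t; exact: Derive_correct.
- move=> t; have := pg (fun=> t) (fun=> 1%Z); rewrite Rmult_1_r.
  by move/RtoC_inj.
exists K, (Rmax 1 h); split; [lra|exact: Rmax_l|].
move=> k t; have := hK (fun=> k) (fun=> t).
have -> : mlength (fun _ : 'I_1 => k) = k by rewrite /mlength big_ord1.
have -> : mderiv (fun=> k) G = iter k (@pderiv 1 ord0) G.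
  by rewrite /mderiv enum_ordSl /= (size0nil (size_enum_ord 0)).
rewrite it Cmod_R => H; apply: Rle_trans H _.
have kp : h ^ k <= Rmax 1 h ^ k by apply: pow_incr; have := Rmax_r 1 h; lra.
rewrite Rmult_assoc; apply: Rmult_le_compat_r; first exact: (wfact_ge0 hm).
by apply: Rmult_le_compat_l; lra.
Qed.

Section BoxLinear.
Variables (n : nat) (l : seq 'I_n) (M : nat) (y : 'I_n.+1 -> R).

(** The truncation as a complex-linear functional of the coefficients at a fixed point; it reduces
    Pu = f to an identity between coefficients. *)
Definition boxlin (a : ('I_n -> Z) -> C) : C :=
  \big[Cplus/RtoC 0]_(xi <- box l M) (RtoC (wt M l xi) * cis (phase l xi y) * a xi)%C.

Lemma eq_boxlin a b : (forall xi, a xi = b xi) -> boxlin a = boxlin b.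
Proof. by move=> e; apply: eq_bigr => xi _; rewrite e. Qed.

Lemma boxlin_plus a b : boxlin (fun xi => a xi + b xi)%C = (boxlin a + boxlin b)%C.
Proof. by rewrite /boxlin -big_split; apply: eq_bigr => xi _ /=; ring. Qed.

Lemma boxlin_scal z a : boxlin (fun xi => z * a xi)%C = (z * boxlin a)%C.
Proof. by rewrite /boxlin csum_scal; apply: eq_bigr => xi _; ring. Qed.

Lemma boxlin_csum (I : Type) (s : seq I) (a : I -> ('I_n -> Z) -> C) :
  boxlin (fun xi => \big[Cplus/RtoC 0]_(i <- s) a i xi) = \big[Cplus/RtoC 0]_(i <- s) boxlin (a i).
Proof.
by rewrite /boxlin exchange_big; apply: eq_bigr => xi _; rewrite csum_scal.
Qed.

(** The box and the weights are even and the phase is odd, so conjugation acts as xi -> -xi; here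
    the conjugate term of P meets the coupling of opposite frequencies. *)
Lemma boxlin_conj a : Cconj (boxlin a) = boxlin (fun xi => Cconj (a (zopp xi))).
Proof.
rewrite /boxlin csum_conj -box_opp; apply: eq_bigr => xi _.
rewrite wt_opp phase_opp !Cmult_conj cis_conj Ropp_involutive.
by congr (_ * _ * _)%C; apply: C_eq => /=; ring.
Qed.

End BoxLinear.

Lemma osc_bounded_EM (m : nat -> R) n (f : ('I_n.+1 -> R) -> C) (j : 'I_n) :
  class_EM m f -> osc_bounded (lift ord0 j) f.
Proof.
move=> [pf [sf [K [h [_ [_ hK]]]]]].
have [e el] := mderiv_tx j 0 1 f.
apply: (osc_bounded_smooth sf pf) => y.
by have := hK _ y; rewrite -[pderiv _ f y]/(iter 0 (@pderiv n.+1 ord0) (iter 1 (@pderiv n.+1 (lift ord0 j)) f) y) -e; apply.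
Qed.

Theorem theorem4p1 (m : nat -> R) (hm : weight_sequence m)
  (n : nat) (hn : (0 < n)%N)
  (alpha : C) (halpha : alpha <> RtoC 0) (delta : R) (lam p0 : 'I_n -> R)
  (q s : R -> R) (hqE : class_EM1_real m q) (hsE : class_EM1_real m s)
  (hq : forall t, 0 <= q t)
  (rho : ('I_n -> Z) -> C)
  (hrho : forall xi : 'I_n -> Z,
     (rho xi ^ 2 = (RtoC (dotR lam (ZtoR xi)) - Ci * RtoC delta) ^ 2
                   + RtoC (Cmod alpha) ^ 2)%C /\
     0 <= Re (rho xi)) :
  let q0 : R := RInt q 0 (2 * PI) in
  let s0 : R := RInt s 0 (2 * PI) in
  let A0 := (RtoC s0 + Ci * RtoC delta * RtoC q0)%C in
  let B0 := (alpha * RtoC q0)%C in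
  let C0 := fun j : 'I_n =>
    (RtoC (2 * PI * p0 j) + Ci * RtoC (lam j) * RtoC q0)%C in
  0 < q0 ->
  Cmod alpha <> Rabs delta ->
  ~ (exists (xi : 'I_n -> Z) (tau : Z),
       Re (A0 * (RtoC (2 * PI * IZR tau)
                 + dotC (ZtoC xi) (fun j => Cconj (C0 j))))%C = 0 /\
       Cmod (RtoC (2 * PI * IZR tau) + dotC (ZtoC xi) C0)%C ^ 2
         = Cmod A0 ^ 2 - Cmod B0 ^ 2) ->
  (forall eps : R, 0 < eps ->
     exists Ceps geps : R, 0 < Ceps /\ 0 < geps /\
       forall xi : 'I_n -> Z, geps <= enorm (ZtoR xi) ->
         Ceps * real (Inf_seq (fun j : nat =>
                   Rbar.Finite (m j * INR j`!
                           / (eps ^ j * (1 + enorm (ZtoR xi)) ^ j))))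
         <= Rmin
              (Cmod (cexp (- rho xi * RtoC q0)
                     - cexp (RtoC s0
                             + Ci * RtoC (2 * PI * dotR (ZtoR xi) p0)))%C)
              (Cmod (RtoC 1
                     - cexp (- rho xi * RtoC q0 + RtoC s0
                             + Ci * RtoC (2 * PI * dotR (ZtoR xi) p0)))%C)) ->
  forall f : ('I_n.+1 -> R) -> C, class_EM m f ->
  exists u : ('I_n.+1 -> R) -> C, class_EM m u /\
    forall y : 'I_n.+1 -> R, opP alpha delta lam p0 q s u y = f y.
Proof.
move=> q0 s0 A0 B0 C0 q0_gt0 hI hII hIII f hf.
have eq := EMfun_of_class hm hqE; have es := EMfun_of_class hm hsE.
have ef := fhat_EMfam hm hn hf.
have [c hc ode] := solve_frequency_system hm halpha eq es hq hrho hI hII hIII ef.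
have gc := EMfam_gfam hc.
exists (fseries c); split; first exact: (fseries_EM hm).
move=> y; set t := y ord0.
have [pf [sf _]] := hf; have cf := smooth_cont sf.
have limf : clim (fun M => psum M (fhat f) y) (f y).
  apply: clim_of_dist => eps e0.
  have [M0 h] := iter_mean_converges (enum 'I_n) cf (fun j => osc_bounded_EM j hf) e0.
  exists M0 => M /h /(_ y); rewrite iter_mean_expand ?enum_uniq //.
  rewrite (_ : \big[Cplus/RtoC 0]_(xi <- _) _ = psum M (fhat f) y) //.
  by apply: eq_bigr => xi _; rewrite coef_fhat.
(* It remains to see that the truncated series of f also converge to Pu; they do, because for each M
   they equal P applied to the truncations of u. *)
apply: clim_unique limf.
rewrite /opP /opL (fseries_pderiv ord0 gc).2.
have lx : clim (fun M => \big[Cplus/RtoC 0]_(j < n) ((RtoC (p0 j) + Ci * RtoC (lam j) * RtoC (q t)) * psum M (famD (lift ord0 j) c) y)%C)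
   (\big[Cplus/RtoC 0]_(j < n) ((RtoC (p0 j) + Ci * RtoC (lam j) * RtoC (q t)) * pderiv (lift ord0 j) (fseries c) y)%C).
  apply: clim_csum => j; apply: clim_scal; rewrite (fseries_pderiv (lift ord0 j) gc).2.
  by apply: fseries_clim; exact: gfam_famD.
have l0 := fseries_clim y (gfam_famD ord0 gc); have lc := fseries_clim y gc.
apply: clim_ext (clim_minus (clim_minus (clim_minus l0 lx) (clim_scal (RtoC (s t) + Ci * RtoC delta * RtoC (q t))%C lc)) (clim_scal (alpha * RtoC (q t))%C (clim_conj lc))) => M.
pose A := @boxlin n (enum 'I_n) M y.
have pA c' : psum M c' y = A (fun xi => c' xi t) by [].
rewrite !pA /A boxlin_conj -/A.
under eq_bigr => j _ do rewrite pA /A -boxlin_scal.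
rewrite -boxlin_csum -!boxlin_scal /Cminus.
(* Negation is written as scaling, so that all terms collect under a single [boxlin]. *)
have neg a : (- boxlin (enum 'I_n) M y a)%C = boxlin (enum 'I_n) M y (fun xi => - RtoC 1 * a xi)%C.
  by rewrite boxlin_scal; ring.
rewrite !neg -!boxlin_plus; apply: eq_boxlin => xi.
rewrite famD0 (cderiv_unique (ode xi t)).
under eq_bigr => j _ do rewrite famDx.
have -> : \big[Cplus/RtoC 0]_(j < n) ((RtoC (p0 j) + Ci * RtoC (lam j) * RtoC (q t)) * (Ci * RtoC (IZR (xi j)) * c xi t))%C
  = ((Ci * RtoC (dotR (ZtoR xi) p0) - RtoC (q t) * RtoC (dotR lam (ZtoR xi))) * c xi t)%C.
  rewrite /dotR /ZtoR; elim/big_rec3: _ => [|j u v w _ ->]; first by ring.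
  rewrite !RtoC_plus !RtoC_mult.
  have ii : (Ci * Ci = - RtoC 1)%C by apply: C_eq => /=; ring.
  (* [ring] does not know that i^2 = -1; the intermediate form isolates Ci times Ci for
     rewriting. *)
  transitivity (((Ci * (RtoC (IZR (xi j)) * RtoC (p0 j))) + (Ci * Ci) * RtoC (q t) * (RtoC (lam j) * RtoC (IZR (xi j)))) * c xi t + (Ci * RtoC v - RtoC (q t) * RtoC u) * c xi t)%C; last by rewrite ii; ring.
  by ring.
ring.
Qed.
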